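(* The map $\vec{a} \mapsto \mathcal{U}(\mathfrak{L}(\vec{a}))$ is a bijection from the set of sequences $\vec{a} \in \mathbb{N}^{\mathbb{Z}_+}$ to the set of isomorphism classes of FGCCHAs, with inverse sending (the class of) an FGCCHA $H$ to $\phi_{h,a}(\overrightarrow{\dim}(H))$. In particular, a sequence $\vec{h} \in \mathbb{N}^{\mathbb{Z}_+}$ is the dimension sequence $\overrightarrow{\dim}(H)$ of some FGCCHA $H$ if and only if $\phi_{h,a}(\vec{h}) \in \mathbb{N}^{\mathbb{Z}_+}$. Similarly, $\vec{p} \in \mathbb{N}^{\mathbb{Z}_+}$ is the dimension sequence $\overrightarrow{\dim}(\mathcal{P}(H))$ of the primitives of some FGCCHA $H$ if and only if $\phi_{p,a}(\vec{p}) \in \mathbb{N}^{\mathbb{Z}_+}$.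
   Context: All vector spaces are over $\mathbb{C}$; $\mathbb{N}$ includes $0$, and $\mathbb{N}^{\mathbb{Z}_+}$ is the set of sequences $(c_1,c_2,\ldots)$ of nonnegative integers. An FGCCHA is a graded Hopf algebra $H = \bigoplus_{n\ge 0} H_n$ with $H_0 = \mathbb{C}$, each $H_n$ finite-dimensional, which is cocommutative and freely generated as an algebra by some graded subset $X = \biguplus_{n\ge1} X^{(n)}$, $X^{(n)}\subseteq H_n$ (so $H \cong \mathsf{T}(\mathbb{C}X)$ as graded algebras). Its dimension sequence is $\overrightarrow{\dim}(H) = (\dim H_n)_{n\ge1}$; $\mathcal{P}(H)$ is its graded space of primitive elements and $\overrightarrow{\dim}(\mathcal{P}(H)) = (\dim \mathcal{P}(H)_n)_{n \ge 1}$. Sequence transforms: rational sequences $\vec h, \vec a, \vec p$ are related if $1 + \sum_{k \ge 1} h_k t^k = \big(1 - \sum_{m\ge1} a_m t^m\big)^{-1} = \prod_{d\ge1}(1-t^d)^{-p_d}$ in $\mathbb{Q}[[t]]$, where $(1-t^d)^{-p} = \sum_{m\ge0}\binom{p+m-1}{m}t^{dm}$; each of the three determines the others uniquely. Write $\phi_{h,a}(\vec h) = \vec a$ and $\phi_{p,a}(\vec p) = \vec a$ for the resulting maps $\mathbb{Q}^{\mathbb{Z}_+}\to\mathbb{Q}^{\mathbb{Z}_+}$. For $\vec a \in \mathbb{N}^{\mathbb{Z}_+}$, let $X_{\vec a} = \biguplus_{n\ge1}\{x^{(n)}_i : 1 \le i \le a_n\}$ be a graded set with $x^{(n)}_i$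 of degree $n$, and let $\mathfrak{L}(\vec a)$ be the free Lie algebra on $X_{\vec a}$: the smallest graded subspace of the tensor algebra $\mathsf{T}(\mathbb{C}X_{\vec a})$ containing $X_{\vec a}$ and closed under the commutator $[x,y] = xy - yx$. $\mathcal{U}(L) = \mathsf{T}(L)/\langle x\otimes y - y\otimes x - [x,y] : x,y\in L\rangle$ is the universal enveloping algebra of a graded Lie algebra $L$, a graded cocommutative Hopf algebra in which every element of $L$ is primitive. *)

(* Defs.v *)
From HB Require Import structures.
From mathcomp Require Import all_boot all_order all_algebra.
From mathcomp Require Import generic_quotient ring_quotient finmap.
From mathcomp Require Import boolp classical_sets.
From mathcomp.multinomials Require Import monalg.

Set Implicit Arguments.
Unset Strict Implicit.
Unset Printing Implicit Defensive.

Import Order.TTheory GRing.Theory Num.Theory.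

Local Open Scope classical_set_scope.
Local Open Scope ring_scope.


Section Span.
Variables (K : fieldType) (V : lmodType K).
Implicit Types (S G : set V).

Definition subspace S : Prop := submod_closed (mem S).

Definition lspan G : set V := smallest subspace G.

Lemma subspaceP S :
  subspace S <-> S 0 /\ forall c x y, S x -> S y -> S (c *: x + y).
Proof.
split=> -[S0 SD]; split.
- by move: S0; rewrite inE.
- by move=> c x y Sx Sy; have := SD c x y; rewrite !inE; apply.
- by rewrite inE.
- by move=> c x y; rewrite !inE; apply: SD.
Qed.

Lemma subspace_lspan G : subspace (lspan G).
Proof.
apply/subspaceP; split=> [S [/subspaceP[]]//|c x y Gx Gy S SP].
have [/subspaceP[_ SD] _] := SP.
by apply: SD; [apply: Gx|apply: Gy].
Qed.

Definition lspan_pred G : {pred V} := fun x => x \in lspan G.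

Lemma lspan_zmod G : zmod_closed (lspan_pred G).
Proof.
have [S0 SD] := subspace_lspan G; split=> // x y xG yG.
by rewrite addrC -scaleN1r; apply: SD.
Qed.

HB.instance Definition _ G :=
  GRing.isZmodClosed.Build V (lspan_pred G) (lspan_zmod G).

Definition has_dim S (n : nat) : Prop :=
  exists e : 'I_n -> V, (forall i, S (e i)) /\
    forall x, S x -> exists! c : 'rV[K]_n, x = \sum_i c 0 i *: e i.

(* junk value 0 when [S] has infinite dimension *)
Definition dimension S : nat := xget 0%N [set n | has_dim S n].

End Span.

Section LinearExtension.
Variables (K : fieldType) (T : choiceType) (W : lmodType K).

Definition linext (h : T -> W) (x : {malg K[T]}) : W :=
  \sum_(k <- msupp x) x@_k *: h k.

Lemma linextEw h (x : {malg K[T]}) (D : {fset T}) :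
  (msupp x `<=` D)%fset -> linext h x = \sum_(k <- D) x@_k *: h k.
Proof.
move=> sxD; rewrite /linext (big_fset_incl _ sxD) //= => k _ kx.
by rewrite mcoeff_outdom ?scale0r.
Qed.

Lemma linext_linear h : linear (linext h).
Proof.
move=> c x y; pose D := (msupp (c *: x + y) `|` (msupp x `|` msupp y))%fset.
rewrite (@linextEw _ _ D) ?fsubsetUl//.
rewrite (@linextEw _ x D); last first.
  by apply: fsubset_trans (fsubsetUr _ _); apply: fsubsetUl.
rewrite (@linextEw _ y D); last first.
  by apply: fsubset_trans (fsubsetUr _ _); apply: fsubsetUr.
rewrite scaler_sumr -big_split /=; apply: eq_bigr => k _.
by rewrite mcoeffD mcoeffZ scalerDl scalerA.
Qed.

HB.instance Definition _ h :=
  GRing.isLinear.Build K {malg K[T]} W _ (linext h) (linext_linear h).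

Lemma linextU h k : linext h << k >> = h k.
Proof. by rewrite /linext msuppU oner_eq0 big_seq_fset1 mcoeffUU scale1r. Qed.

Lemma linextD h h1 h2 c x : (forall k, h k = c *: h1 k + h2 k) ->
  linext h x = c *: linext h1 x + linext h2 x.
Proof.
move=> hE; rewrite /linext scaler_sumr -big_split /=.
by apply: eq_bigr => k _; rewrite hE scalerDr !scalerA mulrC.
Qed.

End LinearExtension.

(* Unfolding this constant, or those made opaque below, makes failing
   unifications very slow. *)
#[global] Opaque linext.

Section QuotientModule.
Variables (K : fieldType) (V : lmodType K) (G : set V).
Local Notation I := (lspan_pred G).

Definition lquot_type := Quotient.quot I.

HB.instance Definition _ := GRing.Zmodule.on lquot_type.

Let to_quot (x : V) : lquot_type := (\pi_(Quotient.quot I) x)%qT.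
Let of_quot (x : lquot_type) : V := repr x.

Let of_quotK : cancel of_quot to_quot.
Proof. exact: reprK. Qed.

Let to_quotP x y : to_quot x = to_quot y <-> lspan G (x - y).
Proof.
rewrite -[lspan G _]in_setE -/(I (x - y)) -[I _]/(_ \in I).
by rewrite (Quotient.idealrBE I); split=> /eqP.
Qed.

Let to_quotD : {morph to_quot : x y / x + y}.
Proof. by move=> x y; rewrite /to_quot raddfD. Qed.

Definition lquot_scale (c : K) (x : lquot_type) : lquot_type :=
  to_quot (c *: of_quot x).

Let scaleE c x : lquot_scale c (to_quot x) = to_quot (c *: x).
Proof.
apply/to_quotP; rewrite -scalerBr -[_ *: _]addr0.
have /subspaceP[G0 GD] := subspace_lspan G; apply: GD => //.
by apply/to_quotP; rewrite of_quotK.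
Qed.

Fact lquot_scaleA a b v :
  lquot_scale a (lquot_scale b v) = lquot_scale (a * b) v.
Proof. by rewrite -[v]of_quotK !scaleE scalerA. Qed.

Fact lquot_scale1 : left_id 1 lquot_scale.
Proof. by move=> v; rewrite -[v]of_quotK scaleE scale1r. Qed.

Fact lquot_scaleDr : right_distributive lquot_scale +%R.
Proof.
move=> c u v; rewrite -[u]of_quotK -[v]of_quotK.
by rewrite -to_quotD !scaleE -to_quotD scalerDr.
Qed.

Fact lquot_scaleDl v : {morph lquot_scale^~ v : a b / a + b}.
Proof.
by move=> a b; rewrite -[v]of_quotK !scaleE -to_quotD scalerDl.
Qed.

HB.instance Definition _ := GRing.Zmodule_isLmodule.Build K lquot_type
  lquot_scaleA lquot_scale1 lquot_scaleDr lquot_scaleDl.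

Fact lquot_proj_linear : linear to_quot.
Proof. by move=> c x y; rewrite to_quotD -scaleE. Qed.

HB.instance Definition _ := GRing.isLinear.Build K V lquot_type _ to_quot
  lquot_proj_linear.

(* V / span(G), as a space with a linear surjection from V of kernel span(G) *)
Record quotient_space := QuotientSpace {
  qs_sort : lmodType K;
  qs_proj : {linear V -> qs_sort};
  qs_repr : qs_sort -> V;
  qs_reprK : cancel qs_repr qs_proj;
  qs_projP : forall x y, qs_proj x = qs_proj y <-> lspan G (x - y)
}.

(* Opaque on purpose: unfolding the quotient makes unification very slow. *)
Definition quotient_space_exists : quotient_space.
Proof. exact: (@QuotientSpace lquot_type to_quot of_quot of_quotK to_quotP). Qed.

End QuotientModule.

Section QuotientModuleTheory.
Variables (K : fieldType) (V : lmodType K) (G : set V).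

Definition lquot : lmodType K := qs_sort (quotient_space_exists G).
Definition to_lquot : {linear V -> lquot} := qs_proj (quotient_space_exists G).
Definition of_lquot : lquot -> V := @qs_repr _ _ _ (quotient_space_exists G).

Lemma of_lquotK : cancel of_lquot to_lquot.
Proof. exact: qs_reprK. Qed.

Lemma to_lquotP x y : to_lquot x = to_lquot y <-> lspan G (x - y).
Proof. exact: qs_projP. Qed.

End QuotientModuleTheory.


Section Tensor.
Variables (K : fieldType) (U V : lmodType K).

Definition tensor_relations : set {malg K[(U * V)%type]} :=
  [set z | exists c u u' v,
     z = << (c *: u + u', v) >> - (c *: << (u, v) >> + << (u', v) >>)] `|`
  [set z | exists c u v v',
     z = << (u, c *: v + v') >> - (c *: << (u, v) >> + << (u, v') >>)].

Definition tensor : lmodType K := lquot tensor_relations.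

Definition tens (u : U) (v : V) : tensor := to_lquot _ << (u, v) >>.

Definition bilinear_map (W : lmodType K) (b : U -> V -> W) : Prop :=
  (forall v, linear (b^~ v)) /\ (forall u, linear (b u)).

(* The map induced by a bilinear [b]; meaningless if [b] is not bilinear. *)
Definition tlift (W : lmodType K) (b : U -> V -> W) (t : tensor) : W :=
  linext (fun p : U * V => b p.1 p.2) (of_lquot t).

Lemma tens_bilinear : bilinear_map tens.
Proof.
split=> [v c u u'|u c v v']; rewrite /tens -linearP; apply/to_lquotP.
  by apply: sub_gen_smallest; left; exists c, u, u', v.
by apply: sub_gen_smallest; right; exists c, u, v, v'.
Qed.

Lemma tlift_linear_map (W : lmodType K) (b b1 b2 : U -> V -> W) c t :
  (forall u v, b u v = c *: b1 u v + b2 u v) ->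
  tlift b t = c *: tlift b1 t + tlift b2 t.
Proof.
by move=> bE; apply: linextD => p; apply: bE.
Qed.

Section Lift.
Variables (W : lmodType K) (b : U -> V -> W).
Hypothesis bP : bilinear_map b.

Lemma tlift_to x :
  tlift b (to_lquot _ x) = linext (fun p : U * V => b p.1 p.2) x.
Proof.
pose f : {linear {malg K[(U * V)%type]} -> W} :=
  linext (fun p : U * V => b p.1 p.2).
rewrite /tlift -![linext _ _]/(f _); apply/eqP; rewrite -subr_eq0 -linearB; apply/eqP => /=.
set z := _ - _; have: lspan tensor_relations z.
  by apply/to_lquotP; rewrite of_lquotK.
move: z; apply: (@smallest_sub _ _ _ [set z | f z = 0]).
  apply/subspaceP; split=> [|c x' y'] /= => [|fx fy]; first by rewrite linear0.
  by rewrite linearP /= fx fy scaler0 addr0.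
case: bP => bl br.
move=> z [[c [u [u' [v ->]]]]|[c [u [v [v' ->]]]]] /=;
  by rewrite linearB linearP /= !linextU /= ?bl ?br subrr.
Qed.

Lemma tlift_linear : linear (tlift b).
Proof.
move=> c s t; rewrite -[s]of_lquotK -[t]of_lquotK -linearP.
by rewrite !tlift_to linearP.
Qed.

Lemma tliftE u v : tlift b (tens u v) = b u v.
Proof. by rewrite tlift_to linextU. Qed.

End Lift.

Lemma tensor_ind (P : tensor -> Prop) : P 0 ->
  (forall c u v t, P t -> P (c *: tens u v + t)) -> forall t, P t.
Proof.
move=> P0 PD t; rewrite -[t]of_lquotK [of_lquot t]monalgE.
elim: (X in \sum_(_ <- X) _) => [|[u v] s IH]; first by rewrite big_nil linear0.
rewrite big_cons linearD /=.
have -> : << (of_lquot t)@_(u, v) *g (u, v) >> =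
          (of_lquot t)@_(u, v) *: << (u, v) >> :> {malg K[(U * V)%type]}.
  by apply/malgP => k; rewrite mcoeffZ 2!mcoeffU mulr_natr.
rewrite linearZ; exact: PD.
Qed.

Lemma tensor_ext (W : lmodType K) (f g : tensor -> W) : linear f -> linear g ->
  (forall u v, f (tens u v) = g (tens u v)) -> f =1 g.
Proof.
move=> fl gl fg; have f0 (h : tensor -> W) : linear h -> h 0 = 0.
  by move=> hl; have := hl (-1) 0 0; rewrite !(scaleN1r, oppr0, addr0) addNr.
elim/tensor_ind => [|c u v t IH]; first by rewrite !f0.
by rewrite fl gl fg IH.
Qed.

End Tensor.

Notation "u ⊗ v" := (tens u v) (at level 45, left associativity) : ring_scope.

#[global] Opaque tens tlift.

Section TensorMaps.
Variable K : fieldType.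
Implicit Types U V W : lmodType K.

Definition tmap U V U' V' (f : U -> U') (g : V -> V') :
    tensor U V -> tensor U' V' :=
  tlift (fun u v => f u ⊗ g v).

Definition tassoc U V W : tensor (tensor U V) W -> tensor U (tensor V W) :=
  tlift (fun t w => tlift (fun u v => u ⊗ (v ⊗ w)) t).

Definition tswap U V : tensor U V -> tensor V U := tlift (fun u v => v ⊗ u).

End TensorMaps.

Section TensorAlgebraStructure.
Variables (K : fieldType) (A B : algType K).

(* No sign rule: (a ⊗ b) (a' ⊗ b') = (a a') ⊗ (b b') in all degrees. *)
Definition tensor_mul (s t : tensor A B) : tensor A B :=
  tlift (fun a b => tlift (fun a' b' => (a * a') ⊗ (b * b')) t) s.

Let tl := (@tens_bilinear K A B).1.
Let tr := (@tens_bilinear K A B).2.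

Let inner_bil a b :
  bilinear_map (fun (a' : A) (b' : B) => (a * a') ⊗ (b * b')).
Proof.
split=> [v c u u'|u c v v']; first by rewrite mulrDr -scalerAr tl.
by rewrite mulrDr -scalerAr tr.
Qed.

Let outer_bil (t : tensor A B) : bilinear_map
  (fun a b => tlift (fun (a' : A) (b' : B) => (a * a') ⊗ (b * b')) t).
Proof.
split=> [v c u u'|u c v v']; apply: tlift_linear_map => a b.
  by rewrite mulrDl -scalerAl tl.
by rewrite mulrDl -scalerAl tr.
Qed.

Lemma tensor_mulE a b a' b' :
  tensor_mul (a ⊗ b) (a' ⊗ b') = (a * a') ⊗ (b * b').
Proof. by rewrite /tensor_mul (tliftE (outer_bil _)) (tliftE (inner_bil _ _)). Qed.

Lemma tensor_mulPl c s s' t :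
  tensor_mul (c *: s + s') t = c *: tensor_mul s t + tensor_mul s' t.
Proof. exact: (tlift_linear (outer_bil t)). Qed.

Lemma tensor_mulPr c s t t' :
  tensor_mul s (c *: t + t') = c *: tensor_mul s t + tensor_mul s t'.
Proof.
apply: tlift_linear_map => a b.
exact: (tlift_linear (inner_bil a b)).
Qed.

Let mulPl_linear t : linear (tensor_mul^~ t).
Proof. by move=> c s s'; apply: tensor_mulPl. Qed.

Let mulPr_linear s : linear (tensor_mul s).
Proof. by move=> c t t'; apply: tensor_mulPr. Qed.

Let comp_linear (X Y Z : lmodType K) (g : Y -> Z) (f : X -> Y) :
  linear g -> linear f -> linear (fun x => g (f x)).
Proof. by move=> gl fl c x y; rewrite fl gl. Qed.

Fact tensor_mulA : associative tensor_mul.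
Proof.
move=> s t r; pose f := tensor_mul^~ (tensor_mul t r).
pose g s := tensor_mul (tensor_mul s t) r.
apply: (@tensor_ext _ _ _ _ f g) s => [||a b]; rewrite /f /g {f g}.
- exact: mulPl_linear.
- exact: comp_linear (mulPl_linear r) (mulPl_linear t).
pose f t := tensor_mul (a ⊗ b) (tensor_mul t r).
pose g t := tensor_mul (tensor_mul (a ⊗ b) t) r.
apply: (@tensor_ext _ _ _ _ f g) t => [||a' b']; rewrite /f /g {f g}.
- exact: comp_linear (mulPr_linear _) (mulPl_linear r).
- exact: comp_linear (mulPl_linear r) (mulPr_linear _).
pose f r := tensor_mul (a ⊗ b) (tensor_mul (a' ⊗ b') r).
pose g r := tensor_mul (tensor_mul (a ⊗ b) (a' ⊗ b')) r.
apply: (@tensor_ext _ _ _ _ f g) r => [||a'' b'']; rewrite /f /g {f g}.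
- exact: comp_linear (mulPr_linear _) (mulPr_linear _).
- exact: mulPr_linear.
by rewrite !tensor_mulE !mulrA.
Qed.

Fact tensor_mul1t : left_id (1 ⊗ 1) tensor_mul.
Proof.
move=> t; apply: (@tensor_ext _ _ _ _ (tensor_mul (1 ⊗ 1)) id) => // a b.
by rewrite tensor_mulE !mul1r.
Qed.

Fact tensor_mult1 : right_id (1 ⊗ 1) tensor_mul.
Proof.
move=> t; apply: (@tensor_ext _ _ _ _ (tensor_mul^~ (1 ⊗ 1)) id) => // a b.
by rewrite tensor_mulE !mulr1.
Qed.

Fact tensor_mulDl : left_distributive tensor_mul +%R.
Proof.
by move=> s s' t; have := tensor_mulPl 1 s s' t; rewrite !scale1r.
Qed.

Fact tensor_mulDr : right_distributive tensor_mul +%R.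
Proof.
by move=> s t t'; have := tensor_mulPr 1 s t t'; rewrite !scale1r.
Qed.

End TensorAlgebraStructure.

#[global] Opaque tensor_mul.


Section QuotientAlgebra.
Variables (K : fieldType) (A : algType K).

Definition two_sided_ideal (S : set A) : Prop :=
  subspace S /\ forall a x, S x -> S (a * x) /\ S (x * a).

Definition ideal_gen (G : set A) : set A := smallest two_sided_ideal G.

Lemma ideal_gen_ideal G : two_sided_ideal (ideal_gen G).
Proof.
split.
  apply/subspaceP; split=> [S [[/subspaceP[]]]//|c x y Gx Gy S SP].
  have [[/subspaceP[_ SD] _] _] := SP.
  by apply: SD; [apply: Gx|apply: Gy].
by move=> a x Gx; split=> S SP; have [[_ SM] _] := SP;
  apply (SM a x); apply: Gx.
Qed.

Lemma lspan_ideal_gen G : lspan (ideal_gen G) = ideal_gen G.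
Proof. by apply: smallest_id; have [] := ideal_gen_ideal G. Qed.

Variables (G : set A) (proper : ~ ideal_gen G 1).

Definition alg_quot_type of ~ ideal_gen G 1 := GRing.Lmodule.sort (lquot (ideal_gen G)).
Local Notation Q := (alg_quot_type proper).

HB.instance Definition _ := GRing.Lmodule.on Q.

Let to_quot (a : A) : Q := to_lquot (ideal_gen G) a.
Let of_quot (q : Q) : A := of_lquot q.

Let of_quotK : cancel of_quot to_quot.
Proof. exact: of_lquotK. Qed.

Let to_quotP x y : to_quot x = to_quot y <-> ideal_gen G (x - y).
Proof. by rewrite -[X in X (x - y)]lspan_ideal_gen; exact: to_lquotP. Qed.

Let to_quotD x y : to_quot (x + y) = to_quot x + to_quot y.
Proof. exact: (linearD (to_lquot (ideal_gen G))). Qed.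

Let to_quotZ c x : to_quot (c *: x) = c *: to_quot x.
Proof. exact: (linearZ_LR (to_lquot (ideal_gen G))). Qed.

Let to_quot0 : to_quot 0 = 0.
Proof. exact: (linear0 (to_lquot (ideal_gen G))). Qed.

Definition quot_mul (x y : Q) : Q := to_quot (of_quot x * of_quot y).

Let mulE a b : quot_mul (to_quot a) (to_quot b) = to_quot (a * b).
Proof.
have [/subspaceP[_ GD] GM] := ideal_gen_ideal G.
apply/to_quotP; set a' := of_quot _; set b' := of_quot _.
have Ga : ideal_gen G (a' - a) by apply/to_quotP; rewrite of_quotK.
have Gb : ideal_gen G (b' - b) by apply/to_quotP; rewrite of_quotK.
have -> : a' * b' - a * b = 1 *: ((a' - a) * b') + a * (b' - b).
  by rewrite scale1r mulrBl mulrBr addrA subrK.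
by apply: GD; [apply: (GM _ _ Ga).2|apply: (GM _ _ Gb).1].
Qed.

Fact quot_mulA : associative quot_mul.
Proof.
move=> x y z; rewrite -[x]of_quotK -[y]of_quotK -[z]of_quotK.
by rewrite !mulE mulrA.
Qed.

Fact quot_mul1 : left_id (to_quot 1) quot_mul.
Proof. by move=> x; rewrite -[x]of_quotK mulE mul1r. Qed.

Fact quot_mulr1 : right_id (to_quot 1) quot_mul.
Proof. by move=> x; rewrite -[x]of_quotK mulE mulr1. Qed.

Fact quot_mulDl : left_distributive quot_mul +%R.
Proof.
move=> x y z; rewrite -[x]of_quotK -[y]of_quotK -[z]of_quotK.
by rewrite -to_quotD !mulE -to_quotD mulrDl.
Qed.

Fact quot_mulDr : right_distributive quot_mul +%R.
Proof.
move=> x y z; rewrite -[x]of_quotK -[y]of_quotK -[z]of_quotK.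
by rewrite -to_quotD !mulE -to_quotD mulrDr.
Qed.

Fact quot_oner_neq0 : to_quot 1 != 0.
Proof.
apply/eqP; rewrite -to_quot0 => /to_quotP; rewrite subr0.
exact: proper.
Qed.

HB.instance Definition _ := GRing.Zmodule_isNzRing.Build Q
  quot_mulA quot_mul1 quot_mulr1 quot_mulDl quot_mulDr quot_oner_neq0.

Fact quot_scaleAl c (x y : Q) : c *: (x * y) = (c *: x) * y.
Proof.
rewrite -[x]of_quotK -[y]of_quotK -to_quotZ -[LHS]/(_ *: quot_mul _ _).
by rewrite -[RHS]/(quot_mul _ _) !mulE -to_quotZ scalerAl.
Qed.

HB.instance Definition _ := GRing.Lmodule_isLalgebra.Build K Q quot_scaleAl.

Fact quot_scaleAr c (x y : Q) : c *: (x * y) = x * (c *: y).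
Proof.
rewrite -[x]of_quotK -[y]of_quotK -to_quotZ -[LHS]/(_ *: quot_mul _ _).
by rewrite -[RHS]/(quot_mul _ _) !mulE -to_quotZ scalerAr.
Qed.

HB.instance Definition _ := GRing.Lalgebra_isAlgebra.Build K Q quot_scaleAr.

Fact alg_quot_proj_linear : linear to_quot.
Proof. by move=> c x y; rewrite to_quotD to_quotZ. Qed.

HB.instance Definition _ :=
  GRing.isLinear.Build K A Q _ to_quot alg_quot_proj_linear.

Fact alg_quot_proj_monoid_morphism : monoid_morphism to_quot.
Proof. by split=> // a b; rewrite -mulE. Qed.

HB.instance Definition _ := GRing.isMonoidMorphism.Build A Q
  to_quot alg_quot_proj_monoid_morphism.

(* A / <G>, as an algebra with an algebra surjection from A of kernel <G> *)
Record quotient_algebra := QuotientAlgebra {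
  qa_sort : algType K;
  qa_proj : {lrmorphism A -> qa_sort};
  qa_repr : qa_sort -> A;
  qa_reprK : cancel qa_repr qa_proj;
  qa_projP : forall x y, qa_proj x = qa_proj y <-> ideal_gen G (x - y)
}.

(* mathcomp algebras are nontrivial, hence the properness argument *)
Definition quotient_algebra_exists : quotient_algebra.
Proof. exact: (@QuotientAlgebra Q to_quot of_quot of_quotK to_quotP). Qed.

End QuotientAlgebra.

Section QuotientAlgebraTheory.
Variables (K : fieldType) (A : algType K) (G : set A).
Variable proper : ~ ideal_gen G 1.

Definition alg_quot : algType K := qa_sort (quotient_algebra_exists proper).
Definition to_alg_quot : {lrmorphism A -> alg_quot} :=
  qa_proj (quotient_algebra_exists proper).
Definition of_alg_quot : alg_quot -> A :=
  @qa_repr _ _ _ (quotient_algebra_exists proper).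

Lemma of_alg_quotK : cancel of_alg_quot to_alg_quot.
Proof. exact: qa_reprK. Qed.

Lemma to_alg_quotP x y :
  to_alg_quot x = to_alg_quot y <-> ideal_gen G (x - y).
Proof. exact: qa_projP. Qed.

End QuotientAlgebraTheory.


Section FreeAlgebra.
Variables (K : fieldType) (I : choiceType).

Definition freealg_type := {malg K[{fmonom I}]}.

HB.instance Definition _ := GRing.Lalgebra.on freealg_type.

Fact freealg_scaleAr c (x y : {malg K[{fmonom I}]}) : c *: (x * y) = x * (c *: y).
Proof.
apply/malgP => k; rewrite mcoeffZ (mcoeffMl x y).
rewrite (@mcoeffMlw _ _ (msupp x) (msupp y)) ?msuppZ_le// mulr_sumr.
apply: eq_bigr => u _; rewrite mulr_sumr; apply: eq_bigr => v _.
by rewrite mcoeffZ mulrnAr mulrCA.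
Qed.

HB.instance Definition _ := GRing.Lalgebra_isAlgebra.Build K freealg_type
  freealg_scaleAr.

(* noncommutative polynomials, i.e. the tensor algebra on the space with basis I *)
Definition freealg : algType K := freealg_type.

Definition word (w : {fmonom I}) : freealg := (<< w >> : {malg K[{fmonom I}]}).

Definition gen (i : I) : freealg := word (fmu i).

(* coefficient of the empty word *)
Definition freealg_aug (x : freealg) : K :=
  (x : {malg K[{fmonom I}]})@_mone.

Definition freealg_linext (W : lmodType K) (h : {fmonom I} -> W)
    (x : freealg) : W :=
  linext h (x : {malg K[{fmonom I}]}).

Lemma freealg_aug_scalar : scalar freealg_aug.
Proof. by move=> c x y; rewrite /freealg_aug mcoeffD mcoeffZ. Qed.

Lemma freealg_augM : {morph freealg_aug : x y / x * y}.
Proof. exact: (rmorphM (@mcoeff {fmonom I} K mone)). Qed.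

Lemma freealg_aug1 : freealg_aug 1 = 1.
Proof. exact: (rmorph1 (@mcoeff {fmonom I} K mone)). Qed.

Lemma freealg_aug_gen i : freealg_aug (gen i) = 0.
Proof. by rewrite /freealg_aug [LHS]mcoeffU1 fm1_eq1. Qed.

Lemma wordM v w : word v * word w = word (mmul v w).
Proof. by rewrite [LHS]fgmulUU mulr1. Qed.

Section Ext.
Variable W : lmodType K.

Lemma freealg_linext_linear h : linear (@freealg_linext W h).
Proof. exact: linext_linear. Qed.

Lemma freealg_linextE h w : @freealg_linext W h (word w) = h w.
Proof. exact: linextU. Qed.

Lemma freealg_ext (f g : freealg -> W) : linear f -> linear g ->
  (forall w, f (word w) = g (word w)) -> f =1 g.
Proof.
move=> fl gl fg x; have f0 (h : freealg -> W) : linear h -> h 0 = 0.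
  by move=> hl; have := hl (-1) 0 0; rewrite !(scaleN1r, oppr0, addr0) addNr.
rewrite [x](@monalgE {fmonom I} K).
elim: (X in \sum_(_ <- X) _) => [|w s IH]; first by rewrite big_nil !f0.
rewrite big_cons; set c := (x : {malg K[_]})@_w.
have -> : << c *g w >> = c *: word w.
  by apply/malgP => k; rewrite mcoeffZ 2!mcoeffU mulr_natr.
by rewrite fl gl fg IH.
Qed.

End Ext.

End FreeAlgebra.

#[global] Opaque freealg word freealg_aug freealg_linext.

Section Enveloping.
Variables (K : fieldType) (L : lmodType K) (br : L -> L -> L).

(* T(L) is presented by the underlying set of L as generators, subject to the
   linear relations holding in L *)
Definition tensor_alg_relations : set (freealg K L) :=
  [set z | exists c x y, z = gen K (c *: x + y) - (c *: gen K x + gen K y)].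

Let ideal_gen_ker0 (A : algType K) (W : lmodType K) (mulW : W -> W -> W)
    (f : A -> W) (G : set A) :
  left_zero 0 mulW -> right_zero 0 mulW -> linear f ->
  (forall x y, f (x * y) = mulW (f x) (f y)) -> (forall x, G x -> f x = 0) ->
  forall x, ideal_gen G x -> f x = 0.
Proof.
move=> m0 m1 fl fM fG; apply: (@smallest_sub _ _ _ [set x | f x = 0]) => //.
split; last by move=> a x /= fx; rewrite !fM fx m0 m1.
apply/subspaceP; split=> [/=|c x y /= fx fy].
  by have := fl (-1) 0 0; rewrite !(scaleN1r, oppr0, addr0) addNr.
by rewrite fl fx fy scaler0 addr0.
Qed.

Let ideal_gen_ker (A : algType K) (f : A -> K) (G : set A) :
  scalar f -> {morph f : x y / x * y} -> (forall x, G x -> f x = 0) ->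
  forall x, ideal_gen G x -> f x = 0.
Proof.
move=> fl fM; apply: (@ideal_gen_ker0 A K^o *%R f) => //.
- exact: mul0r.
- exact: mulr0.
Qed.

Let scalarB (A : algType K) (f : A -> K) x y : scalar f -> f (x - y) = f x - f y.
Proof. by move=> fl; rewrite addrC -scaleN1r fl mulN1r addrC. Qed.

Let freealg_aug_relations x :
  ideal_gen tensor_alg_relations x -> freealg_aug x = 0.
Proof.
apply: (ideal_gen_ker (@freealg_aug_scalar K L) (@freealg_augM K L)).
move=> _ [c [u [v ->]]]; rewrite scalarB; last exact: freealg_aug_scalar.
by rewrite freealg_aug_scalar !freealg_aug_gen mulr0 addr0 subr0.
Qed.

Fact tensor_alg_proper : ~ ideal_gen tensor_alg_relations 1.
Proof.
by move=> /freealg_aug_relations; rewrite freealg_aug1; apply/eqP/oner_neq0.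
Qed.

Definition tensor_alg : algType K := alg_quot tensor_alg_proper.

Definition tgen (x : L) : tensor_alg := to_alg_quot tensor_alg_proper (gen K x).

Definition env_relations : set tensor_alg :=
  [set z | exists x y, z = tgen x * tgen y - tgen y * tgen x - tgen (br x y)].

Let aug (t : tensor_alg) : K := freealg_aug (of_alg_quot t).

Let augE x : aug (to_alg_quot tensor_alg_proper x) = freealg_aug x.
Proof.
rewrite /aug; apply/eqP; rewrite -subr_eq0.
rewrite -(scalarB _ _ (@freealg_aug_scalar K L)).
by apply/eqP/freealg_aug_relations/(to_alg_quotP tensor_alg_proper);
   rewrite of_alg_quotK.
Qed.

Let aug_scalar : scalar aug.
Proof.
move=> c x y; rewrite -[x]of_alg_quotK -[y]of_alg_quotK.
by rewrite -linearP !augE freealg_aug_scalar.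
Qed.

Let augM : {morph aug : x y / x * y}.
Proof.
move=> x y; rewrite -[x]of_alg_quotK -[y]of_alg_quotK.
by rewrite -rmorphM !augE freealg_augM.
Qed.

Fact env_proper : ~ ideal_gen env_relations 1.
Proof.
move=> /(ideal_gen_ker aug_scalar augM) E.
suff: aug 1 = 0.
  by rewrite -(rmorph1 (to_alg_quot tensor_alg_proper)) augE freealg_aug1; apply/eqP/oner_neq0.
have aug_gen x : aug (tgen x) = 0 by rewrite [LHS]augE freealg_aug_gen.
apply: E => _ [x [y ->]].
by rewrite 2!(scalarB _ _ aug_scalar) 2!augM !aug_gen mulr0 !subr0.
Qed.

(* U(L) = T(L) / < x ⊗ y - y ⊗ x - [x, y] > *)
Definition env : algType K := alg_quot env_proper.

Definition env_inj (x : L) : env := to_alg_quot _ (tgen x).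

Definition env_rep (u : env) : freealg K L := of_alg_quot (of_alg_quot u).

(* The algebra morphism with x |-> 0 for x in L. *)
Definition env_counit (u : env) : K := freealg_aug (env_rep u).

(* The algebra morphism with x |-> x ⊗ 1 + 1 ⊗ x for x in L. *)
Definition env_comul (u : env) : tensor env env :=
  freealg_linext (fun w => \big[@tensor_mul _ env env/1 ⊗ 1]_(x <- (w : seq L))
                             (env_inj x ⊗ 1 + 1 ⊗ env_inj x)) (env_rep u).

Let TT := tensor env env.
Let mulT : TT -> TT -> TT := @tensor_mul _ env env.
Let dprim (x : L) : TT := env_inj x ⊗ 1 + 1 ⊗ env_inj x.
Let fcomul (x : freealg K L) : TT :=
  freealg_linext (fun w => \big[mulT/1 ⊗ 1]_(x <- (w : seq L)) dprim x) x.

Let linear_eq0 (U W : lmodType K) (f : U -> W) : linear f -> f 0 = 0.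
Proof. by move=> fl; have := fl (-1) 0 0; rewrite !(scaleN1r, oppr0, addr0) addNr. Qed.

Let linear_eqB (U W : lmodType K) (f : U -> W) x y : linear f -> f (x - y) = f x - f y.
Proof. by move=> fl; rewrite addrC -scaleN1r fl scaleN1r addrC. Qed.

Let mulT_l t : linear (mulT^~ t).
Proof. by move=> c s s'; exact: tensor_mulPl. Qed.

Let mulT_r t : linear (mulT t).
Proof. by move=> c s s'; exact: tensor_mulPr. Qed.

Let fcl : linear fcomul.
Proof. exact: freealg_linext_linear. Qed.

Let fcM x y : fcomul (x * y) = mulT (fcomul x) (fcomul y).
Proof.
have lcomp (X Y Z : lmodType K) (g : Y -> Z) (f : X -> Y) :
    linear g -> linear f -> linear (fun x => g (f x)).
  by move=> gl fl c u v; rewrite fl gl.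
have ml (A : algType K) (z : A) : linear ( *%R^~ z).
  by move=> c u v; rewrite mulrDl -scalerAl.
have mr (A : algType K) (z : A) : linear ( *%R z).
  by move=> c u v; rewrite mulrDr -scalerAr.
move: x; apply: (@freealg_ext _ _ TT).
- exact: (lcomp _ _ _ _ _ fcl (ml _ y)).
- exact: (lcomp _ _ _ _ _ (mulT_l _) fcl).
move=> v; move: y; apply: (@freealg_ext _ _ TT).
- exact: (lcomp _ _ _ _ _ fcl (mr _ _)).
- exact: (lcomp _ _ _ _ _ (mulT_r _) fcl).
move=> w; rewrite wordM /fcomul !freealg_linextE fmM.
elim: (v : seq L) => [|i s IH]; first by rewrite big_nil [RHS]tensor_mul1t.
by rewrite /= !big_cons IH [LHS]tensor_mulA.
Qed.

Let fcomul_gen x : fcomul (gen K x) = dprim x.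
Proof.
rewrite /fcomul /gen freealg_linextE fmU big_cons big_nil.
exact: tensor_mult1.
Qed.

Let mulT0 : right_zero 0 mulT.
Proof. by move=> t; exact: (linear_eq0 (mulT_r t)). Qed.

Let mul0T : left_zero 0 mulT.
Proof. by move=> t; exact: (linear_eq0 (mulT_l t)). Qed.

Lemma env_inj_linear : linear env_inj.
Proof.
move=> c x y; rewrite /env_inj -linearP; congr (to_alg_quot env_proper _).
rewrite /tgen -linearP; apply/to_alg_quotP.
by apply: sub_gen_smallest; exists c, x, y.
Qed.

Lemma env_inj_bracket x y :
  env_inj (br x y) = env_inj x * env_inj y - env_inj y * env_inj x.
Proof.
have -> : env_inj x * env_inj y - env_inj y * env_inj x =
    to_alg_quot env_proper (tgen x * tgen y - tgen y * tgen x).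
  by rewrite rmorphB 2!rmorphM.
apply/esym/to_alg_quotP.
by apply: sub_gen_smallest; exists x, y.
Qed.

Let dprim_linear : linear dprim.
Proof.
have [tl tr] := tens_bilinear env env.
move=> c x y; rewrite /dprim env_inj_linear tl tr scalerDr; exact: addrACA.
Qed.

Let tcomul (t : tensor_alg) : TT := fcomul (of_alg_quot t).

Let tcomulE x : tcomul (to_alg_quot tensor_alg_proper x) = fcomul x.
Proof.
apply/eqP; rewrite /tcomul -subr_eq0 -(linear_eqB _ _ fcl); apply/eqP.
apply: (ideal_gen_ker0 mul0T mulT0 fcl fcM (G := tensor_alg_relations)).
  move=> _ [c [u [v ->]]]; rewrite (linear_eqB _ _ fcl) fcl !fcomul_gen.
  by rewrite dprim_linear subrr.
by apply/(to_alg_quotP tensor_alg_proper); rewrite of_alg_quotK.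
Qed.

Let tcl : linear tcomul.
Proof.
move=> c x y; rewrite -[x]of_alg_quotK -[y]of_alg_quotK -linearP !tcomulE.
exact: fcl.
Qed.

Let tcM x y : tcomul (x * y) = mulT (tcomul x) (tcomul y).
Proof.
rewrite -[x]of_alg_quotK -[y]of_alg_quotK -rmorphM !tcomulE; exact: fcM.
Qed.

Let tcomul_gen x : tcomul (tgen x) = dprim x.
Proof. by rewrite [LHS]tcomulE fcomul_gen. Qed.

Let dprim_bracket x y :
  dprim (br x y) = mulT (dprim x) (dprim y) - mulT (dprim y) (dprim x).
Proof.
have mulTD (a b c d : TT) :
    mulT (a + b) (c + d) = (mulT a c + mulT b d) + (mulT a d + mulT b c).
  rewrite [LHS]tensor_mulDl ![tensor_mul _ (c + d)]tensor_mulDr.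
  by rewrite [X in _ + X]addrC addrACA.
have [tl tr] := tens_bilinear env env.
have tlB (u v w : env) : (u - v) ⊗ w = u ⊗ w - v ⊗ w.
  exact: (linear_eqB _ _ (tl w)).
have trB (u v w : env) : w ⊗ (u - v) = w ⊗ u - w ⊗ v.
  exact: (linear_eqB _ _ (tr w)).
have dd u v : mulT (u ⊗ 1 + 1 ⊗ u) (v ⊗ 1 + 1 ⊗ v) =
    ((u * v) ⊗ 1 + 1 ⊗ (u * v)) + (u ⊗ v + v ⊗ u).
  by rewrite [LHS]mulTD; congr (_ + _ + (_ + _)); rewrite [LHS]tensor_mulE;
     rewrite ?mulr1 ?mul1r.
rewrite /dprim (dd (env_inj x)) (dd (env_inj y)) env_inj_bracket tlB trB.
have E (V : zmodType) (a b c d s s' : V) :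
    a - b + (c - d) = a + c + (s + s') - (b + d + (s' + s)).
  by rewrite (addrC s') opprD [RHS]addrACA subrr addr0 opprD addrACA.
exact: E.
Qed.

Lemma env_comulE u : env_comul (to_alg_quot env_proper u) = tcomul u.
Proof.
apply/eqP; rewrite -[env_comul _]/(tcomul _) -subr_eq0 -(linear_eqB _ _ tcl).
apply/eqP; apply: (ideal_gen_ker0 mul0T mulT0 tcl tcM (G := env_relations)).
  move=> _ [x [y ->]]; rewrite 2!(linear_eqB _ _ tcl) 2!tcM !tcomul_gen.
  by rewrite dprim_bracket subrr.
by apply/(to_alg_quotP env_proper); rewrite of_alg_quotK.
Qed.

Lemma env_comul_linear : linear env_comul.
Proof.
move=> c x y; rewrite -[x]of_alg_quotK -[y]of_alg_quotK -linearP !env_comulE.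
exact: tcl.
Qed.

Lemma env_comulM x y :
  env_comul (x * y) = tensor_mul (env_comul x) (env_comul y).
Proof.
rewrite -[x]of_alg_quotK -[y]of_alg_quotK -rmorphM !env_comulE; exact: tcM.
Qed.

Lemma env_comul_inj x : env_comul (env_inj x) = env_inj x ⊗ 1 + 1 ⊗ env_inj x.
Proof. by rewrite [LHS]env_comulE tcomul_gen. Qed.

Definition env_gr (Lgr : nat -> set L) (n : nat) : set env :=
  lspan [set u | exists s : seq (nat * L), [/\ forall p, p \in s -> Lgr p.1 p.2,
    (\sum_(p <- s) p.1)%N = n & u = \prod_(p <- s) env_inj p.2]].

End Enveloping.

Section Graded.
Variables (K : fieldType) (V : lmodType K) (gr : nat -> set V).

Definition grading : Prop :=
  [/\ forall n, subspace (gr n),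
      forall x, exists N (y : nat -> V),
        (forall n, gr n (y n)) /\ x = \sum_(n < N) y n &
      forall N (y : nat -> V), (forall n, gr n (y n)) ->
        \sum_(n < N) y n = 0 -> forall n, (n < N)%N -> y n = 0].

Definition graded_subspace (S : set V) : Prop :=
  subspace S /\ S `<=` lspan (\bigcup_n (S `&` gr n)).

End Graded.

(* Sequences (c_1, c_2, ...) are functions c : nat -> _ with c n standing for
   c_(n+1). *)
Definition seq_gens (a : nat -> nat) : choiceType := {n : nat & 'I_(a n)}.

Section FreeLie.
Variables (K : fieldType) (a : nat -> nat).
Local Notation T := (freealg K (seq_gens a)).

Definition word_degree (w : {fmonom seq_gens a}) : nat :=
  \sum_(x <- (w : seq (seq_gens a))) (tag x).+1.

Definition freealg_gr (n : nat) : set T :=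
  lspan [set word K w | w in [set w | word_degree w = n]].

Definition free_lie_set : set T :=
  smallest [set S | graded_subspace freealg_gr S /\
                    forall x y, S x -> S y -> S (x * y - y * x)]
           (range (@gen K (seq_gens a))).

Definition free_lie_pred : {pred T} := fun x => x \in free_lie_set.

Lemma free_lie_subspace : subspace free_lie_set.
Proof.
apply/subspaceP; split=> [S [[[/subspaceP[]]]]//|c x y Lx Ly S SP].
have [[[/subspaceP[_ SD] _] _] _] := SP.
by apply: SD; [apply: Lx|apply: Ly].
Qed.

Lemma free_lie_commutator x y :
  free_lie_set x -> free_lie_set y -> free_lie_set (x * y - y * x).
Proof.
move=> Lx Ly S SP; have [[_ SC] _] := SP.
by apply: SC; [apply: Lx|apply: Ly].
Qed.

Fact free_lie_submod_closed : submod_closed free_lie_pred.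
Proof. exact: free_lie_subspace. Qed.

HB.instance Definition _ :=
  GRing.isSubmodClosed.Build K T free_lie_pred free_lie_submod_closed.

Record free_lie := FreeLie { free_lie_val :> T; _ : free_lie_val \in free_lie_pred }.

HB.instance Definition _ := [isSub for free_lie_val].
HB.instance Definition _ := [Choice of free_lie by <:].
HB.instance Definition _ := [SubChoice_isSubLmodule of free_lie by <:].

Fact free_lie_bracket_subproof (x y : free_lie) :
  (x : T) * (y : T) - (y : T) * (x : T) \in free_lie_pred.
Proof.
case: x y => [x Lx] [y Ly] /=; move: Lx Ly; rewrite !unfold_in !inE.
exact: free_lie_commutator.
Qed.

Definition free_lie_bracket (x y : free_lie) : free_lie :=
  FreeLie (free_lie_bracket_subproof x y).

Definition free_lie_gr (n : nat) : set free_lie :=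
  [set x | freealg_gr n (x : T)].

End FreeLie.


Record hopf_data (K : fieldType) := HopfData {
  hcar :> algType K;
  hgr : nat -> set hcar;
  hcomul : hcar -> tensor hcar hcar;
  hcounit : hcar -> K
}.

Section HopfAlgebras.
Variable K : fieldType.
Implicit Types H : hopf_data K.

Definition is_antipode H (S : H -> H) : Prop :=
  [/\ linear S, (forall n x, hgr n x -> hgr n (S x)) &
      forall x : H,
        tlift (fun y z => S y * z) (hcomul x) = (hcounit x)%:A /\
        tlift (fun y z => y * S z) (hcomul x) = (hcounit x)%:A].

Record graded_hopf H : Prop := {
  gh_grading : grading (@hgr K H);
  gh_one : hgr 0 (1 : H);
  gh_mul : forall m n (x y : H), hgr m x -> hgr n y -> hgr (m + n) (x * y);
  gh_comul_linear : linear (@hcomul K H);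
  gh_counit_linear : scalar (@hcounit K H);
  gh_comul1 : hcomul (1 : H) = 1 ⊗ 1;
  gh_comulM : forall x y : H, hcomul (x * y) = tensor_mul (hcomul x) (hcomul y);
  gh_counit1 : hcounit (1 : H) = 1;
  gh_counitM : forall x y : H, hcounit (x * y) = hcounit x * hcounit y;
  gh_coassoc : forall x : H,
    tassoc (tmap (@hcomul K H) id (hcomul x)) = tmap id (@hcomul K H) (hcomul x);
  gh_counitl : forall x : H, tlift (fun y z => hcounit y *: z) (hcomul x) = x;
  gh_counitr : forall x : H, tlift (fun y z => hcounit z *: y) (hcomul x) = x;
  gh_comul_gr : forall n (x : H), hgr n x ->
    lspan [set t | exists i j (y z : H),
             [/\ (i + j)%N = n, hgr i y, hgr j z & t = y ⊗ z]] (hcomul x);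
  gh_counit_gr : forall n (x : H), hgr n.+1 x -> hcounit x = 0;
  gh_antipode : exists S : H -> H, is_antipode S
}.

Definition cocommutative H : Prop :=
  forall x : H, tswap (hcomul x) = hcomul x.

Definition freely_generated H : Prop :=
  exists X : set H, X `<=` \bigcup_n hgr n.+1 /\
    bijective (freealg_linext
      (fun w : {fmonom X} => \prod_(x <- (w : seq X)) (val x) : H)).

Record FGCCHA H : Prop := {
  fg_graded_hopf : graded_hopf H;
  fg_connected : hgr 0 = [set c%:A | c in [set: K]] :> set H;
  fg_findim : forall n, exists d, has_dim (@hgr K H n) d;
  fg_cocommutative : cocommutative H;
  fg_free : freely_generated H
}.

Definition hopf_iso (H H' : hopf_data K) : Prop :=
  exists f : {lrmorphism H -> H'},
    [/\ bijective f, (forall n x, hgr n x <-> hgr n (f x)),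
        (forall x, tmap f f (hcomul x) = hcomul (f x)) &
        (forall x, hcounit (f x) = hcounit x)].

Definition dim_seq H (n : nat) : nat := dimension (@hgr K H n.+1).

Definition primitives H : set H :=
  [set x | hcomul x = x ⊗ 1 + 1 ⊗ x].

Definition primitive_dim_seq H (n : nat) : nat :=
  dimension (@primitives H `&` hgr n.+1).

Definition env_free_lie (a : nat -> nat) : hopf_data K :=
  @HopfData K (env (@free_lie_bracket K a)) (env_gr (@free_lie_gr K a))
    (@env_comul _ _ _) (@env_counit _ _ _).

End HopfAlgebras.


Section PowerSeries.
Implicit Types f g c h a p : nat -> rat.

(* formal power series over rat, given by their coefficients *)
Definition psone : nat -> rat := fun n => (n == 0%N)%:R.

Definition psmul f g : nat -> rat :=
  fun n => \sum_(i < n.+1) f i * g (n - i)%N.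

(* 1 + \sum_(k >= 1) c_k t^k *)
Definition ps1add c : nat -> rat := fun n => if n is k.+1 then c k else 1.

Definition gbinom (x : rat) (m : nat) : rat :=
  (\prod_(i < m) (x - i%:R)) / m`!%:R.

(* (1 - t^d)^(-p) *)
Definition ps_factor (d : nat) (p : rat) : nat -> rat :=
  fun n => if (d %| n)%N then gbinom (p + (n %/ d)%:R - 1) (n %/ d) else 0.

(* f = \prod_(d >= 1) F d, coefficientwise *)
Definition ps_infprod (F : nat -> nat -> rat) f : Prop :=
  forall n, exists N, forall M, (N <= M)%N ->
    (\big[psmul/psone]_(1 <= d < M.+1) F d) n = f n.

Definition h_a_related h a : Prop :=
  psmul (ps1add h) (ps1add (fun k => - a k)) =1 psone.

Definition h_p_related h p : Prop :=
  ps_infprod (fun d => ps_factor d (p d.-1)) (ps1add h).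

Definition phi_ha h : nat -> rat :=
  xget (fun=> 0) [set a | h_a_related h a].

Definition phi_pa p : nat -> rat :=
  xget (fun=> 0) [set a | exists h, h_p_related h p /\ h_a_related h a].


Let rec_seq (F : nat -> (nat -> rat) -> rat) :
  (forall n a b, (forall m, (m < n)%N -> a m = b m) -> F n a = F n b) ->
  exists a, forall n, a n = F n a.
Proof.
move=> FE; pose l := fix l n : seq rat :=
  if n is m.+1 then rcons (l m) (F m (nth 0 (l m))) else [::].
pose a n := F n (nth 0 (l n)).
have sl n : size (l n) = n by elim: n => //= n IH; rewrite size_rcons IH.
have la n m : (m < n)%N -> nth 0 (l n) m = a m.
  elim: n => // n IH; rewrite ltnS leq_eqVlt /= nth_rcons sl.
  by case: ltngtP => //= [mn _|-> //]; apply: IH.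
by exists a => n; apply: FE => m /la.
Qed.

Let h_a_relatedE h a : h_a_related h a <->
  forall n, h n = \sum_(i < n.+1) ps1add h i * a (n - i)%N.
Proof.
have E n : psmul (ps1add h) (ps1add (fun k => - a k)) n.+1 =
    h n - \sum_(i < n.+1) ps1add h i * a (n - i)%N.
  rewrite /psmul big_ord_recr /= subnn mulr1 addrC -sumrN; congr (_ + _).
  by apply: eq_bigr => i _; rewrite subSn -1?ltnS//= mulrN.
split=> [R n|R [|n]]; first by have := R n.+1; rewrite E => /subr0_eq.
  by rewrite /psmul big_ord1 mulr1.
by rewrite E -R subrr.
Qed.

Lemma h_a_related_ex h : exists a, h_a_related h a.
Proof.
have [n a b ab|a aE] := @rec_seq (fun n a =>
    h n - \sum_(i < n) h i * a (n - i.+1)%N).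
  congr (_ - _); apply: eq_bigr => i _; rewrite ab//.
  by rewrite ltn_subrL /=; case: n i {ab} => // -[].
exists a; apply/h_a_relatedE => n.
by rewrite big_ord_recl subn0 mul1r {1}aE /= subrK.
Qed.

Lemma h_a_related_uniq h a b : h_a_related h a -> h_a_related h b -> a = b.
Proof.
move=> /h_a_relatedE ha /h_a_relatedE hb; apply/funext => n.
elim/ltn_ind: n => n IH; have := ha n; rewrite hb !big_ord_recl !subn0 !mul1r.
move=> /esym; set s := (X in a n + X); set s' := (X in b n + X).
suff -> : s = s' by apply: addIr.
apply: eq_bigr => i _; rewrite IH// lift0.
by rewrite ltn_subrL /=; case: n i {ha hb IH s s'} => // -[].
Qed.

Lemma phi_haP h : h_a_related h (phi_ha h).
Proof. exact: (xgetPex _ (h_a_related_ex h)). Qed.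

Lemma ps_infprod_uniq F f g : ps_infprod F f -> ps_infprod F g -> f = g.
Proof.
move=> Ff Fg; apply/funext => n; have [N NE] := Ff n; have [M ME] := Fg n.
by rewrite -(NE (maxn N M)) ?leq_maxl// ME ?leq_maxr.
Qed.

Let psmul_eq n f g g' : (forall m, (m <= n)%N -> g m = g' m) ->
  forall m, (m <= n)%N -> psmul f g m = psmul f g' m.
Proof.
move=> gg m mn; apply: eq_bigr => i _; rewrite gg//.
exact: leq_trans (leq_subr _ _) mn.
Qed.

Let psmul1 f : psmul f psone =1 f.
Proof.
move=> n; rewrite /psmul big_ord_recr /= subnn mulr1 big1 ?add0r// => i _.
by rewrite /psone subn_eq0 leqNgt ltn_ord mulr0.
Qed.

Let infprod_stable (F : nat -> nat -> rat) :
  (forall d, F d 0%N = 1) -> (forall d n, (0 < n < d)%N -> F d n = 0) ->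
  forall n M, (n <= M)%N ->
  (\big[psmul/psone]_(1 <= d < M.+1) F d) n =
  (\big[psmul/psone]_(1 <= d < n.+1) F d) n.
Proof.
move=> F1 F0 n M /subnK <-; elim: (M - n)%N => // k <-.
have E m : index_iota 1 m.+1 = iota 1 m by rewrite /index_iota subn1.
rewrite !E addSn -[(k + n).+1]addn1 iotaD add1n.
move: (k + n)%N (leq_addl k n) (iota 1 _) => m nm s {k}.
move: n nm => n nm; have : (n <= n)%N by []; move: {1 3 4}n => j.
elim: s j => [|d s IH] j jn.
  rewrite big_cons big_nil psmul1 /psone; case: j jn => [|j] jn; first exact: F1.
  by apply: F0; apply/andP; split=> //; rewrite ltnS; exact: leq_trans jn nm.
rewrite !big_cons; apply: psmul_eq jn => i; exact: IH.
Qed.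

Let gbinom0 x : gbinom x 0 = 1.
Proof. by rewrite /gbinom big_ord0 fact0 divr1. Qed.

Lemma h_p_related_ex p : exists h, h_p_related h p.
Proof.
pose F d := ps_factor d (p d.-1).
exists (fun n => (\big[psmul/psone]_(1 <= d < n.+2) F d) n.+1) => n.
exists n => M nM; rewrite infprod_stable//; last 2 first.
- by move=> d; rewrite /F /ps_factor dvdn0 div0n gbinom0.
- by move=> d m /andP[m0 md]; rewrite /F /ps_factor gtnNdvd.
case: n {nM} => [|n]; last by [].
by rewrite big_nil.
Qed.

Lemma phi_paP p : exists h, h_p_related h p /\ h_a_related h (phi_pa p).
Proof.
apply: (@xgetPex _ (fun=> 0) [set a | exists h, h_p_related h p /\ h_a_related h a]).
have [h hp] := h_p_related_ex p; have [a ha] := h_a_related_ex h.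
by exists a, h.
Qed.

End PowerSeries.

Definition natseq (c : nat -> nat) : nat -> rat := fun n => (c n)%:R.

(* Main.v *)
(* The commutator monomials in the generators are homogeneous, so they span the
   free Lie algebra; hence U(L(a)) is the free algebra T(X_a) with primitive
   generators, and the count of words by their first letter relates dim H to a.

   For the converse, let Psi = mult o comult.  Cocommutativity makes Psi a
   morphism of coalgebras, so it commutes with the reduced comultiplication; by
   induction on n, H_n (n > 0) is spanned by eigenvectors of Psi with eigenvalues
   2, 4, ..., 2^n, and prod_(2 <= i <= n) (Psi - 2^i) maps H_n to primitives.  As
   Psi = 2 modulo decomposables, this operator is a nonzero scalar there, so each
   free generator may be replaced by a primitive one with the same
   indecomposable part; this substitution is unitriangular for word length, hence
   bijective.

   For the primitives, the ordered products of a homogeneous basis of P(H) form a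
   basis of H: they span by straightening, and independence follows by induction
   on length from the operators (l (x) id) o comult, which act as partial
   derivatives up to shorter products.  Counting multisets of basis elements
   gives the product formula. *)

Require Import Defs.
From HB Require Import structures.
From mathcomp Require Import all_boot all_order all_algebra.
From mathcomp Require Import zify boolp classical_sets reals complex.
From mathcomp.multinomials Require Import monalg.

Set Implicit Arguments.
Unset Strict Implicit.
Unset Printing Implicit Defensive.

Import Order.TTheory GRing.Theory Num.Theory.

Local Open Scope classical_set_scope.
Local Open Scope ring_scope.

(** * Linear algebra over abstract modules *)

(** Enveloping algebras and arbitrary FGCCHAs are brought under one notion, [prim_presentation]: a
    graded algebra isomorphism from a free algebra that sends the letters to primitives. It
    determines the coproduct and the counit, so two Hopf algebras presented by the same [a] are
    isomorphic, while the dimensions recover [a]. T(X_a) and U(L(a)) map to each other by their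
    universal properties, which gives the presentation of U(L(a)). The obstacle is that the free
    generators of an FGCCHA need not be primitive. The gap between 2 and the other eigenvalues of
    Psi settles this: a reduced tensor is a combination of y (x) z with y and z eigenvectors of
    positive degree, so its eigenvalues start at 2 * 2 = 4. Removing 4, ..., 2^n therefore kills the
    reduced coproduct, while an indecomposable is only multiplied by the factors 2 - 2^i, nonzero in
    characteristic 0. Realising a given p rests on the product formula and the uniqueness of its
    exponents: the primitives of U(L(a)) are only counted. *)

Section LinearPredicate.
Variables (K : fieldType) (U V W : lmodType K).
Implicit Type f : U -> V.

Lemma lin0 f : linear f -> f 0 = 0.
Proof. by move=> fl; have := fl (-1) 0 0; rewrite !(scaleN1r, oppr0, addr0) addNr. Qed.

Lemma linD f x y : linear f -> f (x + y) = f x + f y.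
Proof. by move=> fl; have := fl 1 x y; rewrite !scale1r. Qed.

Lemma linZ f c x : linear f -> f (c *: x) = c *: f x.
Proof. by move=> fl; have := fl c x 0; rewrite (lin0 fl) !addr0. Qed.

Lemma linB f x y : linear f -> f (x - y) = f x - f y.
Proof. by move=> fl; rewrite addrC -scaleN1r fl scaleN1r addrC. Qed.

Lemma lin_sum f (I : Type) (r : seq I) (P : pred I) (F : I -> U) : linear f ->
  f (\sum_(i <- r | P i) F i) = \sum_(i <- r | P i) f (F i).
Proof.
move=> fl; elim/big_rec2: _ => [|i x y _ <-]; first exact: lin0.
exact: linD.
Qed.

Lemma lin_comp (g : V -> W) f : linear g -> linear f -> linear (fun x => g (f x)).
Proof. by move=> gl fl c x y; rewrite fl gl. Qed.

Lemma lin_add f g : linear f -> linear g -> linear (fun x => f x + g x).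
Proof. by move=> fl gl c x y; rewrite fl gl scalerDr addrACA. Qed.

Lemma lin_scale c f : linear f -> linear (fun x => c *: f x).
Proof. by move=> fl d x y; rewrite fl scalerDr !scalerA mulrC. Qed.

Lemma lin_sub f g : linear f -> linear g -> linear (fun x => f x - g x).
Proof. by move=> fl gl c x y; rewrite fl gl scalerBr opprD addrACA. Qed.

Lemma lin_opp f : linear f -> linear (fun x => - f x).
Proof. by move=> fl c x y; rewrite fl opprD scalerN. Qed.

Lemma lin_zero : linear (fun _ : U => 0 : V).
Proof. by move=> c x y; rewrite scaler0 addr0. Qed.

Lemma lin_id : linear (fun x : U => x : U).
Proof. by []. Qed.

End LinearPredicate.

Section AlgebraLinear.
Variables (K : fieldType) (A : algType K).

Lemma lin_mull (x : A) : linear (fun y => x * y).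
Proof. by move=> c y z; rewrite mulrDr -scalerAr. Qed.

Lemma lin_mulr (x : A) : linear (fun y => y * x).
Proof. by move=> c y z; rewrite mulrDl -scalerAl. Qed.

Lemma lrmorphism_pack (B : algType K) (f : A -> B) : linear f ->
  f 1 = 1 -> {morph f : x y / x * y} -> {F : {lrmorphism A -> B} | F = f :> (A -> B)}.
Proof.
move=> fl f1 fM.
pose l := GRing.isLinear.Build K A B _ f fl.
pose m := GRing.isMonoidMorphism.Build A B f (conj f1 fM).
by pose F : {lrmorphism A -> B} := HB.pack f l m; exists F.
Qed.

End AlgebraLinear.

Section SpanTheory.
Variables (K : fieldType) (V : lmodType K).
Implicit Types (S G : set V).

Lemma subspace0 S : subspace S -> S 0.
Proof. by case/subspaceP. Qed.

Lemma subspaceZD S c x y : subspace S -> S x -> S y -> S (c *: x + y).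
Proof. by case/subspaceP=> _; apply. Qed.

Lemma subspaceD S x y : subspace S -> S x -> S y -> S (x + y).
Proof. by move=> SP Sx Sy; rewrite -[x]scale1r; apply: subspaceZD. Qed.

Lemma subspaceZ S c x : subspace S -> S x -> S (c *: x).
Proof. by move=> SP Sx; rewrite -[_ *: _]addr0; apply: subspaceZD => //; exact: subspace0. Qed.

Lemma subspaceN S x : subspace S -> S x -> S (- x).
Proof. by move=> SP Sx; rewrite -scaleN1r; exact: subspaceZ. Qed.

Lemma subspaceB S x y : subspace S -> S x -> S y -> S (x - y).
Proof. by move=> SP Sx Sy; apply: subspaceD => //; exact: subspaceN. Qed.

Lemma subspace_sum S (I : eqType) (r : seq I) (F : I -> V) : subspace S ->
  (forall i, i \in r -> S (F i)) -> S (\sum_(i <- r) F i).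
Proof.
move=> SP SF; rewrite big_seq; elim/big_ind: _ => //; first exact: subspace0.
by move=> x y; exact: subspaceD.
Qed.

Lemma subspace_sum_ord S n (F : 'I_n -> V) : subspace S ->
  (forall i, S (F i)) -> S (\sum_i F i).
Proof.
move=> SP SF; elim/big_ind: _ => //; first exact: subspace0.
by move=> x y; exact: subspaceD.
Qed.

Lemma subspaceI S S' : subspace S -> subspace S' -> subspace (S `&` S').
Proof.
move=> SP SP'; apply/subspaceP; split; first by split; exact: subspace0.
by move=> c x y [? ?] [? ?]; split; exact: subspaceZD.
Qed.

Lemma lspan_min S G : subspace S -> G `<=` S -> lspan G `<=` S.
Proof. exact: smallest_sub. Qed.

Lemma lspan_gen G x : G x -> lspan G x.
Proof. by move=> Gx; apply: sub_gen_smallest. Qed.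

Lemma lspan0 G : lspan G 0.
Proof. exact: subspace0 (subspace_lspan G). Qed.

Lemma lspanS G G' : G `<=` G' -> lspan G `<=` lspan G'.
Proof.
by move=> GG'; apply: lspan_min (subspace_lspan _) _ => x /GG'; exact: lspan_gen.
Qed.

End SpanTheory.

Section LinearSpan.
Variables (K : fieldType) (U V : lmodType K).

Lemma subspace_preim (f : U -> V) (S : set V) : linear f -> subspace S ->
  subspace [set x | S (f x)].
Proof.
move=> fl SP; apply/subspaceP; split=> [|c x y] /=.
  by rewrite lin0//; exact: subspace0.
by rewrite fl; exact: subspaceZD.
Qed.

Lemma subspace_ker (f : U -> V) : linear f -> subspace [set x | f x = 0].
Proof.
move=> fl; apply/subspaceP; split=> [|c x y] /=; first exact: lin0.
by rewrite fl => -> ->; rewrite scaler0 addr0.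
Qed.

Lemma subspace_eq (f g : U -> V) : linear f -> linear g ->
  subspace [set x | f x = g x].
Proof.
move=> fl gl; apply/subspaceP; split=> [|c x y] /=; first by rewrite !lin0.
by rewrite fl gl => -> ->.
Qed.

Lemma lspan_map (f : U -> V) (G : set U) (S : set V) : linear f -> subspace S ->
  (forall x, G x -> S (f x)) -> forall x, lspan G x -> S (f x).
Proof. by move=> fl SP GS; apply: lspan_min (subspace_preim fl SP) _. Qed.

Lemma lspan_eq (f g : U -> V) (G : set U) : linear f -> linear g ->
  (forall x, G x -> f x = g x) -> forall x, lspan G x -> f x = g x.
Proof. by move=> fl gl fg; apply: lspan_min (subspace_eq fl gl) _. Qed.

Lemma linear_can (f : U -> V) (g : V -> U) : linear f -> cancel f g -> cancel g f ->
  linear g.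
Proof. by move=> fl fK gK c x y; rewrite -[x in LHS]gK -[y in LHS]gK -fl fK. Qed.

End LinearSpan.

(** * Bases, coordinates and dimension *)

Section Dimension.
Variables (K : fieldType) (V : lmodType K).
Implicit Types (S : set V).

(** Coefficients form a row vector so that a change of family is a matrix product, as in
    [lcomb_mul]. *)
Definition lcomb n (e : 'I_n -> V) (c : 'rV[K]_n) : V := \sum_i c 0 i *: e i.

Lemma lcomb_linear n (e : 'I_n -> V) : linear (lcomb e).
Proof.
move=> k c d; rewrite /lcomb scaler_sumr -big_split /=; apply: eq_bigr => i _.
by rewrite !mxE scalerDl scalerA.
Qed.

Lemma lcomb_delta n (e : 'I_n -> V) i : lcomb e (delta_mx 0 i) = e i.
Proof.
rewrite /lcomb (bigD1 i)//= mxE !eqxx scale1r big1 ?addr0// => j ji.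
by rewrite mxE (negPf ji) andbF scale0r.
Qed.

Lemma lcomb_mul m n (e : 'I_n -> V) (c : 'rV[K]_m) (A : 'M[K]_(m, n)) :
  lcomb e (c *m A) = lcomb (fun i => lcomb e (row i A)) c.
Proof.
rewrite mulmx_sum_row (lin_sum _ _ _ (lcomb_linear e)).
by apply: eq_bigr => i _; rewrite (linZ _ _ (lcomb_linear e)).
Qed.

Lemma lcomb_in n (e : 'I_n -> V) c S : subspace S -> (forall i, S (e i)) ->
  S (lcomb e c).
Proof. by move=> SP Se; apply: subspace_sum_ord => // i; exact: subspaceZ. Qed.

Lemma has_dimP S n : subspace S -> (has_dim S n <->
  exists e : 'I_n -> V, [/\ forall i, S (e i),
    forall x, S x -> exists c, x = lcomb e c &
    forall c, lcomb e c = 0 -> c = 0]).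
Proof.
move=> SP; split=> -[e].
  move=> [Se eP]; exists e; split=> // [x /eP[c [-> _]]|c ec0]; first by exists c.
  have [d [_ dU]] := eP _ (subspace0 SP).
  rewrite -(dU c) ?ec0//; apply: dU.
  by rewrite -[RHS]/(lcomb e 0) (lin0 (lcomb_linear e)).
move=> [Se eG eF]; exists e; split=> // x /eG[c xE]; exists c; split=> // d xE'.
apply/eqP; rewrite -subr_eq0; apply/eqP/eF.
by rewrite (linB _ _ (lcomb_linear e)) -[lcomb e c]xE -[lcomb e d]xE' subrr.
Qed.

(** The coordinate matrices [A] of [e] in [e'] and [B] of [e'] in [e] satisfy A B = 1 in size m,
    which forces m <= n. *)
Lemma has_dim_le S m n : subspace S -> has_dim S m -> has_dim S n -> (m <= n)%N.
Proof.
move=> SP /(has_dimP _ SP)[e [Se eG eF]] /(has_dimP _ SP)[e' [Se' eG' eF']].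
have /choice[A AE] i := eG' _ (Se i); have /choice[B BE] i := eG _ (Se' i).
apply: (@mulmx1_min _ _ _ (\matrix_(i, j) A i 0 j) (\matrix_(i, j) B i 0 j)).
apply/row_matrixP => i; apply/eqP; rewrite -subr_eq0; apply/eqP/eF.
rewrite (linB _ _ (lcomb_linear e)) rowE mulmxA -rowE row1 lcomb_delta lcomb_mul.
have rA j : row j (\matrix_(i, j) A i 0 j) = A j by apply/rowP => k; rewrite !mxE.
have rB j : row j (\matrix_(i, j) B i 0 j) = B j by apply/rowP => k; rewrite !mxE.
have -> : (fun j => lcomb e (row j (\matrix_(i, j) B i 0 j))) = e'.
  by apply/funext => j; rewrite rB -BE.
by rewrite rA -AE subrr.
Qed.

Lemma has_dim_uniq S m n : subspace S -> has_dim S m -> has_dim S n -> m = n.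
Proof. by move=> SP Sm Sn; apply/eqP; rewrite eqn_leq !(has_dim_le SP). Qed.

Lemma dimensionE S n : subspace S -> has_dim S n -> dimension S = n.
Proof.
move=> SP Sn; apply: (has_dim_uniq SP _ Sn).
exact: (xgetPex 0%N (ex_intro (fun n => has_dim S n) n Sn)).
Qed.

Lemma has_dim_seq (I : eqType) (s : seq I) (v : I -> V) S : uniq s -> subspace S ->
  (forall i, i \in s -> S (v i)) ->
  (forall x, S x -> lspan [set v i | i in [set i | i \in s]] x) ->
  (forall c : I -> K, \sum_(i <- s) c i *: v i = 0 -> forall i, i \in s -> c i = 0) ->
  has_dim S (size s).
Proof.
move=> us SP Sv vG vF; apply/has_dimP => //.
(* [nth] needs a default label, which is available unless [s] is empty. *)
have [s0|i0] : s = [::] \/ exists i : I, True.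
- by case: (s); [left|move=> i ?; right; exists i].
- exists (fun _ => 0); split=> [i|x /vG Gx|c _]; first exact: subspace0.
  + exists 0; rewrite (lin0 (lcomb_linear _)).
    have: (lspan set0) x.
      by apply: lspanS Gx => y [j]; rewrite s0.
    apply: (@lspan_min _ _ [set x | x = 0]) => //; apply/subspaceP; split=> //.
    by move=> c u w /= -> ->; rewrite scaler0 addr0.
  + by apply/rowP => i; have := leq_ltn_trans (leq0n i) (ltn_ord i); rewrite {1}s0.
case: i0 => i0 _; exists (fun j => v (nth i0 s j)); split.
- by move=> j; apply: Sv; rewrite mem_nth.
- move=> x /vG; apply: (@lspan_min _ _ [set x | exists c, x = lcomb _ c]).
    apply/subspaceP; split=> [|k u w [c ->] [d ->]]; first by exists 0; rewrite (lin0 (lcomb_linear _)).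
    by exists (k *: c + d); rewrite lcomb_linear.
  move=> y [i /= si <-]; have si' : (index i s < size s)%N by rewrite index_mem.
  by exists (delta_mx 0 (Ordinal si')); rewrite lcomb_delta /= nth_index.
move=> c c0; pose d i := if insub (index i s) is Some j then c 0 j else 0.
have dE (j : 'I_(size s)) : d (nth i0 s j) = c 0 j.
  by rewrite /d index_uniq// valK.
apply/rowP => j; rewrite mxE -dE; apply: vF; last by rewrite mem_nth.
rewrite -[RHS]c0 (big_nth i0) big_mkord; apply: eq_bigr => k _.
by rewrite dE.
Qed.

(* A matrix of maximal rank among those with rows in [S] spans [S]. *)
Lemma subspace_rV n (S : set 'rV[K]_n) : subspace S ->
  exists A : 'M[K]_n, forall c, S c <-> (c <= A)%MS.
Proof.
move=> SP; pose Q (A : 'M[K]_n) := forall c : 'rV_n, (c <= A)%MS -> S c.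
have [A [QA Amax]] : exists A : 'M[K]_n,
    Q A /\ forall B : 'M[K]_n, Q B -> (\rank B <= \rank A)%N.
  pose R r := `[< exists A : 'M[K]_n, Q A /\ \rank A = r >].
  have R0 : exists r, R r.
    exists 0%N; apply/asboolP; exists 0; split; last exact: mxrank0.
    by move=> c; rewrite submx0 => /eqP->; exact: subspace0.
  have Rn r : R r -> (r <= n)%N by move=> /asboolP[A [_ <-]]; exact: rank_leq_row.
  have [r /asboolP[A [QA <-]] rmax] := ex_maxnP R0 Rn.
  by exists A; split=> // B QB; apply: rmax; apply/asboolP; exists B.
exists A => c; split=> [Sc|]; last exact: QA.
have QB : Q (A + c)%MS.
  move=> d /sub_addsmxP[[u v] /= ->].
  apply: subspaceD => //; first by apply: QA; exact: submxMl.
  by rewrite [v]mx11_scalar mul_scalar_mx; exact: subspaceZ.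
have := Amax _ QB.
rewrite (geq_leqif (mxrank_leqif_sup (addsmxSl A c))).
exact: (submx_trans (addsmxSr A c)).
Qed.

(** In coordinates for [S'] the subspace [S] becomes the row space of a matrix, and [row_base]
    supplies its basis. *)
Lemma has_dim_sub S S' n : subspace S -> subspace S' -> S `<=` S' -> has_dim S' n ->
  exists m, has_dim S m.
Proof.
move=> SP SP' SS' /(has_dimP _ SP')[e [Se eG eF]].
have [A AP] := subspace_rV (subspace_preim (lcomb_linear e) SP).
exists (\rank A); apply/has_dimP => //.
exists (fun i => lcomb e (row i (row_base A))); split=> [i|x Sx|c].
- by apply/AP; rewrite (submx_trans (row_sub _ _))// eq_row_base.
- have [c xE] := eG _ (SS' _ Sx); have : (c <= row_base A)%MS.
    by rewrite eq_row_base; apply/AP => /=; rewrite -xE.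
  by case/submxP=> d cE; exists d; rewrite -lcomb_mul -cE.
- rewrite -lcomb_mul => /eF /eqP.
  by rewrite mulmx_free_eq0 ?row_base_free// => /eqP.
Qed.

(** The coordinate matrix of [b] has independent rows, hence a right inverse; its columns, applied
    to coordinates, are the functionals. Coordinates off [S'] are arbitrary choices, so linearity is
    claimed on [S'] only. *)
Lemma dual_functionals S' n m (b : 'I_m -> V) : subspace S' -> has_dim S' n ->
  (forall i, S' (b i)) -> (forall c, lcomb b c = 0 -> c = 0) ->
  exists l : 'I_m -> V -> K, forall i, [/\ forall c x y, S' x -> S' y ->
      l i (c *: x + y) = c * l i x + l i y & forall j, l i (b j) = (i == j)%:R].
Proof.
move=> SP' /(has_dimP _ SP')[e [Se eG eF]] Sb bF.
have coordE x : exists c, S' x -> x = lcomb e c.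
  have [/eG[c ->]|nx] := pselect (S' x); first by exists c.
  by exists 0.
have [f fE] := choice coordE.
pose B := \matrix_(i < m) f (b i).
have Bfree : row_free B.
  rewrite -kermx_eq0; apply/eqP/row_matrixP => i; rewrite row0; apply: bF.
  have : row i (kermx B) *m B = 0 by rewrite -row_mul mulmx_ker row0.
  move/(congr1 (lcomb e)); rewrite lcomb_mul (lin0 (lcomb_linear e)) => <-.
  by apply: eq_bigr => j _; rewrite rowK -fE.
exists (fun i x => (f x *m pinvmx B) 0 i) => i; split=> [c x y Sx Sy|j].
  have -> : f (c *: x + y) = c *: f x + f y.
    apply/eqP; rewrite -subr_eq0; apply/eqP/eF.
    rewrite (linB _ _ (lcomb_linear e)) lcomb_linear -!fE ?subrr//.
    exact: subspaceZD.
  by rewrite mulmxDl -scalemxAl !mxE.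
have -> : f (b j) = row j B by rewrite rowK.
by rewrite -row_mul mulmxVp// rowE mulmx1 mxE eqxx.
Qed.

End Dimension.

Lemma has_dim_bij (K : fieldType) (U V : lmodType K) (f : U -> V) S S' n :
  linear f -> bijective f -> subspace S -> subspace S' ->
  (forall x, S x <-> S' (f x)) -> has_dim S n -> has_dim S' n.
Proof.
move=> fl [g fK gK] SP SP' SS' /(has_dimP _ SP)[e [Se eG eF]].
have fL m (e' : 'I_m -> U) c : lcomb (f \o e') c = f (lcomb e' c).
  by rewrite (lin_sum _ _ _ fl); apply: eq_bigr => i _; rewrite (linZ _ _ fl).
apply/has_dimP => //; exists (f \o e); split=> [i|x S'x|c].
- exact/SS'.
- have /eG[c gE] : S (g x) by apply/SS'; rewrite gK.
  by exists c; rewrite fL -gE gK.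
- rewrite fL -[RHS](lin0 fl) => /(can_inj fK); exact: eF.
Qed.

(** * Gradings and free algebras *)

Section GradingTheory.
Variables (K : fieldType) (V : lmodType K) (gr : nat -> set V).
Hypothesis grP : grading gr.

Lemma gr_subspace n : subspace (gr n). Proof. by case: grP. Qed.

Lemma gr0 n : gr n 0. Proof. exact: subspace0 (gr_subspace n). Qed.

(** Both decompositions are padded with zeros to the common length [maxn N M], so that independence
    of the pieces applies to their difference. *)
Lemma grading_uniq N M (y z : nat -> V) : (forall n, gr n (y n)) -> (forall n, gr n (z n)) ->
  \sum_(n < N) y n = \sum_(n < M) z n ->
  forall n, (if (n < N)%N then y n else 0) = (if (n < M)%N then z n else 0).
Proof.
have [gS _ gI] := grP => gy gz yz n.
pose w m := (if (m < N)%N then y m else 0) - (if (m < M)%N then z m else 0).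
have gw m : gr m (w m).
  by apply: subspaceB => //; case: ifP => // _; exact: subspace0.
have ext L L' (x : nat -> V) : (L <= L')%N ->
    \sum_(m < L') (if (m < L)%N then x m else 0) = \sum_(m < L) x m.
  move=> LL'; rewrite (big_ord_widen _ x LL') [RHS]big_mkcond.
  by apply: eq_bigr.
have [nm|mn] := ltnP n (maxn N M).
  apply/eqP; rewrite -subr_eq0; apply/eqP.
  apply: (gI (maxn N M) w) nm => //.
  by rewrite sumrB !ext ?leq_maxl ?leq_maxr// yz subrr.
by move: mn; rewrite geq_max => /andP[Nn Mn]; rewrite !ltnNge Nn Mn.
Qed.

Lemma grading_decomp x : exists y : nat -> V, (forall n, gr n (y n)) /\
  exists N, forall M, (N <= M)%N -> x = \sum_(n < M) y n.
Proof.
have [gS gD _] := grP; have [N [y [gy ->]]] := gD x.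
exists (fun n => if (n < N)%N then y n else 0); split=> [n|].
  by case: ifP => // _; exact: subspace0.
exists N => M NM; rewrite (big_ord_widen _ y NM) [LHS]big_mkcond.
by apply: eq_bigr.
Qed.

Definition gproj (x : V) : nat -> V := projT1 (cid (grading_decomp x)).

Lemma gproj_gr n x : gr n (gproj x n).
Proof. by rewrite /gproj; case: cid => y []. Qed.

Lemma gproj_sum x : exists N, forall M, (N <= M)%N -> x = \sum_(n < M) gproj x n.
Proof. by rewrite /gproj; case: cid => y []. Qed.

Lemma gprojE N (y : nat -> V) n : (forall n, gr n (y n)) ->
  gproj (\sum_(n < N) y n) n = if (n < N)%N then y n else 0.
Proof.
move=> gy; set x := \sum_(n < N) y n; have [M xE] := gproj_sum x.
have := grading_uniq (gproj_gr^~ x) gy (esym (xE (maxn M n.+1) (leq_maxl _ _))).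
by move=> /(_ n); rewrite leq_max leqnn orbT.
Qed.

Lemma gproj_id n x : gr n x -> gproj x n = x.
Proof.
move=> gx; have gy m : gr m (if m == n then x else 0).
  by case: eqP => [->|_]//; exact: gr0.
have := @gprojE n.+1 _ n gy; rewrite ltnSn eqxx big_ord_recr/= eqxx.
rewrite big1 ?add0r// => i _; case: eqP => // E.
by have := ltn_ord i; rewrite E ltnn.
Qed.

Lemma gproj0 m n x : gr n x -> m != n -> gproj x m = 0.
Proof.
move=> gx mn; have gy k : gr k (if k == n then x else 0).
  by case: eqP => [->|_]//; exact: gr0.
have := @gprojE n.+1 _ m gy; rewrite big_ord_recr/= eqxx.
rewrite big1 ?add0r => [->|i _].
  by rewrite (negPf mn); case: ifP.
case: eqP => // E.
by have := ltn_ord i; rewrite E ltnn.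
Qed.

Lemma gproj_linear n : linear (gproj^~ n).
Proof.
move=> c x y; have [N xE] := gproj_sum x; have [M yE] := gproj_sum y.
pose L := maxn n.+1 (maxn N M).
have gz m : gr m (c *: gproj x m + gproj y m).
  by apply: subspaceZD (gr_subspace m) _ _; exact: gproj_gr.
have -> : c *: x + y = \sum_(m < L) (c *: gproj x m + gproj y m).
  rewrite big_split /= -scaler_sumr -xE ?leq_max ?leqnn ?orbT//.
  by rewrite -yE // ?leq_max ?leqnn ?orbT.
by rewrite (@gprojE L _ n gz) leq_max leqnn.
Qed.

Lemma gr_disjoint m n x : gr m x -> gr n x -> m != n -> x = 0.
Proof. by move=> gx gx' mn; rewrite -(gproj_id gx) (gproj0 gx'). Qed.

(** The component of x in a degree other than n maps to the component of f x in that degree, which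
    is 0; injectivity then removes it from x. *)
Lemma graded_reflect (U : lmodType K) (gr' : nat -> set U) (f : U -> V) :
  grading gr' -> linear f -> injective f ->
  (forall n x, gr' n x -> gr n (f x)) -> forall n x, gr n (f x) -> gr' n x.
Proof.
move=> [gS gD _] fl fI fg n x gx; have [N [y [gy xE]]] := gD x.
have fE : f x = \sum_(m < N) f (y m) by rewrite xE lin_sum.
have gfy m : gr m (f (y m)) by exact: fg.
have y0 m : m != n -> (m < N)%N -> y m = 0.
  move=> mn mN; apply: fI; rewrite (lin0 fl) -(gproj0 gx mn) fE.
  by rewrite (@gprojE N (f \o y) m gfy) mN.
rewrite xE; apply: subspace_sum_ord => // i.
by have [->//|ni] := eqVneq (i : nat) n; rewrite y0//; exact: subspace0.
Qed.

End GradingTheory.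

Lemma grading_bij (K : fieldType) (U V : lmodType K) (f : U -> V)
    (gr : nat -> set U) (gr' : nat -> set V) :
  linear f -> bijective f -> (forall n x, gr n x <-> gr' n (f x)) ->
  grading gr -> grading gr'.
Proof.
move=> fl [g fK gK] ff' [gS gD gI]; have gl := linear_can fl fK gK.
have gg n y : gr' n y <-> gr n (g y) by rewrite ff' gK.
split=> [n|x|N y gy y0 n nN].
- have -> : gr' n = [set y | gr n (g y)] by apply/funext => y; apply/propext/gg.
  exact: subspace_preim.
- have [N [y [gy E]]] := gD (g x); exists N, (f \o y); split=> [n|].
    exact/ff'.
  by rewrite -[x]gK E (lin_sum _ _ _ fl).
- have ggy m : gr m (g (y m)) by exact/gg.
  rewrite -[y n]gK; have -> : g (y n) = 0; last exact: lin0.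
  apply: (gI N (fun m => g (y m))) => //.
  by rewrite -(lin_sum _ _ _ gl) y0 (lin0 gl).
Qed.

(** * Coefficients and the universal property of the free algebra *)

Section FreeAlgebraTheory.
Variables (K : fieldType) (I : choiceType).
Local Notation T := (freealg K I).

Definition wcoef (w : {fmonom I}) : T -> K :=
  @freealg_linext K I K^o (fun v => (v == w)%:R).

Lemma wcoef_linear w : linear (wcoef w : T -> K^o).
Proof. exact: freealg_linext_linear. Qed.

Lemma wcoef0 w : wcoef w 0 = 0.
Proof. exact: lin0 (wcoef_linear w). Qed.

Lemma wcoef_sum w (J : Type) (r : seq J) (P : pred J) (F : J -> T) :
  wcoef w (\sum_(i <- r | P i) F i) = \sum_(i <- r | P i) wcoef w (F i).
Proof. exact: (@lin_sum K T K^o (wcoef w) J r P F (wcoef_linear w)). Qed.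

Lemma wcoefD w x y : wcoef w (x + y) = wcoef w x + wcoef w y.
Proof. exact: (@linD K T K^o (wcoef w) x y (wcoef_linear w)). Qed.

Lemma wcoefZ w c x : wcoef w (c *: x) = c * wcoef w x.
Proof. exact: (@linZ K T K^o (wcoef w) c x (wcoef_linear w)). Qed.

Lemma wcoefE w v : wcoef w (word K v) = (v == w)%:R.
Proof. by rewrite /wcoef freealg_linextE. Qed.

(** The projection modulo the span of the words vanishes on every word, so it is the zero map by
    [freealg_ext]. *)
Lemma lspan_words (x : T) : lspan (range (word K (I:=I))) x.
Proof.
have := @freealg_ext K I _ (to_lquot (range (word K (I:=I)))) (fun=> 0).
move=> /(_ (linearP _) (@lin_zero _ _ _)) E.
have /to_lquotP : to_lquot (range (word K (I:=I))) x =
                  to_lquot (range (word K (I:=I))) 0.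
  rewrite linear0; apply: E => w; rewrite -[RHS](linear0 (to_lquot (range (word K (I:=I))))).
  by apply/to_lquotP; rewrite subr0; apply: lspan_gen; exists w.
by rewrite subr0.
Qed.

Lemma freealg_ind (S : set T) : subspace S -> (forall w, S (word K w)) -> forall x, S x.
Proof.
move=> SP Sw x; have := lspan_words x; apply: lspan_min => // y [w _ <-].
exact: Sw.
Qed.

(** The expansion holds over every list containing the support, so that two elements can be expanded
    over the same list. *)
Lemma wcoef_expand (x : T) : exists r : seq {fmonom I}, forall s, uniq s ->
  {subset r <= s} -> x = \sum_(w <- s) wcoef w x *: word K w.
Proof.
move: x; apply: (@freealg_ind [set x | _]).
  apply/subspaceP; split=> [|c x y [r rE] [r' r'E]].
    by exists [::] => s _ _; rewrite big1 // => w _; rewrite wcoef0 scale0r.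
  exists (r ++ r') => s us rs.
  rewrite {1}(rE s)// => [|w wr]; last by apply: rs; rewrite mem_cat wr.
  rewrite {1}(r'E s)// => [|w wr]; last by apply: rs; rewrite mem_cat wr orbT.
  rewrite scaler_sumr -big_split /=; apply: eq_bigr => w _.
  by rewrite wcoef_linear scalerDl scalerA.
move=> w; exists [:: w] => s us ws.
rewrite (bigD1_seq w)//= ?ws ?inE// wcoefE eqxx scale1r.
by rewrite big1 ?addr0// => v vw; rewrite wcoefE eq_sym (negPf vw) scale0r.
Qed.

Lemma wcoef_eq0 (x : T) : (forall w, wcoef w x = 0) -> x = 0.
Proof.
move=> x0; have [r /(_ (undup r) (undup_uniq r)) ->] := wcoef_expand x.
  by rewrite big1 // => w _; rewrite x0 scale0r.
by move=> w; rewrite mem_undup.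
Qed.

Lemma word1 : word K mone = 1 :> T.
Proof.
have E (x : T) : word K mone * x = x.
  move: x; apply: (freealg_ind (subspace_eq (@lin_mull _ _ _) (@lin_id _ _))) => w.
  by rewrite /= wordM mul1m.
by rewrite -[LHS]mulr1 E.
Qed.

(** Turns a list of letters into a monoid word, so that statements about words can be proved by
    induction on lists. *)
Definition wseq (s : seq I) : {fmonom I} := foldr (fun i w => mmul (fmu i) w) mone s.

Lemma wseqE (w : {fmonom I}) : wseq w = w.
Proof.
case: w => s; apply: val_inj => /=.
by elim: s => /= [|i s IH]; rewrite ?fm1 ?fmM ?fmU ?IH.
Qed.

Lemma wseqK s : wseq s = s :> seq I.
Proof. by elim: s => /= [|i s IH]; rewrite ?fm1 ?fmM ?fmU ?IH. Qed.

Lemma word_cons i s : word K (wseq (i :: s)) = gen K i * word K (wseq s).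
Proof. by rewrite /gen wordM. Qed.

Lemma word_ind (P : T -> Prop) : P 1 -> (forall i s, P (word K (wseq s)) -> P (gen K i * word K (wseq s))) ->
  forall w, P (word K w).
Proof.
move=> P1 PM w; rewrite -[w]wseqE; elim: (w : seq I) => [|i s IH].
  by rewrite word1.
by rewrite word_cons; exact: PM.
Qed.

Section Lift.
Variables (A : algType K) (h : I -> A).

Definition freealg_lift : T -> A :=
  freealg_linext (fun w => \prod_(i <- (w : seq I)) h i).

Lemma freealg_lift_linear : linear freealg_lift.
Proof. exact: freealg_linext_linear. Qed.

Lemma freealg_lift_word w : freealg_lift (word K w) = \prod_(i <- (w : seq I)) h i.
Proof. exact: freealg_linextE. Qed.

Lemma freealg_lift1 : freealg_lift 1 = 1.
Proof. by rewrite -word1 freealg_lift_word fm1 big_nil. Qed.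

Lemma freealg_lift_gen i : freealg_lift (gen K i) = h i.
Proof. by rewrite /gen freealg_lift_word fmU big_seq1. Qed.

Lemma freealg_liftM : {morph freealg_lift : x y / x * y}.
Proof.
move=> x y; move: x; apply: (freealg_ind (subspace_eq _ _)) => [||v] /=.
- exact: lin_comp freealg_lift_linear (lin_mulr y).
- exact: lin_comp (lin_mulr (freealg_lift y)) freealg_lift_linear.
move: y; apply: (freealg_ind (subspace_eq _ _)) => [||w] /=.
- exact: lin_comp freealg_lift_linear (lin_mull _).
- exact: lin_comp (lin_mull _) freealg_lift_linear.
by rewrite wordM !freealg_lift_word fmM big_cat.
Qed.

Lemma freealg_lift_unique (f : T -> A) : linear f -> f 1 = 1 -> {morph f : x y / x * y} ->
  (forall i, f (gen K i) = h i) -> f =1 freealg_lift.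
Proof.
move=> fl f1 fM fh; apply: (freealg_ind (subspace_eq _ _)) => //.
  exact: freealg_lift_linear.
apply: word_ind => [|i s IH] /=; first by rewrite f1 freealg_lift1.
by rewrite fM freealg_liftM fh freealg_lift_gen IH.
Qed.

End Lift.
End FreeAlgebraTheory.

Section FreeAlgGrading.
Variables (K : fieldType) (a : nat -> nat).
Local Notation I := (seq_gens a).
Local Notation T := (freealg K I).
Local Notation gr := (@freealg_gr K a).

Lemma freealg_gr_subspace n : subspace (gr n).
Proof. exact: subspace_lspan. Qed.

Lemma word_degree1 : word_degree (mone : {fmonom I}) = 0%N.
Proof. by rewrite /word_degree fm1 big_nil. Qed.

Lemma word_degreeM (v w : {fmonom I}) :
  word_degree (mmul v w) = (word_degree v + word_degree w)%N.
Proof. by rewrite /word_degree fmM big_cat. Qed.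

Lemma word_gr w : gr (word_degree w) (word K w).
Proof. by apply: lspan_gen; exists w. Qed.

Lemma freealg_grP n x : gr n x <-> forall w, wcoef w x != 0 -> word_degree w = n.
Proof.
split.
  move=> gx w /eqP wx; apply/eqP/negPn/negP => wn; apply: wx; move: x gx.
  apply: (@lspan_eq K _ K^o (wcoef w) (fun=> 0) _ (wcoef_linear w) (@lin_zero _ _ _)) => _ [v /= vn <-].
  rewrite /= wcoefE; case: eqP => // vw.
  by rewrite -vn vw eqxx in wn.
move=> xn; have [r /(_ (undup r) (undup_uniq r)) ->] := wcoef_expand x.
  apply: subspace_sum (subspace_lspan _) _ => w _.
  have [->|wx] := eqVneq (wcoef w x) 0.
    by rewrite scale0r; exact: lspan0.
  apply: subspaceZ (subspace_lspan _) _; rewrite -(xn _ wx); exact: word_gr.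
by move=> w; rewrite mem_undup.
Qed.

Lemma freealg_grading : grading gr.
Proof.
split=> [n|x|N y gy y0 n nN]; first exact: subspace_lspan.
  move: x; apply: (@freealg_ind _ _ [set x | exists N (y : nat -> T),
    (forall n, gr n (y n)) /\ x = \sum_(n < N) y n]) => [|w].
    apply/subspaceP; split=> [|c _ _ [N [y [gy ->]]] [M [z [gz ->]]]].
      exists 0%N, (fun=> 0); rewrite big_ord0; split=> // n; exact: lspan0.
    exists (maxn N M), (fun n => c *: (if (n < N)%N then y n else 0) + (if (n < M)%N then z n else 0)).
    split=> [n|].
      by apply: (subspaceZD _ (freealg_gr_subspace n)); case: ifP => // _; exact: (subspace0 (freealg_gr_subspace n)).
    rewrite big_split /= -scaler_sumr -!big_mkcond /=.
    by rewrite -(big_ord_widen _ y (leq_maxl _ _)) -(big_ord_widen _ z (leq_maxr _ _)).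
  exists (word_degree w).+1, (fun n => if n == word_degree w then word K w else 0).
  split=> [n|]; first by case: eqP => [->|_]; [exact: word_gr|exact: lspan0].
  rewrite big_ord_recr /= eqxx big1 ?add0r// => i _.
  by case: eqP => // E; have := ltn_ord i; rewrite E ltnn.
apply: wcoef_eq0 => w; apply/eqP/negPn/negP => wn.
have wE : word_degree w = n by apply: (freealg_grP n (y n)).1.
have := congr1 (wcoef w) y0; rewrite wcoef_sum wcoef0.
rewrite (bigD1 (Ordinal nN))//= big1 ?addr0; first by apply/eqP.
move=> i ni; apply/eqP/negPn/negP => /(freealg_grP i (y i)).1 -/(_ (gy i)) E.
by case/eqP: ni; apply: val_inj; rewrite /= -wE E.
Qed.

Lemma freealg_gr1 : gr 0 1.
Proof. by rewrite -word1 -word_degree1; exact: word_gr. Qed.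

Lemma freealg_gr_gen i : gr (tag i).+1 (gen K i).
Proof.
by have := @word_gr (fmu i); rewrite {1}/word_degree fmU big_seq1.
Qed.

Lemma freealg_grM m n x y : gr m x -> gr n y -> gr (m + n) (x * y).
Proof.
move=> gx gy; move: x gx; apply: (lspan_map (lin_mulr y) (subspace_lspan _)).
move=> _ [v /= vm <-]; move: y gy; apply: (lspan_map (lin_mull _) (subspace_lspan _)).
move=> _ [w /= wn <-]; rewrite wordM -vm -wn -word_degreeM; exact: word_gr.
Qed.

End FreeAlgGrading.

(** * Words, and maps between tensor products *)

Section Words.
Variable a : nat -> nat.
Local Notation I := (seq_gens a).

Definition seq_degree (s : seq I) : nat := (\sum_(x <- s) (tag x).+1)%N.

Definition gens_below (n : nat) : seq I :=
  flatten [seq [seq Tagged (fun k => 'I_(a k)) i | i <- enum 'I_(a m)] | m <- iota 0 n].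

Lemma mem_gens_below n (x : I) : (x \in gens_below n) = (tag x < n)%N.
Proof.
apply/flatten_mapP/idP => [[m]|xn].
  by rewrite mem_iota add0n => /andP[_ mn] /mapP[i _ ->].
exists (tag x); first by rewrite mem_iota add0n.
by apply/mapP; exists (tagged x); [rewrite mem_enum|case: (x)].
Qed.

Lemma gens_below_uniq n : uniq (gens_below n).
Proof.
apply: allpairs_uniq_dep => [||[m i] [m' i'] _ _ /= E].
- exact: iota_uniq.
- by move=> m _; exact: enum_uniq.
- by move: (E) => /(congr1 tag) /= mm; case: _ / mm i' E => i' /eqP; rewrite eq_Tagged /= => /eqP->.
Qed.

(** [k] is fuel for the recursion on the degree [n], which drops by at least 1 with each letter; k
    >= n is enough. Since a letter of tag m has degree m + 1, [gens_below n] holds the letters of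
    degree at most n. *)
Fixpoint words (k n : nat) : seq (seq I) :=
  if n is 0 then [:: [::]] else
  if k is k'.+1 then [seq x :: s | x <- gens_below n, s <- words k' (n - (tag x).+1)]
  else [::].

Lemma mem_words k n s : (n <= k)%N -> (s \in words k n) = (seq_degree s == n).
Proof.
rewrite /seq_degree; elim: k n s => [|k IH] [|n] s //= nk.
- by case: s => [|x s]; rewrite !inE ?big_nil ?big_cons.
- by case: s => [|x s]; rewrite !inE ?big_nil ?big_cons.
have E (x : I) : (tag x < n.+1)%N -> (n.+1 - (tag x).+1 <= k)%N.
  by move=> xn; rewrite subSS (leq_trans (leq_subr _ _)).
apply/allpairsPdep/idP => [[x [t]]|].
  rewrite mem_gens_below => -[xn]; rewrite IH; last exact: E.
  by move=> /eqP tE ->; rewrite big_cons tE subnKC.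
case: s => [|x s]; rewrite ?big_nil// big_cons => /eqP xs.
have xn : (tag x < n.+1)%N by rewrite -xs leq_addr.
exists x, s; split=> //; first by rewrite mem_gens_below.
by rewrite IH; [rewrite -xs addKn|exact: E].
Qed.

Lemma words_uniq k n : uniq (words k n).
Proof.
elim: k n => [|k IH] [|n] //=.
apply: allpairs_uniq_dep => [||[x s] [y t] _ _ /= [-> ->]//].
  exact: gens_below_uniq.
by move=> x _; exact: IH.
Qed.

Definition nwords n := size (words n n).

Lemma size_words k n : (n <= k)%N -> size (words k n) = nwords n.
Proof.
move=> nk; apply/perm_size/uniq_perm; rewrite ?words_uniq// => s.
by rewrite !mem_words.
Qed.

Lemma nwords0 : nwords 0 = 1%N. Proof. by []. Qed.

Lemma nwordsS n : nwords n.+1 = (\sum_(m < n.+1) a m * nwords (n - m))%N.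
Proof.
rewrite /nwords /= size_allpairs_dep.
rewrite -(big_mkord xpredT (fun m => a m * nwords (n - m))%N) /index_iota subn0.
rewrite /gens_below map_flatten sumn_flatten -map_comp -map_comp sumnE big_map.
apply: eq_big_seq => m; rewrite mem_iota add0n => /andP[_ mn] /=.
rewrite sumnE !big_map (eq_bigr (fun=> nwords (n - m))).
  by rewrite big_const_seq count_predT iter_addn_0 -enumT size_enum_ord mulnC.
by move=> i _; rewrite subSS size_words// leq_subr.
Qed.

End Words.

Section FreeAlgebraDim.
Variables (K : fieldType) (a : nat -> nat).
Local Notation T := (freealg K (seq_gens a)).

Lemma word_degreeE s : word_degree (wseq s : {fmonom seq_gens a}) = seq_degree s.
Proof. by rewrite /word_degree wseqK. Qed.

Lemma freealg_gr_dim n : has_dim (@freealg_gr K a n) (nwords a n).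
Proof.
apply: (@has_dim_seq _ _ _ (words a n n) (fun s => word K (wseq s))).
- exact: words_uniq.
- exact: freealg_gr_subspace.
- by move=> s; rewrite mem_words// => /eqP<-; rewrite -word_degreeE; exact: word_gr.
- apply: lspanS => _ [w /= wn <-]; exists (w : seq _); last by rewrite wseqE.
  by rewrite /= mem_words// -word_degreeE wseqE wn.
move=> c c0 s sn; have := congr1 (wcoef (wseq s)) c0.
rewrite wcoef_sum wcoef0 (bigD1_seq s)//= ?words_uniq// => <-.
rewrite big1 ?addr0 => [|t ts].
  by rewrite wcoefZ wcoefE eqxx mulr1.
rewrite wcoefZ wcoefE; case: eqP => [E|_]; last by rewrite mulr0.
by have := congr1 val E; rewrite /= !wseqK => /eqP; rewrite (negPf ts).
Qed.

End FreeAlgebraDim.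

Section Relabel.
Variables (K : fieldType) (I J : choiceType) (f : I -> J) (g : J -> I).
Hypotheses (fK : cancel f g).

Lemma freealg_relabelK (x : freealg K I) :
  freealg_lift (fun j => gen K (g j)) (freealg_lift (fun i => gen K (f i)) x) = x.
Proof.
rewrite [RHS](@freealg_lift_unique K I _ (@gen K I) id)//.
apply: (@freealg_lift_unique _ _ _ _ (fun x => freealg_lift _ (freealg_lift _ x))) => [||u v|i].
- exact: lin_comp (freealg_lift_linear _) (freealg_lift_linear _).
- by rewrite !freealg_lift1.
- by rewrite !freealg_liftM.
- by rewrite !freealg_lift_gen fK.
Qed.

End Relabel.

(** * Linear and bilinear maps on tensor products *)

Section TensorTheory.
Variable K : fieldType.
Implicit Types U V W : lmodType K.

Lemma tensDl U V (u u' : U) (v : V) : (u + u') ⊗ v = u ⊗ v + u' ⊗ v.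
Proof. exact: (linD _ _ ((tens_bilinear U V).1 v)). Qed.

Lemma tensDr U V (u : U) (v v' : V) : u ⊗ (v + v') = u ⊗ v + u ⊗ v'.
Proof. exact: (linD _ _ ((tens_bilinear U V).2 u)). Qed.

Lemma tensZl U V c (u : U) (v : V) : (c *: u) ⊗ v = c *: (u ⊗ v).
Proof. exact: (linZ _ _ ((tens_bilinear U V).1 v)). Qed.

Lemma tensZr U V c (u : U) (v : V) : u ⊗ (c *: v) = c *: (u ⊗ v).
Proof. exact: (linZ _ _ ((tens_bilinear U V).2 u)). Qed.

Lemma lin_tensl U V (v : V) : linear (fun u : U => u ⊗ v).
Proof. exact: (tens_bilinear U V).1. Qed.

Lemma lin_tensr U V (u : U) : linear (fun v : V => u ⊗ v).
Proof. exact: (tens_bilinear U V).2. Qed.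

Lemma bilin_comp U V U' V' W (b : U' -> V' -> W) (f : U -> U') (g : V -> V') :
  bilinear_map b -> linear f -> linear g -> bilinear_map (fun u v => b (f u) (g v)).
Proof.
move=> [bl br] fl gl; split=> [v|u].
  exact: (lin_comp (bl (g v)) fl).
exact: (lin_comp (br (f u)) gl).
Qed.

Lemma bilin_tens U V U' V' (f : U -> U') (g : V -> V') :
  linear f -> linear g -> bilinear_map (fun u v => f u ⊗ g v).
Proof. by move=> fl gl; apply: bilin_comp => //; exact: tens_bilinear. Qed.

Lemma bilin_mul (A : algType K) : bilinear_map (fun x y : A => x * y).
Proof. by split=> x; [exact: lin_mulr|exact: lin_mull]. Qed.

Lemma bilin_swap U V W (b : U -> V -> W) :
  bilinear_map b -> bilinear_map (fun v u => b u v).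
Proof. by case. Qed.

Lemma bilin_scale U V W (f : U -> K) (g : V -> W) :
  scalar f -> linear g -> bilinear_map (fun u v => f u *: g v).
Proof.
move=> fl gl; split=> [v c u u'|u c v v'].
  by rewrite fl scalerDl scalerA.
by rewrite gl scalerDr !scalerA mulrC.
Qed.

Lemma tmap_linear U V U' V' (f : U -> U') (g : V -> V') :
  linear f -> linear g -> linear (tmap f g).
Proof. by move=> fl gl; apply: tlift_linear; exact: bilin_tens. Qed.

Lemma tmapE U V U' V' (f : U -> U') (g : V -> V') u v :
  linear f -> linear g -> tmap f g (u ⊗ v) = f u ⊗ g v.
Proof. by move=> fl gl; rewrite /tmap tliftE//; exact: bilin_tens. Qed.

Lemma tswap_linear U V : linear (@tswap K U V).
Proof. by apply: tlift_linear; apply: bilin_swap; exact: tens_bilinear. Qed.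

Lemma tswapE U V (u : U) (v : V) : tswap (u ⊗ v) = v ⊗ u.
Proof. by rewrite /tswap tliftE//; apply: bilin_swap; exact: tens_bilinear. Qed.

Lemma tassoc_inner_bilin U V W (w : W) :
  bilinear_map (fun (u : U) (v : V) => u ⊗ (v ⊗ w)).
Proof.
by apply: bilin_comp (tens_bilinear _ _) (@lin_id _ _) (lin_tensl _).
Qed.

Lemma tassoc_bilin U V W :
  bilinear_map (fun (t : tensor U V) (w : W) => tlift (fun u v => u ⊗ (v ⊗ w)) t).
Proof.
split=> [w|t c w w']; first by apply: tlift_linear; exact: tassoc_inner_bilin.
by apply: tlift_linear_map => u v; rewrite tensDr tensZr tensDr tensZr.
Qed.

Lemma tassoc_linear U V W : linear (@tassoc K U V W).
Proof. by apply: tlift_linear; exact: tassoc_bilin. Qed.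

Lemma tassocE U V W (u : U) (v : V) (w : W) : tassoc ((u ⊗ v) ⊗ w) = u ⊗ (v ⊗ w).
Proof.
rewrite /tassoc tliftE; last exact: tassoc_bilin.
by rewrite tliftE//; exact: tassoc_inner_bilin.
Qed.

(** The operator g (x) 1 + 1 (x) h. With g and h left multiplication by a primitive x, it is
    multiplication by the coproduct of x ([tensor_mul_prim]). Each Hopf axiom below is carried from
    y to x y by commuting a structure map with such an operator. *)
Definition tder U V (g : U -> U) (h : V -> V) (t : tensor U V) : tensor U V :=
  tmap g id t + tmap id h t.

Section Derivation.
Variables (U V W : lmodType K) (g : U -> U) (h : V -> V) (k : W -> W).
Hypotheses (gl : linear g) (hl : linear h) (kl : linear k).

Lemma tder_linear : linear (tder g h).
Proof. by apply: lin_add; apply: tmap_linear. Qed.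

Lemma tderE u v : tder g h (u ⊗ v) = g u ⊗ v + u ⊗ h v.
Proof. by rewrite /tder 2?tmapE. Qed.

End Derivation.

Section DerivationAssoc.
Variables (U V W : lmodType K) (g : U -> U) (h : V -> V) (k : W -> W).
Hypotheses (gl : linear g) (hl : linear h) (kl : linear k).

Lemma tassoc_tder t : tassoc (tder (tder g h) k t) = tder g (tder h k) (tassoc t).
Proof.
have La := @tassoc_linear U V W.
have L1 := tder_linear gl hl; have L2 := tder_linear hl kl.
have L3 := tder_linear L1 kl; have L4 := tder_linear gl L2.
move: t; apply: tensor_ext; [exact: lin_comp La L3|exact: lin_comp L4 La|].
move=> s w; rewrite (tderE L1 kl); move: s; apply: tensor_ext.
- by apply: (lin_comp La); apply: lin_add (lin_comp (lin_tensl _) L1) (lin_tensl _).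
- exact: lin_comp L4 (lin_comp La (lin_tensl _)).
move=> u v; rewrite (tassocE u v w) (tderE gl hl u v) tensDl 2!(linD _ _ La) (tderE gl L2).
rewrite (tassocE (g u) v w) (tassocE u (h v) w) (tassocE u v (k w)).
by rewrite (tderE hl kl) tensDr addrA.
Qed.

End DerivationAssoc.

Section DerivationMap.
Variables (U V U' V' : lmodType K) (g : U -> U) (h : V -> V) (g' : U' -> U') (h' : V' -> V').
Variables (p : U -> U') (q : V -> V').
Hypotheses (gl : linear g) (hl : linear h) (gl' : linear g') (hl' : linear h').
Hypotheses (pl : linear p) (ql : linear q).
Hypotheses (pg : forall u, p (g u) = g' (p u)) (qh : forall v, q (h v) = h' (q v)).

Lemma tmap_tder t : tmap p q (tder g h t) = tder g' h' (tmap p q t).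
Proof.
have Lm := tmap_linear pl ql; have L := tder_linear gl hl.
have L' := tder_linear gl' hl'.
move: t; apply: tensor_ext; [exact: lin_comp Lm L|exact: lin_comp L' Lm|].
move=> u v; rewrite (tmapE u v pl ql) (tderE gl hl u v) (tderE gl' hl').
by rewrite (linD _ _ Lm) (tmapE (g u) v pl ql) (tmapE u (h v) pl ql) pg qh.
Qed.

End DerivationMap.

Lemma tswap_tder U V (g : U -> U) (h : V -> V) t : linear g -> linear h ->
  tswap (tder g h t) = tder h g (tswap t).
Proof.
move=> gl hl; have Ls := @tswap_linear U V.
have L := tder_linear gl hl; have L' := tder_linear hl gl.
move: t; apply: tensor_ext; [exact: lin_comp Ls L|exact: lin_comp L' Ls|].
move=> u v; rewrite (tderE gl hl) (linD _ _ Ls) !tswapE.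
by rewrite (tderE hl gl) addrC.
Qed.

Lemma tlift_tder U V W (b : U -> V -> W) (g : U -> U) (h : V -> V) (k : W -> W) t :
  bilinear_map b -> linear g -> linear h -> linear k ->
  (forall u v, b (g u) v + b u (h v) = k (b u v)) ->
  tlift b (tder g h t) = k (tlift b t).
Proof.
move=> bb gl hl kl E; have Lb := tlift_linear bb; have L := tder_linear gl hl.
move: t; apply: tensor_ext; [exact: lin_comp Lb L|exact: lin_comp kl Lb|].
move=> u v; rewrite (tliftE bb u v) (tderE gl hl) (linD _ _ Lb) -E.
by congr (_ + _); exact: tliftE.
Qed.

Section Mul.
Variables A B : algType K.
Implicit Types s t : tensor A B.

Lemma lin_tmull s : linear (fun t => tensor_mul s t).
Proof. by move=> c t t'; exact: tensor_mulPr. Qed.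

Lemma lin_tmulr s : linear (fun t => tensor_mul t s).
Proof. by move=> c t t'; exact: tensor_mulPl. Qed.

Lemma tensor_mul_prim (x : A) (y : B) t :
  tensor_mul (x ⊗ 1 + 1 ⊗ y) t = tder (fun a => x * a) (fun b => y * b) t.
Proof.
move: t; apply: tensor_ext.
- exact: lin_tmull.
- by apply: tder_linear; exact: lin_mull.
move=> a b; rewrite tderE; try exact: lin_mull.
by rewrite tensor_mulDl !tensor_mulE !mul1r.
Qed.

End Mul.
End TensorTheory.

#[global] Opaque tmap tassoc tswap tder.

(** * Hopf algebras freely generated by primitives *)

(** The coalgebra is constrained only through multiplicativity and its values on letters.
    Coassociativity, cocommutativity, the counit laws and the antipode are all derived from this. *)
Record prim_presentation (K : fieldType) (a : nat -> nat) (H : hopf_data K)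
    (f : freealg K (seq_gens a) -> H) : Prop := {
  pp_linear : linear f;
  pp1 : f 1 = 1;
  ppM : {morph f : x y / x * y};
  pp_bij : bijective f;
  pp_gr : forall n x, freealg_gr n x <-> hgr n (f x);
  pp_comul_linear : linear (@hcomul K H);
  pp_comul1 : hcomul (1 : H) = 1 ⊗ 1;
  pp_comulM : forall x y : H, hcomul (x * y) = tensor_mul (hcomul x) (hcomul y);
  pp_counit_linear : scalar (@hcounit K H);
  pp_counit1 : hcounit (1 : H) = 1;
  pp_counitM : forall x y : H, hcounit (x * y) = hcounit x * hcounit y;
  pp_comul_gen : forall i, hcomul (f (gen K i)) = f (gen K i) ⊗ 1 + 1 ⊗ f (gen K i);
  pp_counit_gen : forall i, hcounit (f (gen K i)) = 0
}.

Section PrimPresentation.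
Variables (K : fieldType) (a : nat -> nat) (H : hopf_data K).
Variable f : freealg K (seq_gens a) -> H.
Hypothesis fP : prim_presentation f.
Local Notation Δ := (@hcomul K H).
Local Notation ε := (@hcounit K H).
Local Notation x_ i := (f (gen K i)).

Let fl := pp_linear fP.
Let Dl : linear Δ := pp_comul_linear fP.
Let el : linear (ε : H -> K^o) := pp_counit_linear fP.

Lemma pp_surj (x : H) : exists t, x = f t.
Proof. by have [g fK gK] := pp_bij fP; exists (g x); rewrite gK. Qed.

(** Words are built by left multiplication by letters. Multiplicativity is not assumed of [F] and
    [G], so the principle also covers maps into a plain module and convolution products with the
    antipode. *)
Lemma pp_ext (W : lmodType K) (F G : H -> W) : linear F -> linear G -> F 1 = G 1 ->
  (forall i y, F y = G y -> F (x_ i * y) = G (x_ i * y)) -> F =1 G.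
Proof.
move=> Fl Gl F1 FM x; have [t ->] := pp_surj x.
move: t; apply: (freealg_ind (subspace_eq (lin_comp Fl fl) (lin_comp Gl fl))).
apply: (@word_ind _ _ (fun t => F (f t) = G (f t))) => [|i s E]; first by rewrite (pp1 fP).
by rewrite (ppM fP) FM.
Qed.

Lemma comul_gen_mul i y : Δ (x_ i * y) = tder (fun z => x_ i * z) (fun z => x_ i * z) (Δ y).
Proof. by rewrite (pp_comulM fP) (pp_comul_gen fP) tensor_mul_prim. Qed.

Lemma counit_gen_mul i y : ε (x_ i * y) = 0.
Proof. by rewrite (pp_counitM fP) (pp_counit_gen fP) mul0r. Qed.

Let ml (g : H) : linear (fun y : H => g * y) := @lin_mull K H g.

(** Both sides turn left multiplication by a generator x into x (x) 1 (x) 1 + 1 (x) x (x) 1 + 1 (x)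
    1 (x) x. *)
Lemma pp_coassoc x : tassoc (tmap Δ id (Δ x)) = tmap id Δ (Δ x).
Proof.
have idl (V : lmodType K) : linear (@id V) by [].
have L1 := tmap_linear Dl (idl H).
have L2 := tmap_linear (idl H) Dl.
have La := @tassoc_linear K H H H.
have tl i := tder_linear (ml (x_ i)) (ml (x_ i)).
move: x; apply: (pp_ext (F := fun x => tassoc (tmap Δ id (Δ x))) (G := fun x => tmap id Δ (Δ x))) => [|||i y E].
- exact: lin_comp La (lin_comp L1 Dl).
- exact: lin_comp L2 Dl.
- by rewrite (pp_comul1 fP) (tmapE _ _ Dl (idl H)) (tmapE _ _ (idl H) Dl) (pp_comul1 fP) tassocE.
have Dg := @comul_gen_mul i.
rewrite {1 2}Dg (tmap_tder (ml _) (ml _) (tl i) (ml _) Dl (idl H) Dg (fun=> erefl)).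
rewrite (tassoc_tder (ml _) (ml _) (ml _)) E.
by rewrite (tmap_tder (ml _) (ml _) (ml _) (tl i) (idl H) Dl (fun=> erefl) Dg).
Qed.

Lemma pp_cocomm x : tswap (Δ x) = Δ x.
Proof.
have Ls := @tswap_linear K H H.
move: x; apply: (pp_ext (F := fun x => tswap (Δ x)) (G := Δ)) => [|||i y E].
- exact: lin_comp Ls Dl.
- exact: Dl.
- by rewrite (pp_comul1 fP) tswapE.
by rewrite comul_gen_mul (tswap_tder _ (ml _) (ml _)) E.
Qed.

Let counitl_bilin : bilinear_map (fun y z : H => ε y *: z).
Proof. exact: bilin_scale (pp_counit_linear fP) (@lin_id _ _). Qed.

Let counitr_bilin : bilinear_map (fun y z : H => ε z *: y).
Proof. exact: bilin_swap (bilin_scale (pp_counit_linear fP) (@lin_id _ _)). Qed.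

Lemma pp_counitl x : tlift (fun y z : H => ε y *: z) (Δ x) = x.
Proof.
have Lb := tlift_linear counitl_bilin.
move: x; apply: (pp_ext (F := fun x => tlift (fun y z : H => ε y *: z) (Δ x)) (G := id)) => [|||i y E] //.
- exact: lin_comp Lb Dl.
- by rewrite (pp_comul1 fP) (tliftE counitl_bilin) (pp_counit1 fP) scale1r.
rewrite comul_gen_mul (tlift_tder _ counitl_bilin (ml _) (ml _) (ml (x_ i))) ?E// => u v.
by rewrite counit_gen_mul scale0r add0r scalerAr.
Qed.

Lemma pp_counitr x : tlift (fun y z : H => ε z *: y) (Δ x) = x.
Proof.
have Lb := tlift_linear counitr_bilin.
move: x; apply: (pp_ext (F := fun x => tlift (fun y z : H => ε z *: y) (Δ x)) (G := id)) => [|||i y E] //.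
- exact: lin_comp Lb Dl.
- by rewrite (pp_comul1 fP) (tliftE counitr_bilin) (pp_counit1 fP) scale1r.
rewrite comul_gen_mul (tlift_tder _ counitr_bilin (ml _) (ml _) (ml (x_ i))) ?E// => u v.
by rewrite counit_gen_mul scale0r addr0 scalerAr.
Qed.

Lemma pp_grading : grading (@hgr K H).
Proof. exact: grading_bij fl (pp_bij fP) (pp_gr fP) (@freealg_grading K a). Qed.

Lemma pp_grE n x : hgr n x <-> exists2 t, freealg_gr n t & x = f t.
Proof.
split=> [gx|[t gt ->]]; last exact/(pp_gr fP).
by have [t xE] := pp_surj x; exists t => //; apply/(pp_gr fP); rewrite -xE.
Qed.

Lemma pp_gr_ind n (S : set H) : subspace S ->
  (forall s, seq_degree s = n -> S (f (word K (wseq s)))) -> hgr n `<=` S.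
Proof.
move=> SP Sw x /pp_grE[t gt ->]; move: t gt; apply: (lspan_map fl SP) => _ [w /= wn <-].
by rewrite -[w]wseqE; apply: Sw; rewrite -word_degreeE wseqE.
Qed.

Lemma pp_word_cons i s :
  f (word K (wseq (i :: s))) = x_ i * f (word K (wseq s)).
Proof. by rewrite word_cons (ppM fP). Qed.

Lemma pp_gr_gen i : hgr (tag i).+1 (x_ i).
Proof. by apply/(pp_gr fP); exact: freealg_gr_gen. Qed.

Lemma pp_gr_mul m n (x y : H) : hgr m x -> hgr n y -> hgr (m + n) (x * y).
Proof.
move=> /pp_grE[s gs ->] /pp_grE[t gt ->]; rewrite -(ppM fP).
by apply/(pp_gr fP); exact: freealg_grM.
Qed.

Lemma pp_gr1 : hgr 0 (1 : H).
Proof. by rewrite -(pp1 fP); apply/(pp_gr fP); exact: freealg_gr1. Qed.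

Lemma pp_comul_gr n (x : H) : hgr n x ->
  lspan [set t | exists i j (y z : H),
    [/\ (i + j)%N = n, hgr i y, hgr j z & t = y ⊗ z]] (Δ x).
Proof.
pose S n := lspan [set t | exists i j (y z : H),
    [/\ (i + j)%N = n, hgr i y, hgr j z & t = y ⊗ z]].
rewrite -/(S n); move: x; apply: (pp_gr_ind (S := [set x | S n (Δ x)])).
  by apply: subspace_preim Dl _; exact: subspace_lspan.
move=> s <- /=; elim: s => [|i s IH].
  rewrite word1 (pp1 fP) (pp_comul1 fP) /seq_degree big_nil /S; apply: lspan_gen => /=.
  by exists 0%N, 0%N, 1, 1; split=> //; exact: pp_gr1.
rewrite pp_word_cons comul_gen_mul /seq_degree big_cons -/(seq_degree s).
move: IH; apply: lspan_map; [exact: tder_linear (ml _) (ml _)|exact: subspace_lspan|].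
move=> _ [j [k [y [z [<- gy gz ->]]]]]; rewrite (tderE (ml _) (ml _)).
apply: subspaceD (subspace_lspan _) _ _; apply: lspan_gen.
- exists ((tag i).+1 + j)%N, k, (x_ i * y), z; split; rewrite ?addnA//.
  by apply: pp_gr_mul => //; exact: pp_gr_gen.
- exists j, ((tag i).+1 + k)%N, y, (x_ i * z); split; rewrite ?(addnCA j)//.
  by apply: pp_gr_mul => //; exact: pp_gr_gen.
Qed.

Lemma pp_counit_gr n (x : H) : hgr n.+1 x -> ε x = 0.
Proof.
apply: (pp_gr_ind (S := [set x | (ε x : K^o) = 0])); first exact: subspace_ker el.
by case=> [|i s] /=; rewrite ?pp_word_cons ?counit_gen_mul// /seq_degree big_nil.
Qed.

(** The antiautomorphism negating the generators: a word is reversed and each letter changes sign.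
    [xget] selects the preimage under the bijection [f]. *)
Definition pp_antipode (x : H) : H :=
  freealg_linext (fun w => \prod_(i <- rev (w : seq (seq_gens a))) - x_ i)
    (xget 0 [set t | x = f t]).

Let finv x : f (xget 0 [set t | x = f t]) = x.
Proof. by rewrite -(xgetPex 0 (pp_surj x)). Qed.

Let finvK : cancel f (fun x => xget 0 [set t | x = f t]).
Proof. by move=> t; apply: (bij_inj (pp_bij fP)); rewrite finv. Qed.

Lemma pp_antipode_linear : linear pp_antipode.
Proof.
apply: lin_comp; first exact: freealg_linext_linear.
exact: linear_can fl finvK finv.
Qed.

Lemma pp_antipode_word s :
  pp_antipode (f (word K (wseq s))) = \prod_(i <- rev s) - x_ i.
Proof. by rewrite /pp_antipode finvK freealg_linextE wseqK. Qed.

Lemma pp_antipode_gen i y : pp_antipode (x_ i * y) = - (pp_antipode y * x_ i).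
Proof.
move: y; apply: (pp_ext (F := fun y => pp_antipode (x_ i * y))
  (G := fun y => - (pp_antipode y * x_ i))) => [|||j y _].
- exact: lin_comp pp_antipode_linear (lin_mull _).
- by apply: lin_opp; exact: lin_comp (lin_mulr _) pp_antipode_linear.
- rewrite -(pp1 fP) -(word1 _ (seq_gens a)).
  have := pp_antipode_word [:: i]; have := pp_antipode_word [::].
  rewrite pp_word_cons /= => -> ->.
  by rewrite big_nil big_seq1 mul1r.
have [t ->] := pp_surj y; move: t; apply: freealg_ind => [|w].
  apply: subspace_eq; first exact: lin_comp pp_antipode_linear (lin_comp (lin_mull _) (lin_comp (lin_mull _) fl)).
  apply: lin_opp; apply: (lin_comp (lin_mulr _)).
  exact: lin_comp pp_antipode_linear (lin_comp (lin_mull _) fl).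
rewrite /= -[w]wseqE -!pp_word_cons !pp_antipode_word.
by rewrite rev_cons -cats1 big_cat /= big_seq1 mulrN.
Qed.

(** Let x be a generator and S the antipode. On the left side, S(x u) v + S(u) x v = 0 term by term.
    On the right side, passing from y to x y applies the commutator with x to the value at y, which
    is a scalar by induction. *)
Lemma pp_antipodeP : @is_antipode K H pp_antipode.
Proof.
have Sl := pp_antipode_linear.
have S1 : pp_antipode 1 = 1.
  by have := pp_antipode_word [::]; rewrite word1 (pp1 fP) big_nil.
have cl : linear (fun x : H => (ε x)%:A : H).
  by move=> c x y; rewrite (pp_counit_linear fP) scalerDl scalerA.
have bl : bilinear_map (fun y z : H => pp_antipode y * z).
  exact: bilin_comp (bilin_mul H) Sl (@lin_id _ _).
have br : bilinear_map (fun y z : H => y * pp_antipode z).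
  exact: bilin_comp (bilin_mul H) (@lin_id _ _) Sl.
split=> // [n|x].
  apply: (pp_gr_ind (S := [set x | hgr n (pp_antipode x)])).
    apply: subspace_preim Sl _; exact: gr_subspace pp_grading n.
  move=> s <- /=; rewrite pp_antipode_word; elim: s => [|i s IH].
    by rewrite big_nil /seq_degree big_nil; exact: pp_gr1.
  rewrite rev_cons -cats1 big_cat /= big_seq1 /seq_degree big_cons addnC.
  apply: pp_gr_mul => //; apply: subspaceN (gr_subspace pp_grading _) _; exact: pp_gr_gen.
split.
  move: x; apply: (pp_ext (F := fun x => tlift (fun y z : H => pp_antipode y * z) (Δ x))
    (G := fun x => (ε x)%:A)) => [|||i y _] //.
  - exact: lin_comp (tlift_linear bl) Dl.
  - by rewrite (pp_comul1 fP) tliftE// S1 mul1r (pp_counit1 fP) scale1r.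
  rewrite comul_gen_mul counit_gen_mul scale0r.
  rewrite (tlift_tder _ bl (ml _) (ml _) (@lin_zero _ H H))// => u v.
  by rewrite pp_antipode_gen mulNr mulrA addNr.
move: x; apply: (pp_ext (F := fun x => tlift (fun y z : H => y * pp_antipode z) (Δ x))
  (G := fun x => (ε x)%:A)) => [|||i y E] //.
- exact: lin_comp (tlift_linear br) Dl.
- by rewrite (pp_comul1 fP) tliftE// S1 mul1r (pp_counit1 fP) scale1r.
rewrite comul_gen_mul counit_gen_mul scale0r.
have kl : linear (fun z : H => x_ i * z - z * x_ i).
  by apply: lin_sub; [exact: lin_mull|exact: lin_mulr].
rewrite (tlift_tder _ br (ml _) (ml _) kl) => [|u v].
  by rewrite E -scalerAl -scalerAr mul1r mulr1 subrr.
by rewrite pp_antipode_gen mulrN !mulrA.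
Qed.

Lemma pp_graded_hopf : graded_hopf H.
Proof.
split.
- exact: pp_grading.
- exact: pp_gr1.
- exact: pp_gr_mul.
- exact: Dl.
- exact: pp_counit_linear fP.
- exact: pp_comul1 fP.
- exact: pp_comulM fP.
- exact: pp_counit1 fP.
- exact: pp_counitM fP.
- exact: pp_coassoc.
- exact: pp_counitl.
- exact: pp_counitr.
- exact: pp_comul_gr.
- exact: pp_counit_gr.
- by exists pp_antipode; exact: pp_antipodeP.
Qed.

Lemma pp_dim n : has_dim (@hgr K H n) (nwords a n).
Proof.
apply: (has_dim_bij fl (pp_bij fP)) (freealg_gr_dim K a n).
- exact: freealg_gr_subspace.
- exact: gr_subspace pp_grading n.
- exact: pp_gr fP n.
Qed.

Lemma pp_connected : hgr 0 = [set c%:A | c in [set: K]] :> set H.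
Proof.
apply/seteqP; split; last first.
  by move=> _ [c _ <-]; exact: subspaceZ (gr_subspace pp_grading _) pp_gr1.
apply: pp_gr_ind => [|[|i s]]; last by rewrite /seq_degree big_cons.
  apply/subspaceP; split=> [|c _ _ [d _ <-] [e _ <-]]; first by exists 0; rewrite ?scale0r.
  by exists (c * d + e); rewrite // scalerDl scalerA.
by exists 1; rewrite //= word1 (pp1 fP) scale1r.
Qed.

(** [freely_generated] asks for a subset of [H], so the index set of the generators is identified
    with its image; the generators are distinct because distinct letters are distinct words. *)
Lemma pp_free : freely_generated H.
Proof.
pose X : set H := range (fun i => x_ i); exists X; split.
  by move=> _ [i _ <-]; exists (tag i) => //; exact: pp_gr_gen.
have /choice[s sE] (x : X) : exists i, x_ i = val x.
  by case: x => x /=; rewrite inE => -[i _ E]; exists i.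
have Xx i : x_ i \in X by rewrite inE; exists i.
pose t i : X := SigSub (Xx i).
have gI : injective (fun i => x_ i).
  move=> i j /(bij_inj (pp_bij fP)) /(congr1 (wcoef (fmu i))).
  rewrite !wcoefE eqxx; case: eqP => [/(congr1 val) /=|_ /eqP]; last by rewrite oner_eq0.
  by rewrite !fmU => -[].
have sK : cancel s t by move=> x; apply: val_inj; rewrite /= sE.
have tK : cancel t s by move=> i; apply: gI; rewrite sE.
have [g fK gK] := pp_bij fP.
have E (z : freealg K X) : freealg_linext
    (fun w : {fmonom X} => \prod_(x <- (w : seq X)) (val x : H)) z =
    f (freealg_lift (fun x => gen K (s x)) z).
  symmetry; apply: (freealg_lift_unique (h := fun x : X => val x)
    (f := fun z => f (freealg_lift (fun x => gen K (s x)) z))) => [||u v|i].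
  - exact: lin_comp fl (freealg_lift_linear _).
  - by rewrite freealg_lift1 (pp1 fP).
  - by rewrite freealg_liftM (ppM fP).
  - by rewrite freealg_lift_gen sE.
exists (fun x => freealg_lift (fun i => gen K (t i)) (g x)) => z.
- by rewrite E fK freealg_relabelK.
- by rewrite E freealg_relabelK.
Qed.

Lemma pp_FGCCHA : FGCCHA H.
Proof.
split.
- exact: pp_graded_hopf.
- exact: pp_connected.
- by move=> n; exists (nwords a n); exact: pp_dim.
- exact: pp_cocomm.
- exact: pp_free.
Qed.

Lemma pp_dim_seq : dim_seq H = (fun n => nwords a n.+1).
Proof.
apply/funext => n; apply: dimensionE (pp_dim _); exact: gr_subspace pp_grading _.
Qed.

End PrimPresentation.

(** The map f' o f^-1 sends generators to generators, and compatibility with the coproduct and the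
    counit propagates along words by [pp_ext]. *)
Lemma prim_presentation_iso (K : fieldType) (a : nat -> nat) (H H' : hopf_data K)
    (f : freealg K (seq_gens a) -> H) (f' : freealg K (seq_gens a) -> H') :
  prim_presentation f -> prim_presentation f' -> hopf_iso H H'.
Proof.
move=> fP fP'; have [g fK gK] := pp_bij fP; have [g' fK' gK'] := pp_bij fP'.
have gl := linear_can (pp_linear fP) fK gK.
pose phi x := f' (g x).
have phil : linear phi := lin_comp (pp_linear fP') gl.
have phiM : {morph phi : x y / x * y}.
  by move=> x y; rewrite /phi -(ppM fP') -[x in LHS]gK -[y in LHS]gK -(ppM fP) fK.
have phi1 : phi 1 = 1 by rewrite /phi -(pp1 fP) fK (pp1 fP').
have phig i : phi (f (gen K i)) = f' (gen K i) by rewrite /phi fK.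
have [F FE] := lrmorphism_pack phil phi1 phiM.
exists F; rewrite FE; split.
- by exists (fun y => f (g' y)) => x; rewrite /phi ?fK' ?fK ?gK ?gK'.
- by move=> n x; rewrite /phi -(pp_gr fP') (pp_gr fP) gK.
- apply: (pp_ext fP (F := fun x => tmap phi phi (hcomul x)) (G := fun x => hcomul (phi x))) => [|||i y E].
  + exact: lin_comp (tmap_linear phil phil) (pp_comul_linear fP).
  + exact: lin_comp (pp_comul_linear fP') phil.
  + by rewrite (pp_comul1 fP) tmapE// phi1 (pp_comul1 fP').
  have ml (A : algType K) (x : A) := @lin_mull K A x.
  have phx z : phi (f (gen K i) * z) = f' (gen K i) * phi z by rewrite phiM phig.
  rewrite (comul_gen_mul fP) phx (comul_gen_mul fP') -E.
  exact: (tmap_tder (ml _ _) (ml _ _) (ml _ _) (ml _ _) phil phil phx phx).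
- apply: (@pp_ext _ _ _ _ fP K^o (fun x => hcounit (phi x)) (@hcounit K H)) => [|||i y _].
  + exact: (@lin_comp _ _ _ K^o (@hcounit K H') phi (pp_counit_linear fP') phil).
  + exact: pp_counit_linear fP.
  + by rewrite phi1 (pp_counit1 fP) (pp_counit1 fP').
  by rewrite phiM phig (counit_gen_mul fP) (counit_gen_mul fP').
Qed.

(** * Enveloping algebras of free Lie algebras *)

Section QuotientLift.
Variables (K : fieldType) (A : algType K) (G : set A) (proper : ~ ideal_gen G 1).
Variables (W : lmodType K) (mulW : W -> W -> W) (f : A -> W).
Hypotheses (mulWl : forall w, linear (mulW w)) (mulWr : forall w, linear (mulW^~ w)).
Hypotheses (fl : linear f) (fM : forall x y, f (x * y) = mulW (f x) (f y)).
Hypothesis fG : forall x, G x -> f x = 0.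

Let fq (q : alg_quot proper) : W := f (of_alg_quot q).

(** The target is a module with a bilinear product [mulW] rather than an algebra, so that the same
    descent serves [tensor_mul], the scalars and the free algebra. *)
Lemma quot_liftE x : fq (to_alg_quot proper x) = f x.
Proof.
apply/eqP; rewrite -subr_eq0 -(linB _ _ fl); apply/eqP.
have : ideal_gen G (of_alg_quot (to_alg_quot proper x) - x).
  by apply/(to_alg_quotP proper); rewrite of_alg_quotK.
apply: (@smallest_sub _ _ _ [set x | f x = 0]) => //.
split; first exact: subspace_ker.
by move=> a y /= fy; rewrite !fM fy (lin0 (mulWl _)) (lin0 (mulWr _)).
Qed.

Lemma quot_lift_linear : linear fq.
Proof.
by move=> c x y; rewrite -[x]of_alg_quotK -[y]of_alg_quotK -linearP !quot_liftE fl.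
Qed.

Lemma quot_liftM x y : fq (x * y) = mulW (fq x) (fq y).
Proof.
by rewrite -[x]of_alg_quotK -[y]of_alg_quotK -rmorphM !quot_liftE fM.
Qed.

Lemma quot_lift1 : fq 1 = f 1.
Proof. by rewrite -(rmorph1 (to_alg_quot proper)) quot_liftE. Qed.

End QuotientLift.

Section EnvelopingLift.
Variables (K : fieldType) (L : lmodType K) (br : L -> L -> L).
Variables (W : lmodType K) (mulW : W -> W -> W) (f : freealg K L -> W).
Hypotheses (mulWl : forall w, linear (mulW w)) (mulWr : forall w, linear (mulW^~ w)).
Hypotheses (fl : linear f) (fM : forall x y, f (x * y) = mulW (f x) (f y)).
Hypothesis gl : linear (fun x : L => f (gen K x)).
Hypothesis fbr : forall x y, f (gen K (br x y)) =
  mulW (f (gen K x)) (f (gen K y)) - mulW (f (gen K y)) (f (gen K x)).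

Let f1 (t : tensor_alg L) : W := f (of_alg_quot t).
Let f2 (u : env br) : W := f (env_rep u).

Let frel z : tensor_alg_relations z -> f z = 0.
Proof. by case=> [c [x [y ->]]]; rewrite (linB _ _ fl) fl gl subrr. Qed.

Let f1E x : f1 (to_alg_quot (@tensor_alg_proper K L) x) = f x.
Proof. exact: (quot_liftE (@tensor_alg_proper K L) mulWl mulWr fl fM frel). Qed.

Let f1l : linear f1.
Proof. have X := @quot_lift_linear _ _ _ (@tensor_alg_proper K L) W mulW f mulWl mulWr fl fM frel.
move=> c x y; have Y := X c x y; exact: Y. Qed.

Let f1M x y : f1 (x * y) = mulW (f1 x) (f1 y).
Proof. have Y := @quot_liftM _ _ _ (@tensor_alg_proper K L) W mulW f mulWl mulWr fl fM frel x y; exact: Y. Qed.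

Let f1rel z : env_relations br z -> f1 z = 0.
Proof.
by case=> [x [y ->]]; rewrite 2!(linB _ _ f1l) !f1M !f1E fbr subrr.
Qed.

Lemma env_liftE x : f2 (to_alg_quot (@env_proper K L br) (to_alg_quot (@tensor_alg_proper K L) x)) = f x.
Proof. by rewrite -f1E; exact: (quot_liftE (@env_proper K L br) mulWl mulWr f1l f1M f1rel). Qed.

Lemma env_lift_linear : linear f2.
Proof. have X := @quot_lift_linear _ _ _ (@env_proper K L br) W mulW f1 mulWl mulWr f1l f1M f1rel.
move=> c x y; have Y := X c x y; exact: Y. Qed.

Lemma env_liftM x y : f2 (x * y) = mulW (f2 x) (f2 y).
Proof. have Y := @quot_liftM _ _ _ (@env_proper K L br) W mulW f1 mulWl mulWr f1l f1M f1rel x y; exact: Y. Qed.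

Lemma env_lift1 : f2 1 = f 1.
Proof.
rewrite -[RHS]env_liftE; congr f2; symmetry.
by rewrite 2!rmorph1.
Qed.

Lemma env_lift_inj x : f2 (env_inj br x) = f (gen K x).
Proof. exact: env_liftE. Qed.

End EnvelopingLift.

Section EnvelopingTheory.
Variables (K : fieldType) (L : lmodType K) (br : L -> L -> L).
Local Notation U := (env br).
Local Notation ι := (@env_inj K L br).

Lemma env_surj (u : U) : exists x : freealg K L, u = freealg_lift ι x.
Proof.
exists (env_rep u); rewrite -[u in LHS]of_alg_quotK -[of_alg_quot u]of_alg_quotK.
apply: (freealg_lift_unique (h := ι) (f := fun x => to_alg_quot (@env_proper K L br)
  (to_alg_quot (@tensor_alg_proper K L) x))) => [||x y|i] //.
- exact: lin_comp (linearP _) (linearP _).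
- by rewrite 2!rmorph1.
- by rewrite 2!rmorphM.
Qed.

Lemma env_ext (A : algType K) (F G : U -> A) : linear F -> linear G -> F 1 = 1 -> G 1 = 1 ->
  {morph F : x y / x * y} -> {morph G : x y / x * y} ->
  (forall x, F (ι x) = G (ι x)) -> F =1 G.
Proof.
move=> Fl Gl F1 G1 FM GM FG u; have [x ->] := env_surj u.
pose h x := F (ι x); have ll := @freealg_lift_linear K L U ι.
have E1 := @freealg_lift_unique K L A h (fun x => F (freealg_lift ι x)).
have E2 := @freealg_lift_unique K L A h (fun x => G (freealg_lift ι x)).
transitivity (freealg_lift h x).
  apply: E1 => [||y z|i]; [exact: lin_comp Fl ll|by rewrite freealg_lift1| |].
    by rewrite freealg_liftM FM.
  by rewrite freealg_lift_gen.
symmetry; apply: E2 => [||y z|i]; [exact: lin_comp Gl ll|by rewrite freealg_lift1| |].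
  by rewrite freealg_liftM GM.
by rewrite freealg_lift_gen /h FG.
Qed.

Let augl : linear (@freealg_aug K L : freealg K L -> K^o) := @freealg_aug_scalar K L.

Let aug_gl : linear (fun x : L => freealg_aug (gen K x) : K^o).
Proof. by move=> c x y; rewrite !freealg_aug_gen scaler0 addr0. Qed.

Let aug_br (x y : L) : freealg_aug (gen K (br x y)) =
  freealg_aug (gen K x) * freealg_aug (gen K y) - freealg_aug (gen K y) * freealg_aug (gen K x).
Proof. by rewrite !freealg_aug_gen mul0r subrr. Qed.

Let mull (w : K^o) : linear ( *%R w) := @lin_mull K K^o w.
Let mulr (w : K^o) : linear ( *%R^~ w) := @lin_mulr K K^o w.
Let augM := @freealg_augM K L.

Lemma env_counit_scalar : scalar (@env_counit K L br).
Proof. by move=> c x y; exact: (@env_lift_linear K L br K^o *%R _ mull mulr augl augM aug_gl aug_br c x y). Qed.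

Lemma env_counitM (x y : U) : env_counit (x * y) = env_counit x * env_counit y.
Proof. exact: (@env_liftM K L br K^o *%R _ mull mulr augl augM aug_gl aug_br). Qed.

Lemma env_counit1 : env_counit (1 : U) = 1.
Proof.
rewrite -(@freealg_aug1 K L).
exact: (@env_lift1 K L br K^o *%R _ mull mulr augl augM aug_gl aug_br).
Qed.

Lemma env_counit_inj x : env_counit (ι x) = 0.
Proof.
rewrite -(@freealg_aug_gen K L x).
exact: (@env_lift_inj K L br K^o *%R _ mull mulr augl augM aug_gl aug_br).
Qed.

(** [env_comul] reads a chosen representative, and that of 1 need not be the empty word; the value
    is obtained from the descent of [F] to the quotient. *)
Lemma env_comul1 : env_comul (1 : U) = 1 ⊗ 1.
Proof.
pose mulT := @tensor_mul K U U.
pose d x : tensor U U := ι x ⊗ 1 + 1 ⊗ ι x.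
pose F (x : freealg K L) : tensor U U :=
  freealg_linext (fun w => \big[mulT/1 ⊗ 1]_(x <- (w : seq L)) d x) x.
have Fl : linear F by exact: freealg_linext_linear.
have Fw w : F (word K w) = \big[mulT/1 ⊗ 1]_(x <- (w : seq L)) d x by exact: freealg_linextE.
have F1 : F 1 = 1 ⊗ 1 by rewrite -word1 Fw fm1 big_nil.
have Fg x : F (gen K x) = d x by rewrite /gen Fw fmU big_cons big_nil; exact: tensor_mult1.
have FM x y : F (x * y) = mulT (F x) (F y).
  move: x; apply: (freealg_ind (subspace_eq (lin_comp Fl (lin_mulr y))
    (lin_comp (lin_tmulr (F y)) Fl))) => v /=.
  move: y; apply: (freealg_ind (subspace_eq (lin_comp Fl (lin_mull _))
    (lin_comp (lin_tmull _) Fl))) => w /=.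
  rewrite wordM !Fw fmM; elim: (v : seq L) => [|i s IH].
    by rewrite big_nil /mulT tensor_mul1t.
  by rewrite /= !big_cons IH; exact: tensor_mulA.
have dl : linear (fun x => F (gen K x)).
  move=> c x y; rewrite !Fg /d env_inj_linear tensDl tensDr tensZl tensZr scalerDr.
  exact: addrACA.
have ker z : tensor_alg_relations z -> F z = 0.
  by case=> [c [x [y ->]]]; rewrite (linB _ _ Fl) Fl dl subrr.
have E := quot_lift1 (@tensor_alg_proper K L) (@lin_tmull K U U) (@lin_tmulr K U U) Fl FM ker.
rewrite -F1; have := env_comulE br (1 : tensor_alg L); rewrite rmorph1 => ->.
exact: E.
Qed.

End EnvelopingTheory.

Section FreeLieEnveloping.
Variables (K : fieldType) (a : nat -> nat).
Local Notation I := (seq_gens a).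
Local Notation T := (freealg K I).
Local Notation L := (free_lie K a).
Local Notation U := (env (@free_lie_bracket K a)).
Local Notation ι := (@env_inj K L (@free_lie_bracket K a)).

Inductive bracket_monomial : T -> Prop :=
| bracket_gen i : bracket_monomial (gen K i)
| bracket_comm x y : bracket_monomial x -> bracket_monomial y ->
    bracket_monomial (x * y - y * x).

Lemma free_lie_gen i : free_lie_set (gen K i : T).
Proof. by apply: sub_gen_smallest; exists i. Qed.

Lemma bracket_monomial_gr x : bracket_monomial x -> exists n, freealg_gr n x.
Proof.
elim=> [i|{}x y _ [m gx] _ [n gy]]; first by exists (tag i).+1; exact: freealg_gr_gen.
exists (m + n)%N; apply: subspaceB (@freealg_gr_subspace _ _ _) _ _; last rewrite addnC.
  exact: freealg_grM.
exact: freealg_grM.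
Qed.

(** [free_lie_set] is minimal among graded subspaces closed under commutators, so the span of the
    monomials must be shown to be graded; this is where their homogeneity enters. *)
Lemma free_lie_span x : free_lie_set x -> lspan bracket_monomial x.
Proof.
apply: smallest_sub => [|_ [i _ <-]]; last by apply: lspan_gen; left.
split; first split; first exact: subspace_lspan.
  apply: lspan_min; first exact: subspace_lspan.
  move=> z Bz; have [n gz] := bracket_monomial_gr Bz.
  by apply: lspan_gen; exists n => //; split=> //; exact: lspan_gen.
move=> {}x y Bx By.
have ml (z : T) : linear (fun t => t * z - z * t).
  by apply: lin_sub; [exact: lin_mulr|exact: lin_mull].
have mr (z : T) : linear (fun t => z * t - t * z).
  by apply: lin_sub; [exact: lin_mull|exact: lin_mulr].
move: x Bx; apply: (lspan_map (ml y) (subspace_lspan _)) => {}x Bx.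
move: y By; apply: (lspan_map (mr x) (subspace_lspan _)) => {}y By.
by apply: lspan_gen; right.
Qed.

Lemma free_lie_mem (x : T) : free_lie_set x -> x \in @free_lie_pred K a.
Proof. by move=> Lx; rewrite unfold_in inE. Qed.

Definition lie_gen (i : I) : L := FreeLie (free_lie_mem (free_lie_gen i)).

Definition env_pres : T -> U := freealg_lift (fun i => ι (lie_gen i)).

Let vall : linear (@free_lie_val K a). Proof. by []. Qed.

(** The elements of T sent by [env_pres] to their own image under [ι] form a subspace closed under
    commutators and containing the letters. This makes [env_pres] surjective, since U(L(a)) is
    generated by the image of [ι]. *)
Lemma env_pres_lie (l : L) : env_pres (l : T) = ι l.
Proof.
have pl : linear env_pres := @freealg_lift_linear K I U (fun i => ι (lie_gen i)).
have pM : {morph env_pres : x y / x * y} := freealg_liftM _.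
pose S : set T := [set x | exists l' : L, x = l' :> T /\ env_pres x = ι l'].
suff [l' [/val_inj <- //]] : S (l : T).
have SP : subspace S.
  apply/subspaceP; split.
    exists 0; split; first by rewrite (lin0 vall).
    by rewrite (lin0 pl) (lin0 (env_inj_linear _)).
  move=> c x y [l1 [-> E1]] [l2 [-> E2]]; exists (c *: l1 + l2); split.
    by rewrite vall.
  by rewrite pl E1 E2 env_inj_linear.
have: lspan bracket_monomial (l : T).
  by apply: free_lie_span; case: l => x /=; rewrite unfold_in inE.
apply: (lspan_min SP) => x; elim=> [i|{}x y _ [l1 [-> E1]] _ [l2 [-> E2]]].
  by exists (lie_gen i); split=> //; rewrite /env_pres freealg_lift_gen.
exists (free_lie_bracket l1 l2); split=> //.
by rewrite (linB _ _ pl) 2!pM E1 E2; symmetry; exact: env_inj_bracket.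
Qed.

Definition env_unpres (u : U) : T := freealg_lift (fun l : L => (l : T)) (env_rep u).

Let F := freealg_lift (fun l : L => (l : T)).
Let Fl : linear F. Proof. exact: freealg_lift_linear. Qed.
Let FM : {morph F : x y / x * y}. Proof. exact: freealg_liftM. Qed.
Let Fgl : linear (fun l : L => F (gen K l)).
Proof. by move=> c x y; rewrite /F 3!freealg_lift_gen vall. Qed.
Let Fbr x y : F (gen K (free_lie_bracket x y)) =
  F (gen K x) * F (gen K y) - F (gen K y) * F (gen K x).
Proof. by rewrite /F !freealg_lift_gen. Qed.

Lemma env_unpres_linear : linear env_unpres.
Proof. exact: (env_lift_linear (@lin_mull K T) (@lin_mulr K T) Fl FM Fgl Fbr). Qed.

Lemma env_unpresM : {morph env_unpres : x y / x * y}.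
Proof. exact: (env_liftM (@lin_mull K T) (@lin_mulr K T) Fl FM Fgl Fbr). Qed.

Lemma env_unpres1 : env_unpres 1 = 1.
Proof.
rewrite -[RHS](freealg_lift1 (fun l : L => (l : T))).
exact: (env_lift1 (@lin_mull K T) (@lin_mulr K T) Fl FM Fgl Fbr).
Qed.

Lemma env_unpres_inj l : env_unpres (ι l) = l.
Proof.
rewrite -[RHS](freealg_lift_gen (fun l : L => (l : T))).
exact: (env_lift_inj (@lin_mull K T) (@lin_mulr K T) Fl FM Fgl Fbr).
Qed.

Let pl : linear env_pres. Proof. exact: freealg_lift_linear. Qed.

Lemma env_presK : cancel env_pres env_unpres.
Proof.
move=> x; rewrite [RHS](@freealg_lift_unique K I T (@gen K I) id)//.
apply: (freealg_lift_unique (f := fun x => env_unpres (env_pres x))) => [||y z|i].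
- exact: lin_comp env_unpres_linear pl.
- by rewrite /env_pres freealg_lift1 env_unpres1.
- by rewrite /env_pres freealg_liftM env_unpresM.
- by rewrite /env_pres freealg_lift_gen env_unpres_inj.
Qed.

Lemma env_unpresK : cancel env_unpres env_pres.
Proof.
apply: (env_ext (F := fun u => env_pres (env_unpres u)) (G := id)) => // [|||l].
- exact: lin_comp pl env_unpres_linear.
- by rewrite env_unpres1 /env_pres freealg_lift1.
- by move=> x y; rewrite env_unpresM /env_pres freealg_liftM.
- by rewrite env_unpres_inj env_pres_lie.
Qed.

Lemma env_pres_gr n x : freealg_gr n x <-> env_gr (@free_lie_gr K a) n (env_pres x).
Proof.
split.
  move: x; apply: (lspan_map pl (subspace_lspan _)) => _ [w /= wn <-].
  rewrite /env_pres freealg_lift_word; apply: lspan_gen.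
  exists [seq ((tag i).+1, lie_gen i) | i <- (w : seq I)]; split.
  - by move=> p /mapP[i _ ->]; exact: freealg_gr_gen.
  - by rewrite big_map.
  - by rewrite big_map.
rewrite -{2}[x]env_presK; move: (env_pres x) => u.
apply: (lspan_map env_unpres_linear (@freealg_gr_subspace _ _ _)) => _ [s [sg <- ->]].
elim: s sg => [|p s IH] sg; first by rewrite !big_nil env_unpres1; exact: freealg_gr1.
rewrite !big_cons env_unpresM env_unpres_inj; apply: freealg_grM.
  by apply: sg; rewrite inE eqxx.
by apply: IH => q qs; apply: sg; rewrite inE qs orbT.
Qed.

Lemma env_free_lie_presentation :
  prim_presentation (H := env_free_lie K a) env_pres.
Proof.
split.
- exact: pl.
- exact: freealg_lift1.
- exact: freealg_liftM.
- exact: Bijective env_presK env_unpresK.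
- exact: env_pres_gr.
- exact: env_comul_linear.
- exact: env_comul1.
- exact: env_comulM.
- exact: env_counit_scalar.
- exact: env_counit1.
- exact: env_counitM.
- by move=> i; rewrite /env_pres freealg_lift_gen; exact: env_comul_inj.
- by move=> i; rewrite /env_pres freealg_lift_gen; exact: env_counit_inj.
Qed.

End FreeLieEnveloping.

(** * Primitive elements of cocommutative Hopf algebras *)

Section TensorComposition.
Variable K : fieldType.
Implicit Types U V W : lmodType K.

Lemma tmap_comp U V U' V' U2 V2 (f' : U' -> U2) (g' : V' -> V2) (f : U -> U') (g : V -> V') t :
  linear f' -> linear g' -> linear f -> linear g ->
  tmap f' g' (tmap f g t) = tmap (fun x => f' (f x)) (fun x => g' (g x)) t.
Proof.
move=> fl' gl' fl gl; have L' := tmap_linear fl' gl'; have L := tmap_linear fl gl.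
have fl2 := lin_comp fl' fl; have gl2 := lin_comp gl' gl.
move: t; apply: tensor_ext; [exact: lin_comp L' L|exact: tmap_linear|].
by move=> u v; rewrite (tmapE u v fl gl) (tmapE _ _ fl' gl') (tmapE _ _ fl2 gl2).
Qed.

Lemma tassoc_tmap U V W W' (f : W -> W') (t : tensor (tensor U V) W) : linear f ->
  tassoc (tmap id f t) = tmap id (tmap id f) (tassoc t).
Proof.
move=> fl; have idl (Z : lmodType K) : linear (@id Z) by [].
have L1 := tmap_linear (idl (tensor U V)) fl.
have L2 := tmap_linear (idl V) fl.
have L3 := tmap_linear (idl U) L2.
have La := @tassoc_linear K U V W; have La' := @tassoc_linear K U V W'.
move: t; apply: tensor_ext; [exact: lin_comp La' L1|exact: lin_comp L3 La|].
move=> s w; rewrite (tmapE s w (idl _) fl); move: s; apply: tensor_ext.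
- exact: lin_comp La' (lin_tensl _).
- exact: lin_comp L3 (lin_comp La (lin_tensl _)).
move=> u v; rewrite (tassocE u v (f w)) (tassocE u v w) (tmapE _ _ (idl U) L2).
by rewrite (tmapE _ _ (idl V) fl).
Qed.

End TensorComposition.

(** * The convolution square of the identity in a cocommutative bialgebra *)

Section CocommutativeBialgebra.
Variables (K : fieldType) (U : lmodType K).
Variables (mu : U -> U -> U) (D : U -> tensor U U).
Variable (N : tensor U U -> tensor U U -> tensor U U).
Hypotheses (mub : bilinear_map mu) (Dl : linear D) (Nb : bilinear_map N).
Hypothesis NE : forall p q r s, N (p ⊗ q) (r ⊗ s) = mu p r ⊗ mu q s.
Hypothesis Dmu : forall x y, D (mu x y) = N (D x) (D y).
Hypothesis coassoc : forall x, tassoc (tmap D id (D x)) = tmap id D (D x).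
Hypothesis cocomm : forall x, tswap (D x) = D x.

Let idl (Z : lmodType K) : linear (@id Z). Proof. by []. Qed.

Let m := tlift mu.
Let ml : linear m. Proof. exact: tlift_linear. Qed.
Let mE p q : m (p ⊗ q) = mu p q. Proof. exact: tliftE. Qed.

Let sw (q : U) (v : tensor U U) : tensor U (tensor U U) :=
  tlift (fun r s => r ⊗ (q ⊗ s)) v.

Let sw_inner q :
  @bilinear_map K U U (tensor U (tensor U U)) (fun r s : U => r ⊗ (q ⊗ s)).
Proof.
split=> [s c r r'|r c s s']; first by rewrite tensDl tensZl.
by rewrite tensDr tensZr tensDr tensZr.
Qed.

Let sw_bilin : bilinear_map sw.
Proof.
split=> [v c q q'|q]; last exact: tlift_linear (sw_inner q).
by apply: tlift_linear_map => r s; rewrite tensDl tensZl tensDr tensZr.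
Qed.

(* [sigma] exchanges the first two factors of a triple tensor product. *)
Let sigma := tlift sw.
Let sl : linear sigma. Proof. exact: tlift_linear sw_bilin. Qed.

Let sigmaE p q r : sigma (p ⊗ (q ⊗ r)) = q ⊗ (p ⊗ r).
Proof. by rewrite /sigma (tliftE sw_bilin) /sw (tliftE (sw_inner p)). Qed.

Let D3 (x : U) := tmap id D (D x).
Let D3l : linear D3.
Proof. exact: lin_comp (tmap_linear (@idl U) Dl) Dl. Qed.

Let sigma_tassoc (t : tensor (tensor U U) U) :
  sigma (tassoc t) = tassoc (tmap (@tswap K U U) id t).
Proof.
have Ls := @tswap_linear K U U; have La := @tassoc_linear K U U U.
have Lm := tmap_linear Ls (@idl U).
move: t; apply: tensor_ext; [exact: lin_comp sl La|exact: lin_comp La Lm|].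
move=> s w; rewrite (tmapE s w Ls (@idl U)); move: s; apply: tensor_ext.
- exact: lin_comp sl (lin_comp La (lin_tensl _)).
- exact: lin_comp La (lin_comp (lin_tensl _) Ls).
by move=> u v; rewrite (tswapE u v) (tassocE u v w) (tassocE v u w) sigmaE.
Qed.

(** By coassociativity the first two factors of [D3 x] come from one application of [D], so
    exchanging them is cocommutativity. *)
Let sigma_D3 x : sigma (D3 x) = D3 x.
Proof.
rewrite /D3 -coassoc sigma_tassoc (tmap_comp _ (@tswap_linear K U U) (@idl U) Dl (@idl U)).
by have -> : (fun y => tswap (D y)) = D by apply/funext => y; exact: cocomm.
Qed.

(** [phi] multiplies the first two and the last two factors of a fourfold tensor. Applied directly
    it yields [tmap m m]; applied after exchanging the middle factors it yields the product [N] of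
    the tensor square. *)
Let phi_in (p : U) (u : tensor U (tensor U U)) : tensor U U :=
  tlift (fun q v => mu p q ⊗ m v) u.

Let phi_inner p :
  @bilinear_map K U (tensor U U) (tensor U U) (fun (q : U) (v : tensor U U) => mu p q ⊗ m v).
Proof.
split=> [v c q q'|q c v v']; first by rewrite mub.2 tensDl tensZl.
by rewrite ml tensDr tensZr.
Qed.

Let phi_bilin : bilinear_map phi_in.
Proof.
split=> [v c p p'|p]; last exact: tlift_linear (phi_inner p).
by apply: tlift_linear_map => r s; rewrite mub.1 tensDl tensZl.
Qed.

Let phi := tlift phi_in.
Let phil : linear phi. Proof. exact: tlift_linear phi_bilin. Qed.

Let phiE p q v : phi (p ⊗ (q ⊗ v)) = mu p q ⊗ m v.
Proof. by rewrite /phi (tliftE phi_bilin) /phi_in (tliftE (phi_inner p)). Qed.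

Let phi_tassoc t : phi (tassoc t) = tmap m m t.
Proof.
have La := @tassoc_linear K U U (tensor U U); have Lm := tmap_linear ml ml.
move: t; apply: tensor_ext; [exact: lin_comp phil La|exact: Lm|].
move=> s w; rewrite (tmapE s w ml ml); move: s; apply: tensor_ext.
- exact: lin_comp phil (lin_comp La (lin_tensl _)).
- exact: lin_comp (lin_tensl _) ml.
by move=> u v; rewrite (tassocE u v w) phiE mE.
Qed.

Let phi_sigma t : phi (tmap id sigma (tassoc t)) = tlift N t.
Proof.
have La := @tassoc_linear K U U (tensor U U).
have Ls := tmap_linear (@idl U) sl; have LN := tlift_linear Nb.
have L := lin_comp phil (lin_comp Ls La).
move: t; apply: tensor_ext; [exact: L|exact: LN|].
move=> s w; rewrite (tliftE Nb); move: s; apply: tensor_ext.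
- exact: lin_comp L (lin_tensl _).
- exact: Nb.1.
move=> p q; move: w; apply: tensor_ext.
- exact: lin_comp L (lin_tensr _).
- exact: Nb.2.
move=> r s; rewrite (tassocE p q (r ⊗ s)) (tmapE _ _ (@idl U) sl) sigmaE phiE mE.
by rewrite NE.
Qed.

Let D4 x : tassoc (tmap D D (D x)) = tmap id D3 (D x).
Proof.
have -> : tmap D D (D x) = tmap id D (tmap D id (D x)).
  by rewrite (tmap_comp _ (@idl _) Dl Dl (@idl _)).
rewrite (tassoc_tmap _ Dl) coassoc.
by rewrite (tmap_comp _ (@idl U) (tmap_linear (@idl U) Dl) (@idl U) Dl).
Qed.

(* By cocommutativity, the convolution square of the identity is a morphism of
   coalgebras. *)
Lemma comul_conv_square x :
  D (tlift mu (D x)) = tmap (fun y => tlift mu (D y)) (fun y => tlift mu (D y)) (D x).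
Proof.
have LN := tlift_linear Nb; have LD := tmap_linear Dl Dl.
transitivity (tlift N (tmap D D (D x))).
  move: (D x) => t; move: t; apply: tensor_ext; [exact: lin_comp Dl ml|exact: lin_comp LN LD|].
  by move=> u v; rewrite (tliftE mub) (tmapE u v Dl Dl) (tliftE Nb) Dmu.
(* The two middle factors of the fourfold coproduct are the first two of [D3], so [sigma] fixes it
   and the two descriptions of [phi] coincide. *)
rewrite -phi_sigma D4 (tmap_comp _ (@idl U) sl (@idl U) D3l).
have -> : (fun y => sigma (D3 y)) = D3 by apply/funext => y; exact: sigma_D3.
by rewrite -D4 phi_tassoc (tmap_comp _ ml ml Dl Dl).
Qed.

End CocommutativeBialgebra.

(** * Spans of eigenvectors and products of shifted operators *)

Section EigenSpan.
Variables (K : fieldType) (V : lmodType K) (f : V -> V).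
Hypothesis fl : linear f.
Implicit Types (C : seq K).

Definition eigen_span (S : set V) C : set V :=
  lspan [set x | S x /\ exists2 c, c \in C & f x = c *: x].

Definition shift_prod C (x : V) : V := foldr (fun c y => f y - c *: y) x C.

Lemma shift_prod_linear C : linear (shift_prod C).
Proof.
elim: C => [|c C IH]; first exact: lin_id.
by apply: lin_sub; [exact: lin_comp fl IH|exact: lin_scale IH].
Qed.

Lemma shift_prod_eigen C c x : f x = c *: x ->
  shift_prod C x = (\prod_(d <- C) (c - d)) *: x.
Proof.
move=> fx; elim: C => [|d C IH] /=; first by rewrite big_nil scale1r.
rewrite IH big_cons (linZ _ _ fl) fx !scalerA -scalerBl; congr (_ *: _).
by rewrite mulrBl [c * _]mulrC.
Qed.


Lemma shift_prod_eigen_span S C x : eigen_span S C x -> shift_prod C x = 0.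
Proof.
move: x; apply: (lspan_eq (shift_prod_linear C) (@lin_zero _ _ _)) => x [_ [c cC fx]].
rewrite (shift_prod_eigen _ fx); suff -> : \prod_(d <- C) (c - d) = 0 by rewrite scale0r.
by apply/eqP; rewrite prodf_seq_eq0; apply/hasP; exists c; rewrite ?subrr ?eqxx.
Qed.

Lemma eigen_spanS S C C' x : {subset C <= C'} -> eigen_span S C x -> eigen_span S C' x.
Proof.
by move=> CC'; apply: lspanS => y [Sy [c cC fy]]; split=> //; exists c => //; exact: CC'.
Qed.

(** On the span of the eigenvectors for [C] the operator f - c is invertible, as c is not in C.
    Hence (f - c) x = (f - c) y for some y in that span, and x - y is an eigenvector for c. *)
Lemma eigen_span_shift S C c x : subspace S -> S x -> c \notin C ->
  eigen_span S C (f x - c *: x) -> eigen_span S (c :: C) x.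
Proof.
move=> SP Sx cC Ex; pose E := eigen_span S C.
have ES y : E y -> S y by apply: lspan_min => // z [].
have [y Ey yE] : exists2 y, E y & f y - c *: y = f x - c *: x.
  move: Ex; move: (f x - _) => u; move: u; apply: lspan_min.
    apply/subspaceP; split=> [|d _ _ [y Ey <-] [z Ez <-]].
      by exists 0; [exact: lspan0|rewrite (lin0 fl) scaler0 subrr].
    exists (d *: y + z); first exact: subspaceZD (subspace_lspan _) Ey Ez.
    have L : linear (fun v => f v - c *: v) := lin_sub fl (lin_scale _ (@lin_id _ _)).
    exact: L.
  move=> u [Su [d dC fu]]; exists ((d - c)^-1 *: u).
    by apply: lspan_gen; split; [exact: subspaceZ|exists d => //; rewrite (linZ _ _ fl) fu !scalerA mulrC].
  have dc : d - c != 0.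
    by rewrite subr_eq0; apply: contraNneq cC => <-.
  by rewrite (linZ _ _ fl) fu !scalerA [_ * d]mulrC -scalerBl -mulrBl mulfV // scale1r.
rewrite -[x](subrK y); apply: subspaceD (subspace_lspan _) _ _.
  apply: lspan_gen; split; first by apply: subspaceB => //; exact: ES.
  exists c; first by rewrite inE eqxx.
  move/eqP: yE; rewrite subr_eq => /eqP fyE.
  rewrite (linB _ _ fl) scalerBr fyE opprD opprB addrA; congr (_ - _).
  by rewrite addrCA subrr addr0.
by apply: eigen_spanS Ey => d dC; rewrite inE dC orbT.
Qed.

(** The outermost factor is removed first by [eigen_span_shift], which moves its eigenvalue from [C]
    to [B]; distinctness keeps each removal legitimate. *)
Lemma eigen_span_shift_prod S B C x : subspace S -> (forall y, S y -> S (f y)) ->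
  S x -> uniq (C ++ B) -> eigen_span S B (shift_prod C x) -> eigen_span S (C ++ B) x.
Proof.
move=> SP Sf Sx; elim: C B => [|c C IH] B //= /andP[cCB uCB] Ex.
have SC : S (shift_prod C x).
  elim: (C) => //= d D SD; apply: subspaceB => //; first exact: Sf.
  exact: subspaceZ.
have {Ex}E : eigen_span S (c :: B) (shift_prod C x).
  apply: eigen_span_shift Ex => //.
  by apply: contra cCB => cB; rewrite mem_cat cB orbT.
apply: eigen_spanS (IH (c :: B) _ E) => [d|].
  by rewrite !(inE, mem_cat) => /or3P[->|->|->]; rewrite ?orbT.
by rewrite -(perm_uniq (permEl (perm_catCA [:: c] C B))) /= cCB.
Qed.

End EigenSpan.

(** * Primitive representatives of indecomposables *)

Section PrimitiveLifting.
Variables (K : fieldType) (H : hopf_data K).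
Hypothesis gH : graded_hopf H.
Hypothesis connH : hgr 0 = [set c%:A | c in [set: K]] :> set H.
Hypothesis cocH : cocommutative H.
Hypothesis K0 : [pchar K] =i pred0.
Local Notation Δ := (@hcomul K H).
Local Notation ε := (@hcounit K H).
Local Notation gr := (@hgr K H).

(** For connected [H] this is the degree n part of the square of the augmentation ideal: the indices
    i.+1 and j.+1 keep both factors in positive degree. *)
Definition decomposables n : set H :=
  lspan [set x | exists i j (y z : H),
    [/\ (i.+1 + j.+1)%N = n, gr i.+1 y, gr j.+1 z & x = y * z]].

Definition reduced_tensors n : set (tensor H H) :=
  lspan [set t | exists i j (y z : H),
    [/\ (i.+1 + j.+1)%N = n, gr i.+1 y, gr j.+1 z & t = y ⊗ z]].

Let grS n : subspace (gr n) := gr_subspace (gh_grading gH) n.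
Let Dl : linear Δ := gh_comul_linear gH.

Definition reduced_comul (x : H) : tensor H H := Δ x - (x ⊗ 1 + 1 ⊗ x).

Lemma reduced_comul_linear : linear reduced_comul.
Proof.
apply: (lin_sub Dl).
exact: (lin_add (@lin_tensl K H H 1) (@lin_tensr K H H 1)).
Qed.

(** Connectedness makes the terms of bidegree (n+1, 0) and (0, n+1) of the form a (x) 1 and 1 (x) b;
    the two counit laws then give a = b = x. *)
Lemma reduced_comulP n x : gr n.+1 x -> reduced_tensors n.+1 (reduced_comul x).
Proof.
move=> gx.
have RS : subspace (reduced_tensors n.+1) by exact: subspace_lspan.
have R0 := subspace0 RS; have g0 := subspace0 (grS n.+1).
have tl0 : (0 : H) ⊗ (1 : H) = 0 := lin0 (@lin_tensl K H H 1).
have tr0 : (1 : H) ⊗ (0 : H) = 0 := lin0 (@lin_tensr K H H 1).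
pose S : set (tensor H H) := [set t | exists (a b : H) (w : tensor H H),
    [/\ gr n.+1 a, gr n.+1 b, reduced_tensors n.+1 w & t = w + (a ⊗ 1 + 1 ⊗ b)]].
have [a [b [w [ga gb Rw DE]]]] : S (Δ x).
  have := gh_comul_gr gH gx; apply: lspan_min.
    apply/subspaceP; split.
      by exists 0, 0, 0; split=> //; rewrite tl0 tr0 !addr0.
    move=> c _ _ [a [b [w [ga gb Rw ->]]]] [a' [b' [w' [ga' gb' Rw' ->]]]].
    exists (c *: a + a'), (c *: b + b'), (c *: w + w'); split; try exact: (subspaceZD _ (grS _)); first exact: (subspaceZD _ RS).
    rewrite (@lin_tensl K H H 1) (@lin_tensr K H H 1) 2!scalerDr.
    by rewrite [LHS]addrACA; congr (_ + _); exact: addrACA.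
  move=> _ [[|i] [[|j] [y [z [//= ij gy gz ->]]]]].
  - have : gr 0 y by [].
    rewrite connH => -[c _ <-]; exists 0, (c *: z), 0; split=> //.
      by rewrite -ij add0n; exact: (subspaceZ _ (grS _)).
    by rewrite tensZl tensZr tl0 !add0r.
  - have : gr 0 z by [].
    rewrite connH => -[c _ <-]; exists (c *: y), 0, 0; split=> //.
      by rewrite -ij addn0; exact: (subspaceZ _ (grS _)).
    by rewrite tensZl tensZr tr0 addr0 add0r.
  - exists 0, 0, (y ⊗ z); split=> //; last by rewrite tl0 tr0 !addr0.
    by apply: lspan_gen; exists i, j, y, z.
have bl : @bilinear_map K H H H (fun y z => ε y *: z).
  exact: bilin_scale (gh_counit_linear gH) (@lin_id _ _).
have br : @bilinear_map K H H H (fun y z => ε z *: y).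
  exact: bilin_swap (bilin_scale (gh_counit_linear gH) (@lin_id _ _)).
have bE : b = x.
  rewrite -[RHS](gh_counitl gH) DE; have Lb := tlift_linear bl.
  rewrite 2!(linD _ _ Lb) (tliftE bl a 1) (tliftE bl 1 b).
  rewrite (gh_counit_gr gH ga) (gh_counit1 gH) scale0r scale1r add0r.
  suff -> : tlift (fun y z => ε y *: z) w = 0 by rewrite add0r.
  move: w Rw {DE}; apply: (lspan_eq Lb (@lin_zero _ _ _)) => _ [i [j [y [z [_ gy _ ->]]]]].
  by rewrite (tliftE bl) (gh_counit_gr gH gy) scale0r.
have aE : a = x.
  rewrite -[RHS](gh_counitr gH) DE; have Lb := tlift_linear br.
  rewrite 2!(linD _ _ Lb) (tliftE br a 1) (tliftE br 1 b).
  rewrite (gh_counit_gr gH gb) (gh_counit1 gH) scale0r scale1r addr0.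
  suff -> : tlift (fun y z => ε z *: y) w = 0 by rewrite add0r.
  move: w Rw {DE}; apply: (lspan_eq Lb (@lin_zero _ _ _)) => _ [i [j [y [z [_ _ gz ->]]]]].
  by rewrite (tliftE br) (gh_counit_gr gH gz) scale0r.
by rewrite /reduced_comul DE aE bE addrK.
Qed.

(** The operator Psi of the overview: the second Adams operation, that is, the convolution square of
    the identity. *)
Definition adams (x : H) : H := tlift (fun y z : H => y * z) (Δ x).

Let mulb : @bilinear_map K H H H (fun y z => y * z) := @bilin_mul K H.

Lemma adams_linear : linear adams.
Proof. exact: lin_comp (tlift_linear mulb) Dl. Qed.

Lemma adams1 : adams 1 = 1.
Proof. by rewrite /adams (gh_comul1 gH) (tliftE mulb) mulr1. Qed.

Lemma adams_gr n x : gr n x -> gr n (adams x).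
Proof.
move=> /(gh_comul_gr gH); rewrite /adams; move: (Δ x) => t; move: t.
apply: (lspan_map (tlift_linear mulb) (grS n)) => _ [i [j [y [z [<- gy gz ->]]]]].
by rewrite (tliftE mulb); exact: (gh_mul gH).
Qed.

Lemma adams_prim x : reduced_comul x = 0 -> adams x = 2 *: x.
Proof.
move=> /eqP; rewrite subr_eq0 => /eqP Dx; rewrite /adams Dx.
rewrite (linD _ _ (tlift_linear mulb)) (tliftE mulb x 1) (tliftE mulb 1 x).
by rewrite mulr1 mul1r scaler_nat mulr2n.
Qed.

Lemma adams_decomposable n x : gr n.+1 x -> decomposables n.+1 (adams x - 2 *: x).
Proof.
move=> /reduced_comulP; have Lm := tlift_linear mulb.
have -> : adams x - 2 *: x = tlift (fun y z : H => y * z) (reduced_comul x).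
  rewrite /reduced_comul (linB _ _ Lm) (linD _ _ Lm) (tliftE mulb x 1) (tliftE mulb 1 x).
  by rewrite mulr1 mul1r scaler_nat mulr2n.
move: (reduced_comul x) => t; move: t.
apply: (lspan_map Lm (subspace_lspan _)) => _ [i [j [y [z [ij gy gz ->]]]]].
by rewrite (tliftE mulb); apply: lspan_gen; exists i, j, y, z.
Qed.

Lemma adams_comul x : Δ (adams x) = tmap adams adams (Δ x).
Proof.
apply: (@comul_conv_square K H _ Δ (@tensor_mul K H H) mulb Dl).
- by split=> t; [exact: lin_tmulr|exact: lin_tmull].
- by move=> p q r s; rewrite tensor_mulE.
- exact: gh_comulM gH.
- exact: gh_coassoc gH.
- exact: cocH.
Qed.

Lemma adams_reduced x : reduced_comul (adams x) = tmap adams adams (reduced_comul x).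
Proof.
have al := adams_linear; have La := tmap_linear al al.
rewrite /reduced_comul (linB _ _ La) (linD _ _ La) (tmapE x 1 al al) (tmapE 1 x al al).
by rewrite adams_comul adams1.
Qed.

Local Notation pows k := [seq (2 ^ i)%:R | i <- k].

Let nat_inj : injective (fun n : nat => n%:R : K).
Proof.
have H0 : forall n, (n%:R == 0 :> K) = (n == 0)%N by apply/pcharf0P.
move=> m n /= mn; apply/eqP; wlog mn' : m n mn / (m <= n)%N.
  move=> W; have [/W|/ltnW/W] := leqP m n; first exact.
  by rewrite eq_sym; apply.
by rewrite eqn_leq mn' /= -subn_eq0 -H0 natrB // mn subrr.
Qed.

Let pows_uniq (k : seq nat) : uniq k -> uniq (pows k : seq K).
Proof.
move=> uk; rewrite map_inj_uniq// => i j /nat_inj /eqP.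
by rewrite eqn_exp2l// => /eqP.
Qed.

Let T := [set: tensor H H].

(** Factors of degrees i+1 and j+1 have eigenvalues 2^p and 2^q with 1 <= p <= i+1 and 1 <= q <=
    j+1, so their tensor has eigenvalue 2^(p+q) with 2 <= p+q <= n. *)
Lemma reduced_eigen n :
  (forall m x, (m.+1 < n)%N -> gr m.+1 x -> eigen_span adams (gr m.+1) (pows (iota 1 m.+1)) x) ->
  reduced_tensors n `<=` eigen_span (tmap adams adams) T (pows (iota 2 n.-1)).
Proof.
move=> IH; apply: lspan_min; first exact: subspace_lspan.
move=> _ [i [j [y [z [ij gy gz ->]]]]].
have ijn : (i.+1 < n)%N /\ (j.+1 < n)%N.
  by rewrite -ij; split; rewrite -[X in (X < _)%N]addn0 ?ltn_add2l// addnC ltn_add2r.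
have al := adams_linear.
have Ey := IH _ _ ijn.1 gy; have Ez := IH _ _ ijn.2 gz; clear gy gz.
move: y Ey; apply: (lspan_map (lin_tensl z) (subspace_lspan _)) => y.
move=> [gy [c /mapP[p pI ->] fy]]; move: pI; rewrite mem_iota => /andP[p0 pi].
move: z Ez; apply: (lspan_map (lin_tensr y) (subspace_lspan _)) => z.
move=> [gz [d /mapP[q qI ->] fz]]; move: qI; rewrite mem_iota => /andP[q0 qj].
apply: lspan_gen; split=> //; exists ((2 ^ (p + q))%:R); last first.
  by rewrite (tmapE y z al al) fy fz tensZl tensZr scalerA -natrM -expnD.
apply/mapP; exists (p + q)%N => //; rewrite mem_iota; lia.
Qed.

Lemma shift_prod_reduced C x :
  reduced_comul (shift_prod adams C x) = shift_prod (tmap adams adams) C (reduced_comul x).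
Proof.
have rl := reduced_comul_linear.
elim: C => //= c C IH.
by rewrite (linB _ _ rl) (linZ _ _ rl) adams_reduced IH.
Qed.

Lemma adams_eigen n x : gr n.+1 x ->
  eigen_span adams (gr n.+1) (pows (iota 1 n.+1)) x /\
  reduced_comul (shift_prod adams (pows (iota 2 n)) x) = 0.
Proof.
elim/ltn_ind: n x => n IH x gx; have al := adams_linear.
have prim : reduced_comul (shift_prod adams (pows (iota 2 n)) x) = 0.
  rewrite shift_prod_reduced; apply: (shift_prod_eigen_span (tmap_linear al al) (S := T)).
  apply: (@reduced_eigen n.+1) (reduced_comulP gx) => m y mn gy.
  by have [] := IH m mn y gy.
split=> //.
have gp C : gr n.+1 (shift_prod adams C x).
  elim: C => //= c C gC; apply: subspaceB => //; first exact: adams_gr.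
  exact: subspaceZ.
(* The shifted element is primitive, hence an eigenvector for 2 = 2^1. The shifts, none of them by
   2, are then undone one at a time. *)
apply: (@eigen_spanS _ _ _ _ (pows (iota 2 n) ++ [:: 2%:R])).
  by move=> d; rewrite mem_cat !inE orbC.
apply: eigen_span_shift_prod => //; first by move=> y; exact: adams_gr.
  have := @pows_uniq (iota 1 n.+1) (iota_uniq _ _).
  by rewrite /= cats1 rcons_uniq.
apply: lspan_gen; split=> //; exists 2%:R; first by rewrite inE.
exact: adams_prim.
Qed.

Lemma primitive_lift n x : gr n.+1 x ->
  exists y, [/\ gr n.+1 y, primitives y & decomposables n.+1 (x - y)].
Proof.
move=> gx; pose C : seq K := pows (iota 2 n).
have al := adams_linear; have [_ prim] := adams_eigen gx.
pose k : K := \prod_(c <- C) (2 - c).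
have k0 : k != 0.
  rewrite prodf_seq_neq0; apply/allP => c /mapP[m]; rewrite mem_iota => /andP[m2 _] ->.
  rewrite /= subr_eq0; apply/eqP => /(@nat_inj 2%N) /eqP.
  by rewrite -[X in X == _](expn1 2) eqn_exp2l// => /eqP m1; rewrite -m1 in m2.
have DS : subspace (decomposables n.+1) by exact: subspace_lspan.
(* One factor at a time: with z the current element, Psi z - 2 z is decomposable by
   [adams_decomposable], so only the congruence for z itself is carried along. *)
have [gp dp] : gr n.+1 (shift_prod adams C x) /\
    decomposables n.+1 (shift_prod adams C x - k *: x).
  rewrite /k; elim: (C) => [|c s [gs ds]] /=; first by rewrite big_nil scale1r subrr; split=> //; exact: subspace0 DS.
  split; first by apply: subspaceB => //; [exact: adams_gr|exact: subspaceZ].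
  rewrite big_cons -scalerA; set z := shift_prod _ _ _ in gs ds *; set u := _ *: x in ds *.
  have -> : adams z - c *: z - (2 - c) *: u = (adams z - 2 *: z) + (2 - c) *: (z - u).
    rewrite scalerBr [in RHS]scalerBl addrA; congr (_ - _).
    by rewrite addrA subrK.
  by apply: (subspaceD DS); [exact: adams_decomposable|exact: (subspaceZ _ DS)].
exists (k^-1 *: shift_prod adams C x); split; first exact: subspaceZ.
  rewrite /primitives /=; apply/eqP; rewrite -subr_eq0; apply/eqP.
  rewrite -/(reduced_comul _) (linZ _ _ reduced_comul_linear) prim.
  exact: scaler0.
have -> : x - k^-1 *: shift_prod adams C x = (- k^-1) *: (shift_prod adams C x - k *: x).
  by rewrite scalerBr scalerA mulNr mulVf// !scaleNr scale1r opprK addrC.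
exact: (subspaceZ _ DS).
Qed.

End PrimitiveLifting.

(** * Primitive free generators *)

Lemma free_family_le (K : fieldType) (V : lmodType K) (S : set V) n m (b : 'I_m -> V) :
  subspace S -> has_dim S n -> (forall i, S (b i)) ->
  (forall c, lcomb b c = 0 -> c = 0) -> (m <= n)%N.
Proof.
move=> SP /(has_dimP _ SP)[e [Se eG eF]] Sb bF.
have /choice[f fE] i := eG _ (Sb i).
pose B := \matrix_(i < m) f i.
suff : row_free B by move=> /eqP <-; exact: rank_leq_col.
rewrite -kermx_eq0; apply/eqP/row_matrixP => i; rewrite row0; apply: bF.
have : row i (kermx B) *m B = 0 by rewrite -row_mul mulmx_ker row0.
move/(congr1 (lcomb e)); rewrite lcomb_mul (lin0 (lcomb_linear e)) => <-.
by apply: eq_bigr => j _; rewrite rowK -fE.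
Qed.

(** * Unitriangular substitutions in the free algebra *)

Section LengthFiltration.
Variables (K : fieldType) (I : choiceType).
Local Notation T := (freealg K I).

(** The k-th power of the augmentation ideal of the free algebra. *)
Definition long_words (k : nat) : set T :=
  lspan [set word K w | w in [set w : {fmonom I} | (k <= size (w : seq I))%N]].

Lemma long_words_subspace k : subspace (long_words k).
Proof. exact: subspace_lspan. Qed.

Lemma long_words_wcoef k x (w : {fmonom I}) : long_words k x -> (size (w : seq I) < k)%N -> wcoef w x = 0.
Proof.
move=> kx wk; move: x kx.
apply: (@lspan_eq K _ K^o (wcoef w) (fun=> 0) _ (wcoef_linear w) (@lin_zero _ _ _)).
move=> _ [v /= kv <-]; rewrite wcoefE; case: eqP => // vw.
by rewrite vw leqNgt wk in kv.
Qed.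

Lemma long_wordsM j k x y : long_words j x -> long_words k y -> long_words (j + k) (x * y).
Proof.
move=> jx ky; move: x jx.
apply: (lspan_map (lin_mulr y) (long_words_subspace _)) => _ [v /= vj <-].
move: y ky; apply: (lspan_map (lin_mull _) (long_words_subspace _)) => _ [w /= wk <-].
rewrite wordM; apply: lspan_gen; exists (mmul v w) => //=.
by rewrite fmM size_cat leq_add.
Qed.

Lemma long_wordsS j k x : (j <= k)%N -> long_words k x -> long_words j x.
Proof.
by move=> jk; apply: lspanS => _ [w /= kw <-]; exists w => //=; exact: leq_trans kw.
Qed.

Lemma long_words_word (w : {fmonom I}) : long_words (size (w : seq I)) (word K w).
Proof. by apply: lspan_gen; exists w => /=. Qed.

(* The coefficients of [g x] and [x] agree at the shortest words of [x]. *)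
Lemma triangular_injective (g : T -> T) : linear g -> g 1 = 1 -> {morph g : x y / x * y} ->
  (forall i, long_words 2 (g (gen K i) - gen K i)) -> injective g.
Proof.
move=> gl g1 gM gg.
have gw s : long_words (size s).+1 (g (word K (wseq s)) - word K (wseq s)).
  elim: s => [|i s IH].
    by rewrite word1 g1 subrr; exact: subspace0 (long_words_subspace _).
  rewrite word_cons gM; set u := g (gen K i) in gg *; set t := g _ in IH *.
  have -> : g (gen K i) * t - gen K i * word K (wseq s) =
      (g (gen K i) - gen K i) * t + gen K i * (t - word K (wseq s)).
    by rewrite mulrBl mulrBr addrA subrK.
  apply: (subspaceD (long_words_subspace _)).
    rewrite -[(size _).+1]/(1 + (size s).+1)%N addnS -addSn; apply: (long_wordsM (gg i)).
    rewrite -[t](subrK (word K (wseq s))); apply: (subspaceD (long_words_subspace _)).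
      exact: long_wordsS IH.
    by have := @long_words_word (wseq s); rewrite wseqK.
  rewrite -[(size _).+1]/(1 + (size s).+1)%N; apply: long_wordsM => //.
  by have := @long_words_word (fmu i); rewrite fmU.
move=> x y gxy; apply/eqP; rewrite -subr_eq0; apply/eqP.
have : g (x - y) = 0 by rewrite (linB _ _ gl) gxy subrr.
move: (x - y) => t gt {x y gxy}; apply: wcoef_eq0 => w.
(* Strong induction on the length of w: shorter words have coefficient 0 in t, and among the words
   at least as long as w only w contributes to the coefficient of w in g t. *)
move: {2}(size _) (erefl (size (w : seq I))) => k; elim/ltn_ind: k w => k IH w wk.
have [r /(_ (undup (w :: r)) (undup_uniq _)) tE] := wcoef_expand t.
have := congr1 (wcoef w) gt; rewrite wcoef0 {1}tE; last first.
  by move=> v vr; rewrite mem_undup inE vr orbT.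
rewrite (lin_sum _ _ _ gl) wcoef_sum (bigD1_seq w) ?mem_undup ?inE ?eqxx ?undup_uniq//.
have gwc (v : {fmonom I}) : (k <= size (v : seq I))%N ->
    wcoef w (g (word K v)) = (v == w)%:R.
  move=> kv; rewrite -[g _](subrK (word K v)).
  have := gw v; rewrite wseqE => /long_words_wcoef L.
  by rewrite wcoefD wcoefE L ?add0r// wk ltnS.
rewrite big1 => [|v vw].
  by rewrite /= addr0 (linZ _ _ gl) wcoefZ gwc ?wk// eqxx mulr1.
rewrite (linZ _ _ gl) wcoefZ; have [vk|kv] := ltnP (size (v : seq I)) k.
  by rewrite (IH _ vk v erefl) mul0r.
by rewrite gwc// (negPf vw) mulr0.
Qed.

End LengthFiltration.

Section HomogeneousGenerators.
Variables (K : fieldType) (H : hopf_data K).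
Hypothesis hH : FGCCHA H.
Local Notation gr := (@hgr K H).

Let grP : grading gr. Proof. exact: gh_grading (fg_graded_hopf hH). Qed.

(** The given free generating set is an unindexed subset of [H]. Its elements are linearly
    independent, so finite-dimensionality leaves finitely many in each degree, and [a n] counts
    those of degree n + 1. *)
Lemma homogeneous_presentation : exists (a : nat -> nat) (f : freealg K (seq_gens a) -> H),
  [/\ linear f, f 1 = 1, {morph f : x y / x * y}, bijective f &
      forall i, gr (tag i).+1 (f (gen K i))].
Proof.
have [X [Xgr phib]] := fg_free hH.
pose phi := freealg_lift (fun x : X => val x : H).
have {}phib : bijective phi by exact: phib.
have phil : linear phi by exact: freealg_lift_linear.
have phig (x : X) : phi (gen K x) = val x by exact: freealg_lift_gen.
have /choice[d dE] (x : X) : exists n, gr n.+1 (val x).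
  by have [n _ gx] := Xgr _ (set_valP x); exists n.
have freeX (s : seq X) (c : X -> K) : uniq s -> \sum_(x <- s) c x *: (val x : H) = 0 ->
    forall x, x \in s -> c x = 0.
  move=> us E x xs; have {}E : \sum_(y <- s) c y *: gen K y = 0 :> freealg K X.
    apply: (bij_inj phib); rewrite (lin_sum _ _ _ phil) (lin0 phil) -[RHS]E.
    by apply: eq_bigr => y _; rewrite (linZ _ _ phil) phig.
  have := congr1 (wcoef (fmu x)) E; rewrite wcoef0 wcoef_sum.
  have wZ y : wcoef (fmu x) (c y *: gen K y) = c y * (y == x)%:R.
    rewrite wcoefZ /gen wcoefE; congr (_ * _%:R); congr (nat_of_bool _); apply/eqP/eqP => [|->//].
    by move/(congr1 val); rewrite /= !fmU => -[].
  rewrite (eq_bigr (fun y => c y * (y == x)%:R)) => [|y _]; last exact: wZ.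
  rewrite (bigD1_seq x) //= eqxx mulr1 big1 ?addr0 // => y /negPf ->.
  by rewrite mulr0.
have neq0 (x : X) : val x != 0 :> H.
  apply/eqP => x0; have := freeX [:: x] (fun=> 1) isT; rewrite big_seq1 x0 scaler0.
  by move=> /(_ erefl x); rewrite inE eqxx => /(_ isT) /eqP; rewrite oner_eq0.
have degE n (x : X) : gr n.+1 (val x) -> d x = n.
  move=> gx; apply/eqP/negPn/negP => dn; case/eqP: (neq0 x).
  by apply: (gr_disjoint grP (dE x) gx); rewrite eqSS.
(* A duplicate-free list of generators of degree n + 1 has length at most the dimension; one of
   maximal length contains them all. *)
have /choice[s sP] n : exists s : seq X, uniq s /\ forall x : X, (x \in s) = (d x == n).
  have [N NE] := fg_findim hH n.+1.
  pose Q k := `[< exists s : seq X, [/\ uniq s, forall x, x \in s -> d x = n & size s = k] >].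
  have Q0 : exists k, Q k by exists 0%N; apply/asboolP; exists [::].
  have QN k : Q k -> (k <= N)%N.
    move=> /asboolP[s [us sn <-]].
    apply: (free_family_le (gr_subspace grP n.+1) NE (b := fun i => val (tnth (in_tuple s) i))).
      by move=> i; rewrite -(sn (tnth (in_tuple s) i)) ?mem_tnth//.
    move=> c c0; have [x0|] := pselect (exists x : X, True); last first.
      move=> nx; apply/rowP => i; case: nx; exists (tnth (in_tuple s) i) => //.
    case: x0 => x0 _.
    pose c' (x : X) := if insub (index x s) is Some j then c 0 j else 0.
    have cE (j : 'I_(size s)) : c' (tnth (in_tuple s) j) = c 0 j.
      by rewrite /c' (tnth_nth x0) index_uniq// valK.
    apply/rowP => j; rewrite mxE -cE; apply: (freeX s) => //; last exact: mem_tnth.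
    rewrite -[RHS]c0 big_tnth; apply: eq_bigr => k' _.
    by rewrite cE.
  have [k /asboolP[t [ut tn tk]] kmax] := ex_maxnP Q0 QN.
  exists t; split=> // x; apply/idP/eqP => [/tn//|xn]; apply/negPn/negP => xt.
  suff /kmax : Q k.+1 by rewrite ltnn.
  apply/asboolP; exists (x :: t); split; rewrite /= ?xt ?tk// => y.
  by rewrite inE => /predU1P[->//|/tn].
pose a n := size (s n).
pose sg (i : seq_gens a) : X := tnth (in_tuple (s (tag i))) (tagged i).
have sgd i : d (sg i) = tag i.
  by apply/eqP; rewrite -(sP (tag i)).2; exact: mem_tnth.
have sgI : injective sg.
  move=> [n i] [m j] E; have nm : n = m by have := sgd (existT _ n i); rewrite E sgd.
  case: m / nm j E => j; rewrite /sg /= => E; congr existT; apply: val_inj.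
  have x0 := tnth (in_tuple (s n)) i; apply/eqP.
  move: E; rewrite !(tnth_nth x0) /= => /eqP.
  by rewrite nth_uniq ?(sP n).1//; case: (i) (j) => ? ? [].
have sd (x : X) : x \in s (d x) by rewrite (sP _).2.
have ilt (x : X) : (index x (s (d x)) < a (d x))%N by rewrite index_mem.
pose tau (x : X) : seq_gens a := existT _ (d x) (Ordinal (ilt x)).
have tauK : cancel tau sg.
  by move=> x; rewrite /sg /= (tnth_nth x) /= nth_index.
have sgK : cancel sg tau by move=> i; apply: sgI; rewrite tauK.
pose f (x : freealg K (seq_gens a)) : H := phi (freealg_lift (fun i => gen K (sg i)) x).
exists a, f; split.
- exact: lin_comp phil (freealg_lift_linear _).
- by rewrite /f freealg_lift1 /phi freealg_lift1.
- by move=> x y; rewrite /f freealg_liftM /phi freealg_liftM.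
- have [psi psiK phiK] := phib.
  exists (fun y => freealg_lift (fun x => gen K (tau x)) (psi y)) => x.
    by rewrite /f psiK freealg_relabelK.
  by rewrite /f freealg_relabelK.
- by move=> i; rewrite /f freealg_lift_gen phig -sgd.
Qed.

End HomogeneousGenerators.

Section PrimitiveGenerators.
Variables (K : fieldType) (H : hopf_data K).
Hypothesis hH : FGCCHA H.
Hypothesis K0 : [pchar K] =i pred0.
Local Notation gr := (@hgr K H).

Let gH := fg_graded_hopf hH.
Let grP : grading gr. Proof. exact: gh_grading gH. Qed.

Lemma FGCCHA_presentation : exists (a : nat -> nat) (f : freealg K (seq_gens a) -> H),
  prim_presentation f.
Proof.
have [a [f [fl f1 fM fb fg]]] := homogeneous_presentation hH.
exists a; have [psi psiK fK] := fb; have psil := linear_can fl psiK fK.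
have psiM : {morph psi : x y / x * y}.
  by move=> x y; apply: (bij_inj fb); rewrite fM !fK.
have psi1 : psi 1 = 1 by apply: (bij_inj fb); rewrite f1 fK.
have grf n x : freealg_gr n x -> gr n (f x).
  move: x; apply: (lspan_map fl (gr_subspace grP n)) => _ [w /= <- <-].
  rewrite -[w]wseqE word_degreeE; elim: (w : seq _) => [|i s IH].
    by rewrite word1 f1 /seq_degree big_nil; exact: (gh_one gH).
  by rewrite word_cons fM /seq_degree big_cons; exact: (gh_mul gH).
have grpsi n x : gr n x -> freealg_gr n (psi x).
  move=> gx; apply: (graded_reflect grP (@freealg_grading K a) fl (bij_inj fb) grf).
  by rewrite fK.
have /choice[y yP] i := primitive_lift gH (fg_connected hH) (fg_cocommutative hH) K0 (fg i).
pose h := freealg_lift y; exists h.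
have hl : linear h by exact: freealg_lift_linear.
have hM : {morph h : x y / x * y} by exact: freealg_liftM.
have h1 : h 1 = 1 by exact: freealg_lift1.
have hg i : h (gen K i) = y i by exact: freealg_lift_gen.
have grh n x : freealg_gr n x -> gr n (h x).
  move: x; apply: (lspan_map hl (gr_subspace grP n)) => _ [w /= <- <-].
  rewrite -[w]wseqE word_degreeE; elim: (w : seq _) => [|i s IH].
    by rewrite word1 h1 /seq_degree big_nil; exact: (gh_one gH).
  rewrite word_cons hM /seq_degree big_cons; apply: (gh_mul gH); last exact: IH.
  by rewrite hg; have [] := yP i.
have longgr n x : freealg_gr n.+1 x -> long_words 1 x.
  apply: lspanS => _ [w /= wn <-]; exists w => //=; move: wn.
  by rewrite /word_degree; case: (w : seq _) => //; rewrite big_nil.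
(* Composing with [psi], the inverse of [f], turns [h] into a substitution of the free algebra: each
   letter changes by decomposables, which [psi] sends to words of length at least 2. *)
have hI : injective h.
  suff : injective (fun x => psi (h x)) by move=> I u v huv; apply: I; rewrite huv.
  apply: triangular_injective => [|||i].
  - exact: lin_comp psil hl.
  - by rewrite h1 psi1.
  - by move=> u v; rewrite hM psiM.
  rewrite hg -[gen K i]psiK -(linB _ _ psil).
  have -> : psi (y i - f (gen K i)) = - psi (f (gen K i) - y i).
    by rewrite -opprB -scaleN1r (linZ _ _ psil) scaleN1r.
  apply: (subspaceN (@long_words_subspace _ _ 2)).
  have [_ _] := yP i; apply: (lspan_map psil (@long_words_subspace _ _ 2)).
  move=> _ [j [k [u [v [_ gu gv ->]]]]]; rewrite psiM.
  by apply: (@long_wordsM _ _ 1 1); [exact: longgr (grpsi _ _ gu)|exact: longgr (grpsi _ _ gv)].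
(* Surjectivity goes by degree: a word of length at least 2 splits into factors of smaller degree,
   and a single generator differs from its primitive substitute by products of such factors. *)
have hS n z : gr n z -> exists t, z = h t.
  elim/ltn_ind: n z => n IH z gz.
  pose R : set H := range h.
  have RS : subspace R.
    apply/subspaceP; split=> [|c _ _ [u _ <-] [v _ <-]].
      by exists 0; rewrite // (lin0 hl).
    by exists (c *: u + v); rewrite // hl.
  have RM u v : R u -> R v -> R (u * v).
    by move=> [u' _ <-] [v' _ <-]; exists (u' * v'); rewrite // hM.
  have IHR m u : (m < n)%N -> gr m u -> R u.
    by move=> mn /(IH m mn)[t ->]; exists t.
  suff [t _ <-] : R z by exists t.
  rewrite -[z]fK; move: (psi z) (grpsi _ _ gz) => t; move: t {z gz}.
  apply: (lspan_map fl RS) => _ [w /= wn <-]; move: wn; rewrite -[w]wseqE word_degreeE.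
  case: (w : seq _) => [|i [|j s]].
  - by move=> _; exists 1; rewrite // h1 word1 f1.
  - rewrite /seq_degree big_seq1 => ni; rewrite word_cons word1 mulr1.
    rewrite -[f _](subrK (y i)); apply: (subspaceD RS); last first.
      by exists (gen K i); rewrite // hg.
    have [_ _] := yP i; apply: (lspan_min RS) => _ [k [l [u [v [kl gu gv ->]]]]].
    by apply: RM; [apply: IHR gu|apply: IHR gv]; rewrite -ni -kl; lia.
  - rewrite word_cons fM {1}/seq_degree big_cons -/(seq_degree (j :: s)) => ijn.
    have js : (0 < seq_degree (j :: s))%N by rewrite /seq_degree big_cons.
    apply: RM; first by apply: IHR (fg i); rewrite -ijn -[X in (X < _)%N]addn0 ltn_add2l.
    apply: (IHR (seq_degree (j :: s))); first by rewrite -ijn addSn ltnS leq_addl.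
    by apply: grf; rewrite -word_degreeE; exact: word_gr.
have hb : bijective h.
  have /choice[h' h'E] z : exists t, h t = z.
    have [N [u [gu ->]]] : exists N (u : nat -> H), (forall n, gr n (u n)) /\ z = \sum_(n < N) u n.
      by have [_] := grP.
    have /choice[t tE] n := hS n _ (gu n).
    exists (\sum_(n < N) t n); rewrite (lin_sum _ _ _ hl).
    by apply: eq_bigr => n _; rewrite -tE.
  by exists h' => // x; apply: hI; rewrite h'E.
split=> //.
- move=> n x; split; first exact: grh.
  exact: (graded_reflect grP (@freealg_grading K a) hl hI grh).
- exact: gh_comul_linear gH.
- exact: gh_comul1 gH.
- exact: gh_comulM gH.
- exact: gh_counit_linear gH.
- exact: gh_counit1 gH.
- exact: gh_counitM gH.
- by move=> i; rewrite hg; have [] := yP i.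
- by move=> i; rewrite hg; apply: (gh_counit_gr gH (n := tag i)); have [] := yP i.
Qed.

End PrimitiveGenerators.

(** * Ordered products of primitives *)

Section OrderedMonomials.
Variables (K : fieldType) (a : nat -> nat) (H : hopf_data K).
Variable f : freealg K (seq_gens a) -> H.
Hypothesis fP : prim_presentation f.
Hypothesis K0 : [pchar K] =i pred0.
Local Notation gr := (@hgr K H).
Local Notation Δ := (@hcomul K H).
Local Notation p := (primitive_dim_seq H).
Local Notation I := (seq_gens p).

Let grP : grading gr := pp_grading fP.
Let grS n : subspace (gr n) := gr_subspace grP n.
Let Dl : linear Δ := pp_comul_linear fP.
Let ml (g : H) : linear (fun y : H => g * y) := @lin_mull K H g.

Lemma primitives_subspace : subspace (@primitives K H).
Proof.
have L : linear (fun x : H => Δ x - (x ⊗ 1 + 1 ⊗ x)).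
  apply: (lin_sub Dl).
  exact: (lin_add (@lin_tensl K H H 1) (@lin_tensr K H H 1)).
have -> : @primitives K H = [set x | Δ x - (x ⊗ 1 + 1 ⊗ x) = 0].
  apply/seteqP; split=> x /=; first by move=> ->; rewrite subrr.
  by move/eqP; rewrite subr_eq0 => /eqP.
exact: subspace_ker L.
Qed.

Lemma primitives_commutator x y :
  primitives x -> primitives y -> primitives (x * y - y * x : H).
Proof.
have DM u v : primitives u -> primitives v ->
    Δ (u * v) = ((u * v) ⊗ 1 + 1 ⊗ (u * v)) + (u ⊗ v + v ⊗ u).
  move=> uP vP; rewrite (pp_comulM fP) uP vP tensor_mul_prim.
  rewrite (linD _ _ (tder_linear (ml u) (ml u))).
  rewrite (tderE (ml u) (ml u) v 1) (tderE (ml u) (ml u) 1 v) !mulr1.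
  have E (V : zmodType) (b c d e : V) : b + e + (d + c) = b + c + (d + e).
    by rewrite [d + c]addrC addrACA [e + d]addrC.
  exact: E.
move=> xP yP; rewrite /primitives /= (linB _ _ Dl) (DM _ _ xP yP) (DM _ _ yP xP).
have tlB u v : (u - v) ⊗ (1 : H) = u ⊗ 1 - v ⊗ 1 := linB u v (@lin_tensl K H H 1).
have trB u v : (1 : H) ⊗ (u - v) = 1 ⊗ u - 1 ⊗ v := linB u v (@lin_tensr K H H 1).
rewrite tlB trB [x ⊗ y + _]addrC.
have E (V : zmodType) (b c d e s : V) : b + c + s - (d + e + s) = b - d + (c - e).
  by rewrite opprD addrACA subrr addr0 opprD addrACA.
exact: E.
Qed.

Lemma primitive_dim n : has_dim (@primitives K H `&` gr n.+1) (p n).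
Proof.
have PS : subspace (@primitives K H `&` gr n.+1) := subspaceI primitives_subspace (grS _).
have [m mP] := has_dim_sub PS (grS n.+1) (fun _ h => h.2) (pp_dim fP n.+1).
by rewrite /primitive_dim_seq (dimensionE PS mP).
Qed.

Let basis_ex n : exists e : 'I_(p n) -> H,
  [/\ forall i, (@primitives K H `&` gr n.+1) (e i),
      forall x, (@primitives K H `&` gr n.+1) x -> exists c, x = lcomb e c &
      forall c, lcomb e c = 0 -> c = 0].
Proof.
have PS : subspace (@primitives K H `&` gr n.+1) := subspaceI primitives_subspace (grS _).
exact: (has_dimP _ PS).1 (primitive_dim n).
Qed.

Definition prim_basis (x : I) : H := projT1 (cid (basis_ex (tag x))) (tagged x).
Local Notation e_ := prim_basis.

Lemma prim_basis_prim x : primitives (e_ x).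
Proof. by rewrite /e_; case: cid => e [/= eP _ _]; have [] := eP (tagged x). Qed.

Lemma prim_basis_gr x : gr (tag x).+1 (e_ x).
Proof. by rewrite /e_; case: cid => e [/= eP _ _]; have [] := eP (tagged x). Qed.

Lemma prim_basis_span n y : primitives y -> gr n.+1 y ->
  lspan [set e_ x | x in [set x : I | tag x = n]] y.
Proof.
move=> Py gy; pose e := projT1 (cid (basis_ex n)).
have [c ->] : exists c, y = lcomb e c.
  by rewrite /e; case: cid => e' [/= _ eG _]; apply: eG.
apply: (lcomb_in _ (subspace_lspan _)) => i.
by apply: lspan_gen; exists (existT _ n i).
Qed.

(** The functional is dual to the basis inside degree n + 1 and is extended by 0 to the other
    degrees through [gproj]; in particular it kills 1. *)
Lemma prim_basis_dual : exists l : I -> H -> K, forall x,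
  [/\ scalar (l x), l x 1 = 0 & forall y, l x (e_ y) = (x == y)%:R].
Proof.
suff /choice[l lP] : forall x : I, exists l : H -> K,
    [/\ scalar l, l 1 = 0 & forall y, l (e_ y) = (x == y)%:R] by exists l.
move=> [n i].
have gb j : gr n.+1 (e_ (existT _ n j)) := prim_basis_gr (existT _ n j).
have bF c : lcomb (fun j => e_ (existT _ n j)) c = 0 -> c = 0.
  by rewrite /e_ /=; case: cid => e [/= _ _]; apply.
have [l lP] := dual_functionals (grS n.+1) (pp_dim fP n.+1) gb bF.
have [lL lE] := lP i.
have l0 : l i 0 = 0.
  have := lL 1 0 0 (subspace0 (grS _)) (subspace0 (grS _)).
  by rewrite scaler0 addr0 mul1r => /eqP; rewrite -subr_eq0 opprD addrA subrr sub0r oppr_eq0 => /eqP.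
exists (fun y => l i (gproj grP y n.+1)); split=> [c x y||[m j]].
- by rewrite (gproj_linear grP) lL//; exact: gproj_gr.
- by rewrite (gproj0 grP (pp_gr1 fP)).
have [nm|nm] := eqVneq m n.
  subst m; rewrite (gproj_id grP) ?gb// lE; congr (nat_of_bool _)%:R.
  by apply/eqP/eqP => [->//|/eqP]; rewrite eq_Tagged => /eqP.
rewrite (gproj0 grP (prim_basis_gr (existT _ m j))) 1?eq_sym//.
by case: eqP => // /(congr1 tag) /= E; rewrite E eqxx in nm.
Qed.

Definition prim_prod (s : seq I) : H := \prod_(x <- s) e_ x.
Local Notation ep := prim_prod.

Lemma prim_prod_cons x s : ep (x :: s) = e_ x * ep s.
Proof. exact: big_cons. Qed.

Lemma prim_prod_nil : ep [::] = 1.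
Proof. exact: big_nil. Qed.

Lemma seq_degree_cons (x : I) s : seq_degree (x :: s) = ((tag x).+1 + seq_degree s)%N.
Proof. exact: big_cons. Qed.

Lemma prim_prod_gr s : gr (seq_degree s) (ep s).
Proof.
elim: s => [|x s IH].
  by rewrite prim_prod_nil /seq_degree big_nil; exact: pp_gr1 fP.
rewrite prim_prod_cons seq_degree_cons; apply: (pp_gr_mul fP) => //.
exact: prim_basis_gr.
Qed.

(** Letters may come in any order. The degree is kept for straightening inside one graded piece;
    [short_prods_any] drops it, since the derivations do not track it. *)
Definition short_prods k n : set H :=
  lspan [set ep s | s in [set s : seq I | (size s < k)%N /\ seq_degree s = n]].

Definition short_prods_any k : set H :=
  lspan [set ep s | s in [set s : seq I | (size s < k)%N]].

Let FS k n : subspace (short_prods k n). Proof. exact: subspace_lspan. Qed.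
Let FaS k : subspace (short_prods_any k). Proof. exact: subspace_lspan. Qed.

Lemma short_prods_incl k n x : short_prods k n x -> short_prods_any k x.
Proof. by apply: lspanS => _ [s [? ?] <-]; exists s. Qed.

Lemma short_prods_any_le j k x : (j <= k)%N -> short_prods_any j x -> short_prods_any k x.
Proof.
by move=> jk; apply: lspanS => _ [s /= sj <-]; exists s => //=; exact: leq_trans jk.
Qed.

Lemma short_prods_mull x k n y : short_prods k n y ->
  short_prods k.+1 ((tag x).+1 + n) (e_ x * y).
Proof.
move: y; apply: (lspan_map (ml _) (FS _ _)) => _ [s [sk <-] <-].
rewrite -prim_prod_cons -seq_degree_cons; apply: lspan_gen.
by exists (x :: s).
Qed.

Lemma short_prods_any_mull x k y : short_prods_any k.-1 y -> short_prods_any k (e_ x * y).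
Proof.
move: y; apply: (lspan_map (ml _) (FaS _)) => _ [s /= sk <-].
rewrite -prim_prod_cons; apply: lspan_gen; exists (x :: s) => //=.
by case: k sk.
Qed.

(** The commutator of two primitives is primitive, hence a combination of single basis elements of
    the summed degree, so the length drops by one. *)
Lemma prim_prod_swap x y s :
  short_prods (size s).+2 (seq_degree [:: x, y & s]) (ep [:: x, y & s] - ep [:: y, x & s]).
Proof.
rewrite !prim_prod_cons !mulrA -mulrBl.
have : lspan [set e_ z | z in [set z : I | tag z = (tag x + tag y).+1]] (e_ x * e_ y - e_ y * e_ x).
  apply: prim_basis_span; first by apply: primitives_commutator; exact: prim_basis_prim.
  have E : (tag x + tag y).+2 = ((tag x).+1 + (tag y).+1)%N by rewrite addSn addnS.
  apply: subspaceB (grS _) _ _; rewrite E; last rewrite addnC;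
    by apply: (pp_gr_mul fP); exact: prim_basis_gr.
apply: (lspan_map (lin_mulr (ep s)) (FS _ _)) => _ [z /= zE <-].
rewrite -prim_prod_cons; apply: lspan_gen; exists (z :: s) => //; split=> //=.
by rewrite !seq_degree_cons zE addnA addSn addnS.
Qed.

(** The first letter of [s] is carried to its place in [t] by adjacent swaps, which is [mv]; the
    remaining letters follow by induction. *)
Lemma prim_prod_perm s t : perm_eq s t ->
  short_prods (size s) (seq_degree s) (ep s - ep t).
Proof.
have mv x s1 s2 : short_prods (size s1 + size s2).+1
    (seq_degree (x :: s1 ++ s2)) (ep (x :: s1 ++ s2) - ep (s1 ++ x :: s2)).
  elim: s1 => [|y s1 IH] /=; first by rewrite subrr; exact: subspace0 (FS _ _).
  rewrite -[_ - _](subrKA (ep [:: y, x & s1 ++ s2])).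
  apply: (subspaceD (FS _ _)).
    by have := @prim_prod_swap x y (s1 ++ s2); rewrite size_cat.
  rewrite 2!(prim_prod_cons y) -mulrBr.
  rewrite !seq_degree_cons addnCA addSn; rewrite seq_degree_cons in IH.
  exact: (@short_prods_mull y _ _ _ IH).
elim: s t => [|x s IH] t.
  move=> t0; have -> : t = [::] by apply/size0nil; rewrite -(perm_size t0).
  by rewrite subrr; exact: subspace0 (FS _ _).
move=> st; have xt : x \in t by rewrite -(perm_mem st) inE eqxx.
case/splitPr: xt st => t1 t2 st.
have st' : perm_eq s (t1 ++ t2).
  by rewrite -(perm_cons x) (perm_trans st)// perm_catC /= perm_cons perm_catC.
rewrite -[_ - _](subrKA (ep (x :: t1 ++ t2))).
apply: (subspaceD (FS _ _)).
  by rewrite !prim_prod_cons -mulrBr seq_degree_cons; exact: short_prods_mull (IH _ st').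
have := @mv x t1 t2; rewrite -size_cat -(perm_size st') !seq_degree_cons.
rewrite /seq_degree -(perm_big _ st'); exact.
Qed.

(** The generators of the presentation are primitive, so each is a combination of basis primitives
    of its degree, and words expand accordingly. *)
Lemma gr_prim_prod_span n :
  gr n `<=` lspan [set ep s | s in [set s : seq I | seq_degree s = n]].
Proof.
apply: (pp_gr_ind fP (subspace_lspan _)) => s <- {n}.
elim: s => [|i s IH].
  rewrite word1 (pp1 fP) -prim_prod_nil; apply: lspan_gen.
  by exists [::] => //=; rewrite /seq_degree !big_nil.
rewrite (pp_word_cons fP) /seq_degree big_cons -/(seq_degree s).
have := prim_basis_span (pp_comul_gen fP i) (pp_gr_gen fP i).
move: (f (gen K i)); apply: (lspan_map (lin_mulr _) (subspace_lspan _)) => _ [x /= xi <-].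
move: (f _) IH; apply: (lspan_map (ml _) (subspace_lspan _)) => _ [t /= ts <-].
rewrite -prim_prod_cons; apply: lspan_gen; exists (x :: t) => //.
by rewrite /= -[LHS]/(seq_degree (x :: t)) seq_degree_cons ts xi.
Qed.

(** * Partial derivatives and independence of the ordered products *)

Section Derivation.
Variables (l : I -> H -> K).
Hypothesis lP : forall x,
  [/\ scalar (l x), l x 1 = 0 & forall y, l x (e_ y) = (x == y)%:R].

Let lb (x : I) (u v : H) : H := l x u *: v.
Let lb_bilin x : @bilinear_map K H H H (lb x).
Proof. by apply: bilin_scale; [case: (lP x)|exact: lin_id]. Qed.

Definition prim_deriv (x : I) (y : H) : H := tlift (lb x) (Δ y).
Local Notation d_ := prim_deriv.

Lemma prim_deriv_linear x : linear (d_ x).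
Proof. exact: lin_comp (tlift_linear (lb_bilin x)) Dl. Qed.

Let rest k : set (tensor H H) :=
  lspan [set t | exists u v, short_prods_any k v /\ t = u ⊗ v].

Let restS k : subspace (rest k). Proof. exact: subspace_lspan. Qed.

(** Expanding the product of the coproducts, each letter goes left or right; only 1 (x) [ep s] keeps
    all letters on the right. *)
Lemma comul_prim_prod s : rest (size s) (Δ (ep s) - 1 ⊗ ep s).
Proof.
elim: s => [|x s IH].
  by rewrite prim_prod_nil (pp_comul1 fP) subrr; exact: subspace0 (restS _).
have td := tder_linear (ml (e_ x)) (ml (e_ x)).
rewrite prim_prod_cons (pp_comulM fP) (prim_basis_prim x) tensor_mul_prim.
set g := fun b => e_ x * b; set t := Δ (ep s) in IH *.
have -> : tder g g t - 1 ⊗ (e_ x * ep s) = tder g g (t - 1 ⊗ ep s) + e_ x ⊗ ep s.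
  rewrite (linB _ _ td) (tderE (ml (e_ x)) (ml (e_ x)) 1 (ep s)) mulr1 opprD.
  by rewrite addrA addrAC subrK.
apply: (subspaceD (restS _)).
  move: IH; move: (t - _); apply: (lspan_map td (restS _)) => _ [u [v [kv ->]]].
  rewrite (tderE (ml (e_ x)) (ml (e_ x)) u v); apply: (subspaceD (restS _)); apply: lspan_gen.
    by exists (g u), v; split=> //; exact: short_prods_any_le kv.
  by exists u, (g v); split=> //; exact: short_prods_any_mull.
apply: lspan_gen; exists (e_ x), (ep s); split=> //.
by apply: lspan_gen; exists s => /=.
Qed.

Let deriv_rest x k t : rest k t -> short_prods_any k (tlift (lb x) t).
Proof.
move: t; apply: (lspan_map (tlift_linear (lb_bilin x)) (FaS _)) => _ [u [v [kv ->]]].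
by rewrite (tliftE (lb_bilin x)); exact: subspaceZ (FaS _) kv.
Qed.

Lemma prim_deriv_lower x s : short_prods_any (size s) (d_ x (ep s)).
Proof.
have [_ l1 _] := lP x; have Lb := tlift_linear (lb_bilin x).
have l0 : lb x 1 (ep s) = 0 by rewrite /lb l1 scale0r.
rewrite /d_ -[Δ _](subrK (1 ⊗ ep s)) (linD _ _ Lb) (tliftE (lb_bilin x)) l0 addr0.
exact: (@deriv_rest x _ _ (@comul_prim_prod s)).
Qed.

Lemma prim_deriv_cons x y s : short_prods_any (size s)
  (d_ x (ep (y :: s)) - ((x == y)%:R *: ep s + e_ y * d_ x (ep s))).
Proof.
have [_ l1 le] := lP x; have Lb := tlift_linear (lb_bilin x).
have td := tder_linear (ml (e_ y)) (ml (e_ y)).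
rewrite prim_prod_cons /d_ (pp_comulM fP) (prim_basis_prim y) tensor_mul_prim.
set g := fun b => e_ y * b; have rs := @comul_prim_prod s; set t := Δ (ep s) in rs *.
pose E r : H := tlift (lb x) (tder g g r) - e_ y * tlift (lb x) r.
(* [E] measures the failure of multiplication by e_y to commute with the derivative. On u (x) v it
   equals l_x(e_y u) v, whose length is that of v. *)
have El : linear E.
  apply: lin_sub; first exact: lin_comp Lb td.
  exact: lin_comp (ml (e_ y)) Lb.
have E1 : E (1 ⊗ ep s) = (x == y)%:R *: ep s.
  rewrite /E (tderE (ml (e_ y)) (ml (e_ y)) 1 (ep s)) mulr1 (linD _ _ Lb).
  rewrite 3!(tliftE (lb_bilin x)) /lb l1 le !scale0r mulr0 subr0 addr0.
  by [].
have -> : tlift (lb x) (tder g g t) - ((x == y)%:R *: ep s + e_ y * tlift (lb x) t) =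
    E (t - 1 ⊗ ep s).
  by rewrite (linB _ _ El) E1 /E opprD addrA addrAC.
move: rs; move: (t - _); apply: (lspan_map El (FaS _)) => _ [u [v [kv ->]]].
rewrite /E (tderE (ml (e_ y)) (ml (e_ y)) u v) (linD _ _ Lb).
rewrite (tliftE (lb_bilin x) (g u)) (tliftE (lb_bilin x) u (g v)) (tliftE (lb_bilin x) u v).
by rewrite /lb -scalerAr addrK; exact: subspaceZ (FaS _) kv.
Qed.

Lemma prim_deriv_prod x s : short_prods_any (size s).-1
  (d_ x (ep s) - (count_mem x s)%:R *: ep (rem x s)).
Proof.
elim: s => [|y s IH] /=.
  rewrite scale0r subr0; exact: (@prim_deriv_lower x [::]).
set r := d_ x (ep s) - _ in IH *.
have := @prim_deriv_cons x y s; set q := _ - _ => qs.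
have -> : d_ x (ep (y :: s)) = q + ((x == y)%:R *: ep s + e_ y * d_ x (ep s)).
  by rewrite /q subrK.
have -> : d_ x (ep s) = r + (count_mem x s)%:R *: ep (rem x s) by rewrite /r subrK.
rewrite mulrDr -scalerAr -prim_prod_cons.
have yr := @short_prods_any_mull y _ _ IH.
rewrite eq_sym; case: (eqVneq y x) => [<-|yx] /=; last first.
  rewrite scale0r !add0r add0n addrA addrK.
  exact: (subspaceD (FaS _)).
(* The leading y contributes [ep s], the other occurrences contribute [ep (y :: rem y s)]; these
   words are permutations of each other, so the terms combine modulo shorter products. *)
have D : short_prods_any (size s) ((count_mem y s)%:R *: (ep (y :: rem y s) - ep s)).
  have [ys|/count_memPn ->] := boolP (y \in s); last first.
    by rewrite scale0r; exact: subspace0 (FaS _).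
  apply: subspaceZ (FaS _) _; rewrite -opprB; apply: subspaceN (FaS _) _.
  exact: short_prods_incl (prim_prod_perm (perm_to_rem ys)).
rewrite scale1r natrD scalerDl scale1r.
have E (V : lmodType K) (c : K) (P Q R S : V) :
    Q + (P + (R + c *: S)) - (P + c *: P) = Q + R + c *: (S - P).
  by rewrite scalerBr [P + (R + _)]addrC addrA opprD addrA addrK !addrA.
rewrite E; apply: (subspaceD (FaS _)) D; exact: (subspaceD (FaS _)).
Qed.

Let nat_neq0 n : n.+1%:R != 0 :> K.
Proof.
have H0 : forall n, (n%:R == 0 :> K) = (n == 0)%N by apply/pcharf0P.
by rewrite H0.
Qed.

(* The symbols of monomials with distinct underlying multisets are independent
   modulo shorter products: differentiate and induct on the length. *)
Lemma prim_prod_symbol_free (J : eqType) (r : seq J) (w : J -> seq I) (c : J -> K) k :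
  uniq r -> (forall j, j \in r -> size (w j) = k) ->
  {in r &, forall i j, perm_eq (w i) (w j) -> i = j} ->
  short_prods_any k (\sum_(j <- r) c j *: ep (w j)) -> forall j, j \in r -> c j = 0.
Proof.
elim: k r w c => [|k IH] r w c ur wk wI Fk j jr.
  have w0 i : i \in r -> w i = [::] by move=> /wk /size0nil.
  (* All words are empty, hence permutations of each other, so there is a single index and the sum
     is a multiple of 1. *)
  have rj : r = [:: j].
    case: r ur jr wI w0 {Fk wk} => [//|i r] /= /andP[ir ur] jr wI w0.
    have ij i' : i' \in i :: r -> i' = j.
      by move=> i'r; apply: wI => //; rewrite !w0.
    rewrite (ij i) ?inE ?eqxx//; case: r ir {ur jr wI w0} ij => // i' r.
    move=> ir ij; move: ir; rewrite (ij i) ?inE ?eqxx//.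
    by rewrite (ij i') ?inE ?eqxx ?orbT.
  have : short_prods_any 0 (c j *: 1).
    by move: Fk; rewrite rj big_seq1 w0// prim_prod_nil.
  have F0 x : short_prods_any 0 x -> x = 0.
    move: x; apply: (lspan_eq (@lin_id _ _) (@lin_zero _ _ _)) => y [s /= s0 _].
    by rewrite ltn0 in s0.
  by move=> /F0 /eqP; rewrite scaler_eq0 oner_eq0 orbF => /eqP.
(* Differentiating in a letter of w_j keeps the j-th term. Terms without x vanish modulo shorter
   products, and removing one x from the others keeps their multisets distinct. *)
have [x xw] : exists x, x \in w j.
  by case: (w j) (wk j jr) => // x s _; exists x; rewrite inE eqxx.
have dF y : short_prods_any k.+1 y -> short_prods_any k (d_ x y).
  move: y; apply: (lspan_map (prim_deriv_linear x) (FaS _)) => _ [s /= sk <-].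
  exact: short_prods_any_le (@prim_deriv_lower x s).
pose r' := [seq i <- r | x \in w i].
have r'r i : i \in r' -> i \in r /\ x \in w i.
  by rewrite mem_filter => /andP[].
have : c j * (count_mem x (w j))%:R = 0.
  apply: (IH r' (fun i => rem x (w i)) (fun i => c i * (count_mem x (w i))%:R)).
  - exact: filter_uniq.
  - by move=> i /r'r[ir xi]; rewrite size_rem// wk.
  - move=> i i' /r'r[ir xi] /r'r[ir' xi'] P; apply: wI => //.
    rewrite (perm_trans (perm_to_rem xi))// perm_sym.
    by rewrite (perm_trans (perm_to_rem xi'))// perm_cons perm_sym.
  - rewrite big_filter big_mkcond /=.
    have := dF _ Fk; rewrite (lin_sum _ _ _ (prim_deriv_linear x)) => Fd.
    rewrite -[X in short_prods_any k X](subrK (\sum_(i <- r) d_ x (c i *: ep (w i)))).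
    apply: (subspaceD (FaS _)) Fd; rewrite -sumrB; apply: subspace_sum (FaS _) _ => i ir.
    have := @prim_deriv_prod x (w i); rewrite (wk i ir) /= => D.
    rewrite (linZ _ _ (prim_deriv_linear x)) -opprB; apply: subspaceN (FaS _) _.
    have -> : (if x \in w i then (c i * (count_mem x (w i))%:R) *: ep (rem x (w i)) else 0) =
              c i *: ((count_mem x (w i))%:R *: ep (rem x (w i))).
      case: ifPn => [_|/count_memPn ->]; first by rewrite scalerA.
      by rewrite scale0r scaler0.
    by rewrite -scalerBr; exact: subspaceZ (FaS _) D.
  - by rewrite mem_filter xw.
(* The multiplicity of x in w_j is positive, hence nonzero in characteristic 0, and can be
   cancelled. *)
move: xw; rewrite -has_pred1 has_count; case: (count_mem x (w j)) => // n _ /eqP.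
by rewrite mulf_eq0 (negPf (nat_neq0 n)) orbF => /eqP.
Qed.

(** Descending induction on length: once the coefficients of the longer words vanish, those of
    length k form a relation modulo shorter products. [N] exceeds every length, and [d] bounds N -
    k. *)
Lemma prim_prod_free (J : eqType) (r : seq J) (w : J -> seq I) (c : J -> K) :
  uniq r -> {in r &, forall i j, perm_eq (w i) (w j) -> i = j} ->
  \sum_(j <- r) c j *: ep (w j) = 0 -> forall j, j \in r -> c j = 0.
Proof.
move=> ur wI S0; pose N := (\max_(j <- r) size (w j)).+1.
suff P d k : (N <= k + d)%N -> forall j, j \in r -> (k <= size (w j))%N -> c j = 0.
  by move=> j jr; exact: (P N 0%N (leqnn N) j jr).
elim: d k => [|d IH] k Nk j jr kj.
  have : (size (w j) < N)%N by rewrite ltnS; exact: leq_bigmax_seq.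
  by rewrite ltnNge (leq_trans _ kj)// -[k]addn0.
have ck i : i \in r -> (k < size (w i))%N -> c i = 0.
  by apply: IH; rewrite addSn -addnS.
have [{}kj|kj'] := ltnP k (size (w j)); first exact: ck.
have {kj'}kj : size (w j) = k by apply/eqP; rewrite eqn_leq kj' kj.
pose r' := [seq i <- r | size (w i) == k].
apply: (@prim_prod_symbol_free J r' w c k) => [|i|i i'||].
- exact: filter_uniq.
- by rewrite mem_filter => /andP[/eqP].
- by rewrite !mem_filter => /andP[_ ir] /andP[_ ir']; exact: wI.
- rewrite big_filter big_mkcond /=.
  rewrite -[X in short_prods_any k X]subr0 -[X in _ - X]S0 -sumrB; apply: subspace_sum (FaS _) _ => i ir.
  case: ltngtP => [ik|ik|ik]; last by rewrite subrr; exact: subspace0 (FaS _).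
    rewrite sub0r; apply: subspaceN (FaS _) _; apply: subspaceZ (FaS _) _.
    by apply: lspan_gen; exists (w i).
  by rewrite ck// scale0r subr0; exact: subspace0 (FaS _).
- by rewrite mem_filter kj eqxx.
Qed.

End Derivation.

(** [ts] is a system of representatives of the words of degree n up to permutation, so no ordering
    of the letters has to be chosen. *)
Theorem prim_prod_dim n (ts : seq (seq I)) : uniq ts ->
  (forall t, t \in ts -> seq_degree t = n) ->
  {in ts &, forall s t, perm_eq s t -> s = t} ->
  (forall s, seq_degree s = n -> exists2 t, t \in ts & perm_eq s t) ->
  has_dim (gr n) (size ts).
Proof.
move=> uts dts its cts; have [l lP] := prim_basis_dual.
apply: (has_dim_seq (v := ep)) => // [t /dts <-|x|c c0 t tts]; first exact: prim_prod_gr.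
  move=> /gr_prim_prod_span; apply: (lspan_min (subspace_lspan _)) => _ [s /= sn <-].
  (* Spanning by induction on length: a word differs from its representative by shorter products of
     the same degree. *)
  move: {2}(size s).+1 (ltnSn (size s)) => k; elim: k s sn => // k IH s sn sk.
  have [t tts st] := cts s sn.
  rewrite -[ep s](subrK (ep t)); apply: (subspaceD (subspace_lspan _)); last first.
    by apply: lspan_gen; exists t.
  have := prim_prod_perm st; apply: (lspan_min (subspace_lspan _)) => _ [u [us ud] <-].
  by apply: IH; [rewrite ud|exact: leq_trans us sk].
exact: (prim_prod_free lP uts its c0 tts).
Qed.

End OrderedMonomials.

Local Close Scope classical_set_scope.

(** * Power series and multisets *)

Section PsmulTheory.
Implicit Types f g h : nat -> rat.

Let trunc n f : {poly rat} := \poly_(i < n.+1) f i.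

Let psmulE n f g m : (m <= n)%N -> psmul f g m = (trunc n f * trunc n g)`_m.
Proof.
move=> mn; rewrite coefM; apply: eq_bigr => i _; rewrite !coef_poly !ltnS.
have im : (i <= m)%N by rewrite -ltnS.
by rewrite (leq_trans im mn) (leq_trans (leq_subr _ _) mn).
Qed.

(** Coefficients up to n see only the truncations, so associativity is inherited from
    polynomials. *)
Lemma psmulA f g h : psmul f (psmul g h) = psmul (psmul f g) h.
Proof.
apply/funext => n; transitivity ((trunc n f * trunc n g * trunc n h)`_n).
  rewrite -mulrA coefM; apply: eq_bigr => i _; rewrite coef_poly ltn_ord.
  by rewrite -(psmulE _ _ (leq_subr _ _)).
rewrite coefM; apply: eq_bigr => i _; rewrite coef_poly ltnS leq_subr.
by rewrite -(@psmulE n)// -ltnS.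
Qed.

Lemma psmul1l f : psmul psone f = f.
Proof.
apply/funext => n; rewrite /psmul big_ord_recl /= subn0 mul1r big1 ?addr0// => i _.
by rewrite mul0r.
Qed.

Lemma gbinom0 x : gbinom x 0 = 1.
Proof. by rewrite /gbinom big_ord0 fact0 divr1. Qed.

Lemma gbinom1 x : gbinom x 1 = x.
Proof. by rewrite /gbinom big_ord1 subr0 divr1. Qed.

Lemma gbinomS x m : gbinom x m.+1 = gbinom x m * (x - m%:R) / m.+1%:R.
Proof.
rewrite /gbinom big_ord_recr /= factS natrM invfM.
by rewrite -!mulrA; congr (_ * _); rewrite [LHS]mulrA [LHS]mulrC.
Qed.

Lemma gbinom_nat n m : gbinom n%:R m = 'C(n, m)%:R.
Proof.
elim: m => [|m IH]; first by rewrite gbinom0 bin0.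
have m0 : m.+1%:R != 0 :> rat by rewrite pnatr_eq0.
rewrite gbinomS IH; apply: (mulIf m0); rewrite mulfVK// -natrM.
have [mn|nm] := leqP m n.
  by rewrite -natrB// -natrM; congr (_%:R); rewrite [LHS]mulnC [RHS]mulnC mul_bin_left.
by rewrite !bin_small ?mul0r// (ltn_trans nm).
Qed.

(** The case p = 0, where the upper index of the binomial is one less than the lower; it yields (1 -
    t^d)^0 = 1. *)
Lemma gbinom_m1 m : gbinom ((0 + m.+1%:R) - 1) m.+1 = 0.
Proof. by rewrite add0r -natr1 addrK gbinom_nat bin_small. Qed.

Lemma gbinom_pascal (p m : nat) :
  gbinom (p.+1%:R + m.+1%:R - 1) m.+1 =
  gbinom (p%:R + m.+1%:R - 1) m.+1 + gbinom (p.+1%:R + m%:R - 1) m.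
Proof.
have -> : p.+1%:R + m.+1%:R - 1 = (p + m).+1%:R :> rat.
  by rewrite -[m.+1%:R]natr1 addrA addrK -natrD.
have -> : p%:R + m.+1%:R - 1 = (p + m)%:R :> rat.
  by rewrite -[m.+1%:R]natr1 addrA addrK -natrD.
have -> : p.+1%:R + m%:R - 1 = (p + m)%:R :> rat.
  by rewrite -[p.+1%:R]natr1 addrAC addrK -natrD.
by rewrite !gbinom_nat binS natrD.
Qed.

Lemma ps_factor0E d p : (0 < d)%N -> ps_factor d p 0 = 1.
Proof. by move=> d0; rewrite /ps_factor dvdn0 div0n gbinom0. Qed.

Lemma ps_factor_small d p n : (0 < n < d)%N -> ps_factor d p n = 0.
Proof. by move=> /andP[n0 nd]; rewrite /ps_factor gtnNdvd. Qed.

Lemma ps_factor_p0 d : (0 < d)%N -> ps_factor d 0%:R = psone.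
Proof.
move=> d0; apply/funext => -[|n]; first by rewrite ps_factor0E.
rewrite /ps_factor /psone /=; case: ifP => // dn.
have : (0 < n.+1 %/ d)%N by rewrite divn_gt0// dvdn_leq.
by case: (n.+1 %/ d)%N => // m _; exact: gbinom_m1.
Qed.

Lemma ps_factor1E d n : ps_factor d 1 n = (d %| n)%:R.
Proof.
rewrite /ps_factor; case: ifP => // _.
by rewrite addrAC subrr add0r gbinom_nat binn.
Qed.

(** Coefficient form of (1 - t^d) (1 - t^d)^-(p+1) = (1 - t^d)^-p, by Pascal's rule. *)
Lemma ps_factor_pS d (p n : nat) : (0 < d)%N -> (d <= n)%N ->
  ps_factor d p.+1%:R n = ps_factor d p%:R n + ps_factor d p.+1%:R (n - d).
Proof.
move=> d0 dn; rewrite /ps_factor (dvdn_subl dn (dvdnn d)).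
case: ifP => [dvdn_n|]; last by rewrite addr0.
rewrite divnBr ?dvdnn// divnn d0 subn1.
have : (0 < n %/ d)%N by rewrite divn_gt0.
by case: (n %/ d)%N => // m _; rewrite gbinom_pascal.
Qed.

(** The quotient u = g / (1 - t^d) solves u = g + t^d u. Together with [ps_factor_pS], this shows
    that both sides of [ps_factorS] satisfy one recurrence. *)
Lemma psmul_geom d g n : (0 < d)%N ->
  psmul (ps_factor d 1) g n = g n + (if (d <= n)%N then psmul (ps_factor d 1) g (n - d) else 0).
Proof.
move=> d0; pose F i := ps_factor d 1 i * g (n - i)%N.
have F0 : F 0%N = g n by rewrite /F ps_factor0E// mul1r subn0.
have Fs i : (0 < i < d)%N -> F i = 0 by move=> id; rewrite /F ps_factor_small// mul0r.
rewrite /psmul -(big_mkord xpredT F).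
have [dn|nd] := leqP d n; last first.
  rewrite big_ltn// F0 big_nat big1 => [|i /andP[i0 id]]//.
  by apply: Fs; rewrite i0 (leq_trans id).
rewrite (big_cat_nat _ (n := d)) ?leqW// big_ltn// F0; congr (_ + _).
  by rewrite big_nat big1 => [|i id]; [exact: addr0|exact: Fs].
rewrite -{1}[d]add0n big_addn subSn// big_mkord; apply: eq_bigr => i _.
rewrite /F !ps_factor1E (dvdn_addl _ (dvdnn d)).
by rewrite addnC subnDA.
Qed.

Lemma ps_factorS d (p : nat) : (0 < d)%N ->
  ps_factor d p.+1%:R = psmul (ps_factor d 1) (ps_factor d p%:R).
Proof.
move=> d0; apply/funext => n; elim/ltn_ind: n => n IH; rewrite psmul_geom//.
have [dn|nd] := leqP d n.
  rewrite ps_factor_pS// IH// ltn_subrL d0.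
  exact: leq_trans d0 dn.
by rewrite addr0; case: n nd {IH} => [|n] nd; rewrite ?ps_factor0E ?ps_factor_small.
Qed.

(* The coefficient of [t^m] in a product depends on the exponent [p_m] only
   through the summand [p_m]. *)
Lemma h_p_related_inj h p q : h_p_related h p -> h_p_related h q -> p = q.
Proof.
move=> hp hq; apply/funext => m; elim/ltn_ind: m => m IH.
have [N NE] := hp m.+1; have [M ME] := hq m.+1.
pose L := maxn m.+1 (maxn N M).
have: (\big[psmul/psone]_(1 <= d < L.+1) ps_factor d (p d.-1)) m.+1 =
      (\big[psmul/psone]_(1 <= d < L.+1) ps_factor d (q d.-1)) m.+1.
  by rewrite NE ?ME// /L !leq_max leqnn !orbT.
(* Multiplying by a series with constant term 1 preserves this relation: the lower coefficients
   agree, so only the constant term meets the difference in degree m + 1. *)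
pose agree f g := (forall i, (i <= m)%N -> f i = g i) /\ f m.+1 - g m.+1 = p m - q m.
have mul_agree F f g : F 0%N = 1 -> agree f g -> agree (psmul F f) (psmul F g).
  move=> F0 [fg fgm]; split=> [i im|].
    by apply: eq_bigr => j _; rewrite fg// (leq_trans (leq_subr _ _)).
  rewrite /psmul -sumrB big_ord_recl big1 => [|j _].
    by rewrite subn0 F0 !mul1r addr0.
  by rewrite lift0 subSS fg ?leq_subr// subrr.
pose P r s := \big[psmul/psone]_(d <- s) ps_factor d (r d.-1).
have P0 r s : all (leq 1) s -> P r s 0%N = 1.
  elim: s => [|d s IHs]; rewrite /P ?big_nil// big_cons => /andP[d0 s0].
  by rewrite /psmul big_ord1 -/(P r s) IHs// ps_factor0E// mulr1.
have Psmall r s i : all (leq m.+2) s -> (0 < i <= m.+1)%N -> P r s i = 0.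
  elim: s i => [|d s IHs] i; first by rewrite /P big_nil; case: i.
  rewrite /P big_cons -/(P r s) => /andP[md ms] /andP[i0 im].
  rewrite /psmul big_ord_recl subn0 IHs ?i0// mulr0 add0r big1// => j _.
  rewrite ps_factor_small ?mul0r// lift0 /= (leq_trans _ md)// !ltnS.
  by rewrite -ltnS; apply: leq_trans im; rewrite ltn_ord.
(* Factors with d <= m coincide by induction, since [ps_factor d] uses the exponent at [d.-1]. The
   factor d = m + 1 carries p_m, and later factors are 1 through degree m + 1. *)
have -> : index_iota 1 L.+1 = iota 1 m ++ m.+1 :: iota m.+2 (L - m.+1).
  rewrite /index_iota subn1 /= -{1}(@subnKC m.+1 L) ?leq_maxl//.
  by rewrite addSnnS iotaD /= add1n; congr (_ ++ _).
have pos k : all (leq 1) (iota m.+2 k).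
  by apply/allP => d; rewrite mem_iota /= => /andP[md _]; apply: leq_trans md.
have big k : all (leq m.+2) (iota m.+2 k).
  by apply/allP => d; rewrite mem_iota => /andP[].
set T := iota m.+2 _; have posT : all (leq 1) T by exact: pos.
have bigT : all (leq m.+2) T by exact: big.
suff [_ E] : agree (P p (iota 1 m ++ m.+1 :: T)) (P q (iota 1 m ++ m.+1 :: T)).
  by rewrite -/(P p _) -/(P q _) => PE; apply/eqP; rewrite -subr_eq0 -E PE subrr.
have base : agree (P p (m.+1 :: T)) (P q (m.+1 :: T)).
  have PE r i : (i <= m.+1)%N -> P r (m.+1 :: T) i = ps_factor m.+1 (r m) i.
    move=> im; rewrite /P big_cons /= -/(P r T) /psmul big_ord_recr /= subnn P0// mulr1.
    rewrite big1 ?add0r// => j _; rewrite Psmall ?mulr0// subn_gt0 ltn_ord.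
    exact: leq_trans (leq_subr _ _) im.
  split=> [i im|]; last first.
    by rewrite !PE// /ps_factor dvdnn divnn /= !gbinom1 !addrK.
  rewrite !PE ?leqW//; case: i im => [|i] im; first by rewrite !ps_factor0E.
  by rewrite !ps_factor_small.
have : all (fun d => 0 < d <= m)%N (iota 1 m).
  by apply/allP => d; rewrite mem_iota add1n ltnS.
elim: (iota 1 m) => [//|d s IHs] /= /andP[/andP[d0 dm] sm].
rewrite /P !big_cons -/(P p _) -/(P q _) IH ?prednK//.
by apply: mul_agree (IHs sm); exact: ps_factor0E.
Qed.

End PsmulTheory.

(** * Multisets of letters and their generating series *)

Section Multisets.
Variable p : nat -> nat.
Local Notation I := (seq_gens p).
Local Notation deg x := (tag (x : I)).+1.

(* One word for each multiset of letters of [l] of total degree [n]. *)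
Fixpoint multisets (l : seq I) (n : nat) : seq (seq I) :=
  if l is x :: l' then
    [seq nseq (i %/ deg x) x ++ w | i <- [seq i <- iota 0 n.+1 | (deg x %| i)%N],
                                   w <- multisets l' (n - i)]
  else if n is 0 then [:: [::]] else [::].

Lemma multisets_consP x l n s : reflect
  (exists i w, [/\ (i <= n)%N, (deg x %| i)%N, w \in multisets l (n - i) &
                   s = nseq (i %/ deg x) x ++ w])
  (s \in multisets (x :: l) n).
Proof.
apply: (iffP allpairsPdep) => -[i [w []]].
  rewrite mem_filter mem_iota add0n ltnS => /andP[di ni] wl ->.
  by exists i, w.
move=> ni di wl ->; exists i, w; split=> //.
by rewrite mem_filter mem_iota add0n ltnS di.
Qed.

Lemma seq_degree_cat (s t : seq I) : seq_degree (s ++ t) = (seq_degree s + seq_degree t)%N.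
Proof. exact: big_cat. Qed.

Lemma seq_degree_nseq k x : seq_degree (nseq k x : seq I) = (k * deg x)%N.
Proof. by rewrite /seq_degree big_nseq iter_addn_0 mulnC. Qed.

Lemma multisets_sub l n s : s \in multisets l n -> {subset s <= l}.
Proof.
elim: l n s => [|x l IH] n s; first by case: n => [|n] //=; rewrite inE => /eqP ->.
move=> /multisets_consP[i [w [_ _ /IH wl ->]]] y.
by rewrite mem_cat mem_nseq inE => /orP[/andP[_ ->]//|/wl ->]; rewrite orbT.
Qed.

Lemma multisets_degree l n s : s \in multisets l n -> seq_degree s = n.
Proof.
elim: l n s => [|x l IH] n s.
  by case: n => [|n] //=; rewrite inE => /eqP ->; rewrite /seq_degree big_nil.
move=> /multisets_consP[i [w [ni di /IH wl ->]]].
by rewrite seq_degree_cat seq_degree_nseq wl divnK// subnKC.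
Qed.

Lemma multisets_perm_inj l n : uniq l ->
  {in multisets l n &, forall s t, perm_eq s t -> s = t}.
Proof.
elim: l n => [|x l IH] n /=.
  by move=> _ s t; case: n => [|n] //; rewrite !inE => /eqP-> /eqP->.
move=> /andP[xl ul] _ _ /multisets_consP[i [s [ni di sl ->]]] /multisets_consP[j [t [nj dj tl ->]]] st.
have c0 k w : w \in multisets l k -> count_mem x w = 0%N.
  by move=> wl; apply/count_memPn; apply: contra xl => /(multisets_sub wl).
have ij : i = j.
  rewrite -[X in X = _](divnK di) -[X in _ = X](divnK dj); congr (_ * _)%N.
  have /permP/(_ (pred1 x)) := st.
  by rewrite !count_cat !count_nseq /= eqxx !mul1n (c0 _ _ sl) (c0 _ _ tl) !addn0.
by subst j; congr (_ ++ _); apply: (IH (n - i)%N) => //; rewrite -(perm_cat2l (nseq (i %/ deg x) x)).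
Qed.

Lemma multisets_uniq l n : uniq l -> uniq (multisets l n).
Proof.
elim: l n => [|x l IH] n; first by case: n.
rewrite cons_uniq => /andP[xl ul].
apply: (@allpairs_uniq_dep _ (fun=> seq I) _ (fun i w => nseq (i %/ deg x) x ++ w)) => [|i _|].
- by rewrite filter_uniq// iota_uniq.
- exact: IH.
move=> [i s] [j t] /allpairsPdep[i' [s' [ii' s'l [-> ->]]]] /allpairsPdep[j' [t' [jj' t'l [-> ->]]]] /= E.
have c0 k w : w \in multisets l k -> count_mem x w = 0%N.
  by move=> wl; apply/count_memPn; apply: contra xl => /(multisets_sub wl).
have ij : (i' %/ deg x)%N = (j' %/ deg x)%N.
  have := congr1 (count_mem x) E.
  by rewrite !count_cat !count_nseq /= eqxx !mul1n (c0 _ _ s'l) (c0 _ _ t'l) !addn0.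
move: ii' jj'; rewrite !mem_filter => /andP[di _] /andP[dj _].
move/eqP: E; rewrite ij eqseq_cat// eqxx => /eqP ->.
by rewrite -(divnK di) -(divnK dj) ij.
Qed.

Lemma multisets_complete l s : uniq l -> {subset s <= l} ->
  exists2 t, t \in multisets l (seq_degree s) & perm_eq s t.
Proof.
elim: l s => [|x l IH] s /=.
  case: s => [|y s] _ sl; first by exists [::]; rewrite // /seq_degree big_nil.
  by have := sl y; rewrite inE eqxx => /(_ isT).
move=> /andP[xl ul] sl; pose s' := [seq y <- s | y != x].
have [|t ts st] := IH s' ul.
  move=> y; rewrite mem_filter => /andP[yx /sl]; rewrite inE (negPf yx).
  by [].
have ps : perm_eq s (nseq (count_mem x s) x ++ s').
  rewrite -(perm_filterC (pred1 x) s) perm_cat2r.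
  have /all_pred1P -> : all (pred1 x) (filter (pred1 x) s) by exact: filter_all.
  by rewrite size_filter.
have ds : seq_degree s = (count_mem x s * deg x + seq_degree s')%N.
  by rewrite {1}/seq_degree (perm_big _ ps) -/(seq_degree _) seq_degree_cat seq_degree_nseq.
exists (nseq (count_mem x s) x ++ t); last by rewrite (perm_trans ps)// perm_cat2l.
apply/multisets_consP; exists (count_mem x s * deg x)%N, t; split.
- by rewrite ds leq_addr.
- exact: dvdn_mull.
- by rewrite ds addKn.
- by rewrite mulnK.
Qed.

Definition multiset_count l : nat -> rat := fun n => (size (multisets l n))%:R.

Lemma multiset_count_nil : multiset_count [::] = psone.
Proof. by apply/funext => -[]. Qed.

(** The copies of x occupy a total degree i that is a multiple of deg x, each multiple exactly once;
    this is the geometric series in t^(deg x). *)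
Lemma multiset_count_cons x l :
  multiset_count (x :: l) = psmul (ps_factor (deg x) 1) (multiset_count l).
Proof.
apply/funext => n; rewrite /multiset_count [size (multisets (x :: l) n)]size_allpairs_dep sumnE !big_map big_filter.
rewrite natr_sum /psmul -(big_mkord xpredT (fun i => ps_factor (deg x) 1 i * (size (multisets l (n - i)))%:R)).
rewrite /index_iota subn0 [LHS]big_mkcond; apply: eq_bigr => i _.
by rewrite ps_factor1E; case: ifP; rewrite ?mul1r ?mul0r.
Qed.

Lemma multiset_count_block m (s : seq I) l : (forall x, x \in s -> tag x = m) ->
  multiset_count (s ++ l) = psmul (ps_factor m.+1 (size s)%:R) (multiset_count l).
Proof.
elim: s => [|x s IH] sm /=; first by rewrite ps_factor_p0// psmul1l.
rewrite multiset_count_cons IH => [|y ys]; last by apply: sm; rewrite inE ys orbT.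
by rewrite (sm x) ?inE ?eqxx// psmulA -ps_factorS.
Qed.

Lemma multiset_count_gens M : multiset_count (gens_below p M) =
  \big[psmul/psone]_(1 <= d < M.+1) ps_factor d (natseq p d.-1).
Proof.
rewrite /index_iota subn1 /= -[1%N]addn0 iotaDl big_map /gens_below.
elim: (iota 0 M) => [|m ms IH]; first by rewrite big_nil multiset_count_nil.
rewrite big_cons /= -IH; rewrite (@multiset_count_block m) ?size_map.
  by rewrite -enumT size_enum_ord add0n add1n.
by move=> x /mapP[i _ ->].
Qed.

End Multisets.

(** * The classification *)

Lemma h_a_related_rec (h a : nat -> rat) : h_a_related h a <->
  forall n, h n = \sum_(i < n.+1) ps1add h i * a (n - i)%N.
Proof.
have E n : psmul (ps1add h) (ps1add (fun k => - a k)) n.+1 =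
    h n - \sum_(i < n.+1) ps1add h i * a (n - i)%N.
  rewrite /psmul big_ord_recr /= subnn mulr1 addrC -sumrN; congr (_ + _).
  by apply: eq_bigr => i _; rewrite subSn -1?ltnS//= mulrN.
split=> [ha n|ha [|n]]; first by have := ha n.+1; rewrite E => /subr0_eq.
  by rewrite /psmul big_ord1 mulr1.
by rewrite E -ha subrr.
Qed.

Lemma h_a_related_inj (h h' a : nat -> rat) :
  h_a_related h a -> h_a_related h' a -> h = h'.
Proof.
move=> /h_a_related_rec hE /h_a_related_rec hE'; apply/funext => n.
elim/ltn_ind: n => n IH; rewrite hE hE'; apply: eq_bigr => -[[|i] //= ni] _.
by rewrite IH.
Qed.

Lemma natseq_inj : injective natseq.
Proof.
move=> a b ab; apply/funext => n.
by have /eqP := congr1 (fun c => c n) ab; rewrite /natseq eqr_nat => /eqP.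
Qed.

Lemma nwords_related a : h_a_related (natseq (fun n => nwords a n.+1)) (natseq a).
Proof.
apply/h_a_related_rec => n; rewrite /natseq nwordsS natr_sum.
(* [nwordsS] sums over the degree of the first letter, the recurrence over the degree of the
   remaining word. *)
rewrite (reindex_inj rev_ord_inj) /=; apply: eq_bigr => i _.
have iE : (i <= n)%N by rewrite -ltnS.
rewrite subSS subKn// natrM mulrC; congr (_ * _).
by case: (i : nat) => [|k]; rewrite ?nwords0.
Qed.

Section Presented.
Variables (K : fieldType) (a : nat -> nat) (H : hopf_data K).
Variable f : freealg K (seq_gens a) -> H.
Hypothesis fP : prim_presentation f.

Lemma dim_seq_related : h_a_related (natseq (dim_seq H)) (natseq a).
Proof. by rewrite (pp_dim_seq fP); exact: nwords_related. Qed.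

Lemma primitive_dim_seq_related : [pchar K] =i pred0 ->
  h_p_related (natseq (dim_seq H)) (natseq (primitive_dim_seq H)).
Proof.
(* The coefficient of t^n is stable from M = n on: a letter of a word of degree n has degree at most
   n, hence lies in [gens_below M]. *)
move=> K0 n; exists n => M nM; rewrite -multiset_count_gens /multiset_count.
set ts := multisets _ n.
have ug := gens_below_uniq (primitive_dim_seq H) M.
have tsP : has_dim (@hgr K H n) (size ts).
  apply: (prim_prod_dim fP K0) => [|t||s sn].
  - exact: multisets_uniq.
  - exact: multisets_degree.
  - exact: multisets_perm_inj.
  rewrite /ts -{1}sn; apply: multisets_complete => // x xs.
  rewrite mem_gens_below; apply: leq_trans nM; rewrite -sn /seq_degree.
  by rewrite (big_rem x)//= leq_addr.
rewrite (has_dim_uniq (gr_subspace (pp_grading fP) n) tsP (pp_dim fP n)).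
(* In degree 0 the constant term of [ps1add] is matched by the empty word. *)
by rewrite (pp_dim_seq fP); case: n {nM ts tsP}.
Qed.

End Presented.

Lemma hopf_iso_nwords (K : fieldType) a b :
  hopf_iso (env_free_lie K a) (env_free_lie K b) -> nwords a = nwords b.
Proof.
move=> [phi [phib phigr _ _]]; apply/funext => n.
have Pa := env_free_lie_presentation K a; have Pb := env_free_lie_presentation K b.
apply: has_dim_uniq (gr_subspace (pp_grading Pb) n) _ (pp_dim Pb n).
apply: (has_dim_bij (linearP phi) phib _ _ (phigr n) (pp_dim Pa n)).
  exact: gr_subspace (pp_grading Pa) n.
exact: gr_subspace (pp_grading Pb) n.
Qed.

Theorem theorem4p2 (R : realType) :
  (* a |-> U(L(a)) is a bijection from sequences onto isomorphism classes *)
  [/\ (forall a : nat -> nat, FGCCHA (env_free_lie R[i] a)),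
      (forall a b : nat -> nat,
         hopf_iso (env_free_lie R[i] a) (env_free_lie R[i] b) -> a = b) &
      (forall H : hopf_data R[i], FGCCHA H ->
         exists a : nat -> nat, hopf_iso H (env_free_lie R[i] a))] /\
  (* its inverse is H |-> phi_ha (dim H) *)
  ((forall a : nat -> nat,
      phi_ha (natseq (dim_seq (env_free_lie R[i] a))) = natseq a) /\
   (forall H : hopf_data R[i], FGCCHA H ->
      exists a : nat -> nat, phi_ha (natseq (dim_seq H)) = natseq a /\
        hopf_iso H (env_free_lie R[i] a))) /\
  (forall h : nat -> nat,
     (exists H : hopf_data R[i], FGCCHA H /\ dim_seq H = h) <->
     (exists a : nat -> nat, phi_ha (natseq h) = natseq a)) /\
  (forall p : nat -> nat,
     (exists H : hopf_data R[i], FGCCHA H /\ primitive_dim_seq H = p) <->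
     (exists a : nat -> nat, phi_pa (natseq p) = natseq a)).
Proof.
have K0 : [pchar R[i]] =i pred0 := @pchar_num R[i].
have envP (a : nat -> nat) := env_free_lie_presentation R[i] a.
have envF a : FGCCHA (env_free_lie R[i] a) := pp_FGCCHA (envP a).
have presH (H : hopf_data R[i]) : FGCCHA H ->
    exists a (f : freealg R[i] (seq_gens a) -> H), prim_presentation f.
  by move=> hH; exact: FGCCHA_presentation hH K0.
have phiE (h : nat -> rat) a : h_a_related h a -> phi_ha h = a.
  exact: h_a_related_uniq (phi_haP h).
have isoH (H : hopf_data R[i]) : FGCCHA H -> exists a : nat -> nat,
    phi_ha (natseq (dim_seq H)) = natseq a /\ hopf_iso H (env_free_lie R[i] a).
  move=> /presH[a [f fP]]; exists a; split; first exact: phiE (dim_seq_related fP).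
  exact: prim_presentation_iso fP (envP a).
split; last split; last split.
- split=> [//|a b /hopf_iso_nwords ab|H /isoH[a [_ ?]]]; last by exists a.
  apply/natseq_inj/(h_a_related_uniq (nwords_related a)).
  by rewrite ab; exact: nwords_related.
- by split=> // a; exact: phiE (dim_seq_related (envP a)).
- move=> h; split=> [[H [/isoH[a [aE _]] <-]]|[a aE]]; first by exists a.
  exists (env_free_lie R[i] a); split=> //; apply/natseq_inj.
  apply: h_a_related_inj (dim_seq_related (envP a)) _.
  by rewrite -aE; exact: phi_haP.
- move=> p; split=> [[H [/presH[a [f fP]] <-]]|[a aE]].
  exists a; have [h [hp ha]] := phi_paP (natseq (primitive_dim_seq H)).
  (* [phi_paP] provides some series h with exponents p; the product formula shows that it is the
     dimension series of [H]. *)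
  have hE := ps_infprod_uniq hp (primitive_dim_seq_related fP K0).
  apply: h_a_related_uniq ha _.
  have -> : h = natseq (dim_seq H).
    by apply/funext => n; have := congr1 (fun g => g n.+1) hE.
  exact: dim_seq_related fP.
(* U(L(a)) has dimension series h, since [a] determines h. Its primitive dimensions are then
   exponents of the same product as p, and exponents are unique. *)
have [h [hp]] := phi_paP (natseq p); rewrite aE => ha.
exists (env_free_lie R[i] a); split=> //; apply/natseq_inj.
apply: h_p_related_inj (primitive_dim_seq_related (envP a) K0) _.
by rewrite (h_a_related_inj (dim_seq_related (envP a)) ha).
Qed.
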